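(* Let $\mu\in\mathrm{dom}(\alpha)$ be critical, $\alpha\in(1,2]$, with associated slowly varying function $L$, and consider $\mathcal T$-walks in $\mathbb Z^d$ with $\theta$-jumps. Assume that (i) either $d>\frac{2\alpha}{\alpha-1}$, or $d=\frac{2\alpha}{\alpha-1}$ and $\sum_{n\ge1}\frac{L(n^{2/(\alpha-1)})}{n}<+\infty$; (ii) the jump distribution $\theta$ has a finite moment of order $d-1$. Then for all finite $A\subset\mathbb Z^d$, $$\mathbb P(\mathcal T^x\cap A\neq\emptyset)\ \sim_{x\to\infty}\ \mathrm{BCap}(A)\,g_\theta(x).$$
   Context: Offspring distribution: $\mu$ is a probability distribution on $\mathbb N=\{0,1,2,\dots\}$, critical ($\sum_k k\mu(k)=1$, $\mu\neq\delta_1$); $\mu\in\mathrm{dom}(\alpha)$ means that $\mathrm{Gen}_\mu(s)=\sum_k\mu(k)s^k$ satisfies $\mathrm{Gen}_\mu(1-s)-(1-s)=s^\alpha L(1/s)$ for $s\in(0,1]$ with $L$ slowly varying at $+\infty$. Jump distribution: $\theta$ is centered on $\mathbb Z^d$ with invertible covariance matrix $\Sigma_\theta^2$; $\|x\|=|\Sigma_\theta^{-1}x|$ with $|\cdot|$ Euclidean. $g_\theta(x)=\sum_{n\ge0}\mathbb P_0(S_n=x)$ is the Green function of the random walk $S$ with $\theta$-jumps. Standing assumption: $g_\theta(x)\sim_{x\to\infty}C_\theta\|x\|^{2-d}$ with $C_\theta=\Gamma(\frac{d-2}2)/(2\sqrt{\det(\pi\Sigma_\theta^2)})$. $f(x)\sim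 g(x)$ means $f(x)=g(x)(1+o(1))$. $\mathcal T$ is a $\mu$-Bienaymé (Galton–Watson) tree. A $T$-walk started at $x$ with $\theta$-jumps, $W_T^x$, has, given the tree, i.i.d. increments with law $\theta$ along the edges (from parent to child) and takes value $x$ at the root (at $c_0$ for $\mathcal T_\infty$ below). For a set $\mathcal V$ of vertices of the tree, $\mathcal V^x=\{W_T^x(u):u\in\mathcal V\}$; in particular $\mathcal T^x$ is the set of positions visited by the $\mathcal T$-walk started at $x$. Infinite tree $\mathcal T_\infty$: it has an infinite spine $(c_0,c_{-1},c_{-2},\dots)$ in which $c_{-i-1}$ is the parent of $c_{-i}$ for all $i\ge0$. Independently for $k\ge1$, $c_{-k}$ has a number of children distributed according to $\mu'(j)=j\mu(j)$, and $c_{-k+1}$ is placed uniformly among these (ordered) children. All other vertices, including $c_0$, have independent numbers of (ordered) children with law $\mu$. Depth-first order $\preceq$: $u\preceq v$ iff $u$ is $v$ or an ancestor of $v$, or, with $w$ the last common ancestor of $u,v$, the child of $w$ equal to or an ancestor of $u$ comes before the child of $w$ equal to or an ancestor of $v$. $\mathcal T_+=\{u\in\mathcal T_\infty:c_0\prec u\}$. Branching capacity of a finite $A\subset\mathbb Z^d$: $\mathrm{BCap}(A)=\sum_{a\in A}\mathbb P(\mathcal T_+^a\cap A=\emptyset)$. *)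

(* Defs.v *)
From HB Require Import structures.
From mathcomp Require Import all_boot all_order all_algebra.
From mathcomp Require Import finmap.
From mathcomp Require Import all_classical all_reals all_analysis.

Set Implicit Arguments.
Unset Strict Implicit.
Unset Printing Implicit Defensive.

Import Order.TTheory GRing.Theory Num.Theory.
Import numFieldNormedType.Exports.

Local Open Scope classical_set_scope.
Local Open Scope ring_scope.

(* Z^d, with the sigma-algebra of all its subsets. *)
Definition lattice (d : nat) : Type := 'rV[int]_d.

HB.instance Definition _ (d : nat) := GRing.Zmodule.on (lattice d).
HB.instance Definition _ (d : nat) := isPointed.Build (lattice d) 0.
HB.instance Definition _ (d : nat) :=
  @isMeasurable.Build default_measure_display (lattice d)
    discrete_measurable discrete_measurable0
    discrete_measurableC discrete_measurableU.

Definition lcoord (R : realType) (d : nat) (i : 'I_d) (x : lattice d) : R :=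
  (x ord0 i)%:~R.

Definition to_real (R : realType) (d : nat) (x : lattice d) : 'rV[R]_d :=
  \row_i lcoord R i x.

Definition eucl (R : realType) (d : nat) (v : 'rV[R]_d) : R :=
  Num.sqrt (\sum_i v ord0 i ^+ 2).

(* The filter "x -> oo" on Z^d. *)
Definition lattice_infty (R : realType) (d : nat) : set_system (lattice d) :=
  [set U | exists M : R, forall x, M < eucl (to_real R x) -> U x].

Arguments lattice_infty : clear implicits.

#[global] Instance lattice_infty_filter (R : realType) (d : nat) :
  Filter (lattice_infty R d).
Proof.
split; first by exists 0.
- move=> U V [M HU] [M' HV]; exists (Num.max M M') => x.
  by rewrite gt_max => /andP[/HU ? /HV ?].
- by move=> U V UV [M HU]; exists M => x /HU /UV.
Qed.

Canonical lattice_infty_filterType (R : realType) (d : nat) :=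
  FilterType (lattice_infty R d) (lattice_infty_filter R d).

Section Independence.
Local Open Scope ereal_scope.

(* sigma(X) *)
Definition events_of (dO dE : measure_display) (Om : measurableType dO)
    (E : measurableType dE) (X : Om -> E) : set_system Om :=
  [set X @^-1` B | B in measurable].

Definition mutually_independent (R : realType) (dO : measure_display)
    (Om : measurableType dO) (P : probability Om R)
    (I : choiceType) (E : I -> set_system Om) : Prop :=
  forall (J : {fset I}) (F : I -> set Om),
    (forall i, i \in J -> E i (F i)) ->
    P (\bigcap_(i in [set` J]) F i) = \prod_(i <- J) P (F i).

Definition has_law (R : realType) (dO dE : measure_display)
    (Om : measurableType dO) (E : measurableType dE) (P : probability Om R)
    (X : {RV P >-> E}) (nu : probability E R) : Prop :=
  forall B, measurable B -> distribution P X B = nu B.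

End Independence.

Section OffspringLaw.
Context {R : realType}.
Implicit Types (mu : probability nat R) (L : R -> R).

Definition mass mu (k : nat) : R := fine (mu [set k]).

Definition critical mu : Prop :=
  (\sum_(0 <= k <oo) (k%:R * mass mu k)%:E = 1)%E /\
  ~ (forall B : set nat, mu B = \d_1%N B).

Definition Gen mu (s : R) : R :=
  limn (series (fun k => mass mu k * s ^+ k)).

Definition slowly_varying L : Prop :=
  (exists a : R, measurable_fun `[a, +oo[ L /\ forall t, a <= t -> 0 < L t) /\
  (forall c : R, 0 < c -> L (c * t) / L t @[t --> +oo] --> (1 : R)).

Definition in_dom mu (alpha : R) L : Prop :=
  slowly_varying L /\
  forall s : R, 0 < s <= 1 ->
    Gen mu (1 - s) - (1 - s) = s `^ alpha * L s^-1.

End OffspringLaw.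

Section JumpLaw.
Context {R : realType} {d : nat}.
Implicit Types (theta : probability (lattice d) R) (Sigma : 'M[R]_d).

Definition finite_moment theta (q : nat) : Prop :=
  (\int[theta]_x (eucl (to_real R x) ^+ q)%:E < +oo)%E.

Definition cov_matrix theta : 'M[R]_d :=
  \matrix_(i, j) fine (covariance theta (@lcoord R d i) (@lcoord R d j)).

(* The finite second moment is what makes the mean and the covariance matrix
   (built from total integrals) meaningful. *)
Definition centered_nondegenerate theta : Prop :=
  [/\ finite_moment theta 2,
      forall i, ('E_theta[@lcoord R d i] = 0)%E
    & cov_matrix theta \in unitmx].

(* Sigma is the nonnegative symmetric square root of C. *)
Definition is_sqrtmx Sigma (C : 'M[R]_d) : Prop :=
  [/\ Sigma^T = Sigma,
      forall v : 'rV[R]_d, 0 <= (v *m Sigma *m v^T) ord0 ord0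
    & Sigma *m Sigma = C].

Definition sigma_norm Sigma (x : lattice d) : R :=
  eucl (to_real R x *m invmx Sigma).

Definition Gamma (s : R) : R :=
  fine (\int[@lebesgue_measure R]_(t in `]0%R, +oo[)
          (t `^ (s - 1) * expR (- t))%:E)%E.

Definition C_green theta : R :=
  Gamma ((d%:R - 2) / 2) / (2 * Num.sqrt (\det (pi *: cov_matrix theta))).

End JumpLaw.

Section RandomWalk.
Context {R : realType} {d : nat} {dO : measure_display}
  {Om : measurableType dO} {P : probability Om R}.
Implicit Types (xi : nat -> {RV P >-> lattice d}).

Definition walk_steps xi (theta : probability (lattice d) R) : Prop :=
  (forall n, has_law (xi n) theta) /\
  mutually_independent P (fun n => events_of (xi n)).

Definition green xi (x : lattice d) : \bar R :=
  (\sum_(0 <= n <oo) P [set w | (\sum_(j < n) xi j w)%R = x])%E.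

End RandomWalk.

(* Finite tree.  A vertex is a word, with the most recent generation first:
   [::] is the root and i :: p is the child number i of p. *)

Fixpoint in_tree (n : seq nat -> nat) (u : seq nat) : bool :=
  if u is i :: p then in_tree n p && (i < n p)%N else true.

Fixpoint tree_pos (d : nat) (x : lattice d) (xi : seq nat -> lattice d)
    (u : seq nat) : lattice d :=
  if u is i :: p then tree_pos x xi p + xi u else x.

(* T^x, from the numbers of children n and the increments xi, where xi u sits
   on the edge from the parent of u to u. *)
Definition tree_range (d : nat) (n : seq nat -> nat)
    (xi : seq nat -> lattice d) (x : lattice d) : set (lattice d) :=
  [set tree_pos x xi u | u in [set u | in_tree n u]].

Section TreeWalk.
Context {R : realType} {d : nat} {dO : measure_display}
  {Om : measurableType dO} {P : probability Om R}.
Implicit Types (N : seq nat -> {RV P >-> nat})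
  (X : seq nat -> {RV P >-> lattice d}).

Definition is_tree_walk N X (mu : probability nat R)
    (theta : probability (lattice d) R) : Prop :=
  [/\ forall u, has_law (N u) mu,
      forall u, has_law (X u) theta
    & mutually_independent P
        (fun i : seq nat + seq nat =>
           match i with
           | inl u => events_of (N u)
           | inr u => events_of (X u)
           end)].

Definition hit_prob N X (A : set (lattice d)) (x : lattice d) : R :=
  fine (P [set w | tree_range (N^~ w) (X^~ w) x `&` A !=set0]).

End TreeWalk.

(* Infinite tree.  (k, [::]) is the spine vertex c_{-k}, and (k, i :: p) is the
   child number i of (k, p).  The spine child of c_{-k}, for k > 0, is only
   (k.-1, [::]), hence the last condition in in_inf_tree below.

   s k is the pair (number of children of c_{-k-1}, rank of c_{-k} among them);
   n v is the number of children of a vertex v that is c_0 or off the spine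
   (n (k.+1, [::]) is not used). *)

Definition vertex : Type := (nat * seq nat)%type.

Section InfiniteTree.
Variables (s : nat -> nat * nat) (n : vertex -> nat).
Implicit Types u v w : vertex.

Definition nb_children v : nat :=
  if v is (k.+1, [::]) then (s k).1 else n v.

Definition parent v : vertex :=
  match v with
  | (k, [::]) => (k.+1, [::])
  | (k, _ :: p) => (k, p)
  end.

Definition rank v : nat :=
  match v with
  | (k, [::]) => (s k).2
  | (_, i :: _) => i
  end.

Fixpoint in_inf_tree_rec (k : nat) (p : seq nat) : bool :=
  if p is i :: q then
    [&& in_inf_tree_rec k q, (i < nb_children (k, q))%N
      & ~~ [&& (0 < k)%N, q == [::] & i == rank (k.-1, [::])]]
  else true.

Definition in_inf_tree v : bool := in_inf_tree_rec v.1 v.2.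

(* u is v or an ancestor of v *)
Definition anc_eq u v : Prop := exists m : nat, u = iter m parent v.

Definition last_common_anc w u v : Prop :=
  [/\ anc_eq w u, anc_eq w v
    & forall w', anc_eq w' u -> anc_eq w' v -> anc_eq w' w].

Definition dfs_le u v : Prop :=
  anc_eq u v \/
  exists w a b, [/\ last_common_anc w u v,
    parent a = w /\ anc_eq a u, parent b = w /\ anc_eq b v
    & (rank a < rank b)%N].

Definition root_inf : vertex := (0%N, [::]).

Definition T_plus : set vertex :=
  [set u | [/\ in_inf_tree u, dfs_le root_inf u & u != root_inf]].

End InfiniteTree.

(* xi v sits on the edge from the parent of v to v; the walk is x at c_0. *)
Fixpoint inf_pos_rec (d : nat) (x : lattice d) (xi : vertex -> lattice d)
    (k : nat) (p : seq nat) : lattice d :=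
  if p is i :: q then inf_pos_rec x xi k q + xi (k, p)
  else x - \sum_(j < k) xi (j : nat, [::]).

Definition inf_pos (d : nat) (x : lattice d) (xi : vertex -> lattice d)
    (v : vertex) : lattice d := inf_pos_rec x xi v.1 v.2.

Definition T_plus_range (d : nat) (s : nat -> nat * nat) (n : vertex -> nat)
    (xi : vertex -> lattice d) (x : lattice d) : set (lattice d) :=
  [set inf_pos x xi v | v in T_plus s n].

Section InfiniteTreeWalk.
Context {R : realType} {d : nat} {dO : measure_display}
  {Om : measurableType dO} {P : probability Om R}.
Implicit Types (S : nat -> {RV P >-> (nat * nat)%type})
  (N : vertex -> {RV P >-> nat}) (X : vertex -> {RV P >-> lattice d}).

(* Probability that there are j children, where j has law mu'(j) = j mu(j),
   and that a uniform one among them has rank i. *)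
Definition spine_mass (mu : probability nat R) (j i : nat) : R :=
  (j%:R * mass mu j) * (if (i < j)%N then j%:R^-1 else 0).

Definition is_inf_tree_walk S N X (mu : probability nat R)
    (theta : probability (lattice d) R) : Prop :=
  [/\ forall k j i,
        distribution P (S k) [set (j, i)] = (spine_mass mu j i)%:E,
      forall v, has_law (N v) mu,
      forall v, has_law (X v) theta
    & mutually_independent P
        (fun i : nat + (vertex + vertex) =>
           match i with
           | inl k => events_of (S k)
           | inr (inl v) => events_of (N v)
           | inr (inr v) => events_of (X v)
           end)].

Definition BCap S N X (A : set (lattice d)) : R :=
  \sum_(a \in A)
    fine (P [set w | T_plus_range (S^~ w) (N^~ w) (X^~ w) a `&` A = set0]).

End InfiniteTreeWalk.

(* Main.v *)
Require Import Defs.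
From HB Require Import structures.
From mathcomp Require Import all_boot all_order all_algebra.
From mathcomp Require Import finmap.
From mathcomp Require Import all_classical all_reals all_analysis.
From mathcomp Require Import ring lra zify.

Set Implicit Arguments.
Unset Strict Implicit.
Unset Printing Implicit Defensive.

Import Order.TTheory GRing.Theory Num.Theory.
Import numFieldNormedType.Exports.

Local Open Scope classical_set_scope.
Local Open Scope ring_scope.

(** Let q(x) be the probability that a tree walk started at x avoids A, let
    p = 1 - q, and let P be the averaging operator of the jump law (step). A tree
    avoids A if and only if its root does and the subtrees of all children do,
    so that q = 1_{A^c} gf(P q), where gf is the generating function of mu
    (avoid_limit_rec). Splitting according to the last child whose subtree hits
    A, that is summing by parts, 1 - gf(s) = branch_gf(s) (1 - s), where
    branch_gf is the generating function of the number of children after a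
    uniformly marked one under the size-biased law (branch_gf_gf). With the
    damping factor kap = branch_gf(P q) the nonlinear equation becomes linear in
    p, namely p = f + kap P p with f = 1_A gf(P q), and iteration gives
    p = sum_k (kap P)^k f (damped_fixpoint).

    The same operator describes the infinite tree. The k-th iterate of kap P,
    started from the part of f at a point a of A, gives at y the probability
    that c_{-k} is at y and that no branch leaving the spine after the marked
    child at c_0, ..., c_{-k} hits A, when c_0 is at a. Hence the total mass of
    (kap P)^k f decreases to BCap(A) (T_plus_avoid_cvg).

    It remains to compare the sum over k of (kap P)^k f, far from the origin,
    with that limit times the Green function (damped_pot_asymp). A finite mass
    seen from far away contributes at least its size times the Green function,
    by Fatou's lemma; since the potential of 1_A is equivalent to #A times the
    Green function, the mass that the damping has removed from 1_A by time m
    can be subtracted, which gives the upper bound. For the lower bound, what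
    the damping costs after time m has to be negligible (late_loss_small). The
    union bound p <= sum_n P^n 1_A and the decay of the Green function bound 1
    - kap(y) by psi(c |y|^(2 - d)), where psi(e) = e^(alpha - 1) L(1 / e). The
    corresponding losses, summed over the shell of radius 2^j, are of order 4^j
    psi(2^(- j (d - 2))), and the sum over j is finite: in high dimension
    because it is dominated by a geometric series, in the critical one by
    Cauchy condensation (dyadic_sum_ratio, dyadic_sum_critical). This estimate
    also shows that BCap(A) > 0 when A is not empty (BCap_gt0), so that the
    error is a relative one. *)

(** * Sums of nonnegative families *)

Section NonnegativeSums.
Local Open Scope ereal_scope.
Context {R : realType}.

Lemma esumZl (T : choiceType) (c : \bar R) (f : T -> \bar R) :
  0 <= c -> (forall x, 0 <= f x) ->
  \esum_(x in [set: T]) (c * f x) = c * \esum_(x in [set: T]) f x.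
Proof.
move=> c0 f0.
have le_real (r : R) (g : T -> \bar R) : (0 <= r)%R -> (forall x, 0 <= g x) ->
    \esum_(x in [set: T]) (r%:E * g x) <= r%:E * \esum_(x in [set: T]) g x.
  move=> r0 g0; apply: ge_ereal_sup => _ [X [finX _] <-].
  rewrite -ge0_mule_fsumr//; apply: lee_wpmul2l; first by rewrite lee_fin.
  by apply: ereal_sup_ubound; exists X.
case: c c0 => [r| |//]; rewrite ?lee_fin.
- rewrite le_eqVlt => /orP[/eqP <-|r0].
    by rewrite mul0e esum1// => x _; rewrite mul0e.
  apply/eqP; rewrite eq_le (le_real _ _ (ltW r0))//=.
  have r0E : 0 <= r%:E by rewrite lee_fin ltW.
  have rV0 : (0 <= r^-1)%R by rewrite invr_ge0 ltW.
  have := lee_wpmul2l r0E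
    (le_real _ (fun x => r%:E * f x) rV0 (fun x => mule_ge0 r0E (f0 x))).
  rewrite muleA -EFinM divff ?gt_eqF// mul1e => Hle; apply: (le_trans _ Hle); rewrite le_eqVlt.
  apply/orP; left; apply/eqP; congr (_ * _); apply: eq_esum => x _.
  by rewrite muleA -EFinM mulVf ?gt_eqF// mul1e.
- move=> _; have [f_eq0|] := pselect (forall x, f x = 0).
    by rewrite !esum1 ?mule0// => x _; rewrite f_eq0 mule0.
  move/existsNP => [x fx0].
  have fx : 0 < f x by rewrite lt_neqAle f0 andbT eq_sym; apply/eqP.
  have ge_term (g : T -> \bar R) : (forall y, 0 <= g y) ->
      g x <= \esum_(y in [set: T]) g y.
    move=> g0; apply: esum_ge; exists [set x].
      by split=> //; exact: finite_set1.
    by rewrite fsbig_set1.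
  rewrite gt0_mulye; last exact: lt_le_trans (ge_term _ f0).
  apply/eqP; rewrite -leye_eq.
  have := ge_term (fun y => +oo * f y) (fun y => mule_ge0 (leey _) (f0 y)).
  by rewrite gt0_mulye.
Qed.

Lemma esum_swap (T1 T2 : choiceType) (a : T1 -> T2 -> \bar R) :
  (forall i j, 0 <= a i j) ->
  \esum_(i in [set: T1]) \esum_(j in [set: T2]) a i j =
  \esum_(j in [set: T2]) \esum_(i in [set: T1]) a i j.
Proof.
move=> a0; rewrite !(@esum_esum _ _ _ setT (fun=> setT))//.
rewrite (reindex_esum ([set: T2] `*`` (fun=> [set: T1])) _
  (fun x => (x.2, x.1)))//; split=> //=.
  by move=> [i1 i2] [j1 j2] /= _ _ [] -> ->.
by move=> [i1 i2] _ /=; exists (i2, i1).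
Qed.

Lemma esum_term (T : choiceType) (f : T -> \bar R) (x : T) :
  (forall y, 0 <= f y) -> f x <= \esum_(y in [set: T]) f y.
Proof.
move=> f0; apply: esum_ge; exists [set x].
  by split=> //; exact: finite_set1.
by rewrite fsbig_set1.
Qed.

Lemma esum_shift (T : zmodType) (f : T -> \bar R) (a : T) :
  \esum_(x in [set: T]) f (x + a)%R = \esum_(x in [set: T]) f x.
Proof.
rewrite [RHS](reindex_esum [set: T] _ (fun x => (x + a)%R))//; split=> //.
  by move=> x y _ _ /addIr.
by move=> x _; exists (x - a)%R => //; rewrite subrK.
Qed.

Lemma esum_reflect (T : zmodType) (f : T -> \bar R) (a : T) :
  \esum_(x in [set: T]) f (a - x)%R = \esum_(x in [set: T]) f x.
Proof.
rewrite [RHS](reindex_esum [set: T] _ (fun x => (a - x)%R))//; split=> //.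
  by move=> x y _ _ /addrI/oppr_inj.
by move=> x _; exists (a - x)%R => //; rewrite opprB addrC subrK.
Qed.

Lemma nneseries_shift (f : nat -> \bar R) (m : nat) : (forall n, 0 <= f n) ->
  \sum_(m <= n <oo) f n = \esum_(n in [set: nat]) f (m + n)%N.
Proof.
move=> f0; rewrite -nneseries_addn// nneseries_esumT//.
by apply: eq_esum => n _; rewrite addnC.
Qed.

Lemma esum_nat_split (f : nat -> \bar R) (m : nat) : (forall n, 0 <= f n) ->
  \esum_(n in [set: nat]) f n =
  \sum_(0 <= n < m) f n + \esum_(n in [set: nat]) f (m + n)%N.
Proof.
move=> f0; rewrite -nneseries_esumT// (nneseries_split 0 m)// add0n.
by rewrite nneseries_shift.
Qed.

Lemma esum_nat_le (f : nat -> \bar R) (b : \bar R) : (forall n, 0 <= f n) ->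
  (forall m, \sum_(0 <= n < m) f n <= b) -> \esum_(n in [set: nat]) f n <= b.
Proof.
move=> f0 fb; rewrite -nneseries_esumT//.
by apply: lime_le; [exact: is_cvg_nneseries|apply: nearW => n; exact: fb].
Qed.

Lemma esum_partial_le (f : nat -> \bar R) m : (forall n, 0 <= f n) ->
  \sum_(0 <= n < m) f n <= \esum_(n in [set: nat]) f n.
Proof. by move=> f0; rewrite (esum_nat_split m f0) leeDl// esum_ge0. Qed.

Lemma esum_tail_small (f : nat -> \bar R) (e : R) : (forall n, 0 <= f n) ->
  \esum_(n in [set: nat]) f n < +oo -> (0 < e)%R ->
  exists m0, forall m, (m0 <= m)%N -> \esum_(n in [set: nat]) f (m + n)%N < e%:E.
Proof.
move=> f0 foo e0; rewrite -nneseries_esumT// in foo.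
have /fine_cvgP[_ /cvgrPdist_lt /(_ e e0)[m0 _ H]] :=
  nneseries_tail_cvg foo (fun k _ => f0 k).
exists m0 => m /H /=; rewrite nneseries_shift// sub0r normrN.
have tail0 : 0 <= \esum_(n in [set: nat]) f (m + n)%N by exact: esum_ge0.
rewrite ger0_norm ?fine_ge0// => lt_e; rewrite -[ltLHS]fineK ?lte_fin//.
rewrite ge0_fin_numE//; apply: le_lt_trans foo.
by rewrite nneseries_esumT// (esum_nat_split m f0) leeDr// sume_ge0.
Qed.

(** All that Fatou's lemma needs along a filter: finitely many terms can be
    controlled simultaneously. *)
Lemma esum_finite_approx (T : choiceType) (f : T -> \bar R) (c : R) :
  c%:E < \esum_(x in [set: T]) f x ->
  exists X : {fset T}, c%:E < \sum_(x <- X) f x.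
Proof.
move=> /ereal_sup_gt[_ [X [finX _] <-]]; rewrite fsbig_finite//= => H.
by exists (fset_set X).
Qed.

Lemma fset_sum_le_esum (T : choiceType) (f : T -> \bar R) (X : {fset T}) :
  (forall x, 0 <= f x) -> \sum_(x <- X) f x <= \esum_(x in [set: T]) f x.
Proof.
move=> f0; apply: esum_ge; exists [set` X]; first by split.
by rewrite fsbig_finite//= set_fsetK.
Qed.

End NonnegativeSums.

(** * Convolution with a jump law and its Green function *)

Section Potential.
Local Open Scope ereal_scope.
Context {R : realType} {T : zmodType}.
Variable t : T -> \bar R.
Hypothesis t_ge0 : forall z, 0 <= t z.
Implicit Types f g h : T -> \bar R.

(** With t the law of a jump, the expectation of f after one jump from x. *)
Definition step f x := \esum_(z in [set: T]) (t z * f (x + z)%R).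

Definition delta0 (y : T) : \bar R := ((y == 0%R)%:R)%:E.

Definition pot h x := \esum_(n in [set: nat]) iter n step h x.

Lemma step_ge0 f : (forall x, 0 <= f x) -> forall x, 0 <= step f x.
Proof. by move=> f0 x; apply: esum_ge0 => z _; rewrite mule_ge0. Qed.

Lemma steps_ge0 n f : (forall x, 0 <= f x) -> forall x, 0 <= iter n step f x.
Proof. by move=> f0; elim: n => [//|n IH] x; rewrite iterS step_ge0. Qed.

Lemma pot_ge0 f : (forall x, 0 <= f x) -> forall x, 0 <= pot f x.
Proof. by move=> f0 x; apply: esum_ge0 => n _; exact: steps_ge0. Qed.

Lemma eq_step f g x : f =1 g -> step f x = step g x.
Proof. by move=> /funext ->. Qed.

Lemma le_step f g : (forall x, f x <= g x) -> forall x, step f x <= step g x.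
Proof. by move=> fg x; apply: le_esum => z _; rewrite lee_wpmul2l. Qed.

Lemma le_steps n f g : (forall x, f x <= g x) ->
  forall x, iter n step f x <= iter n step g x.
Proof. by move=> fg; elim: n => [//|n IH] x; rewrite !iterS le_step. Qed.

Lemma le_pot f g : (forall x, f x <= g x) -> forall x, pot f x <= pot g x.
Proof. by move=> fg x; apply: le_esum => n _; exact: le_steps. Qed.

Lemma stepD f g x : (forall x, 0 <= f x) -> (forall x, 0 <= g x) ->
  step (fun x => f x + g x) x = step f x + step g x.
Proof.
move=> f0 g0; rewrite -esumD; [|by move=> *; rewrite mule_ge0..].
by apply: eq_esum => z _; rewrite ge0_muleDr.
Qed.

Lemma stepsD n f g x : (forall x, 0 <= f x) -> (forall x, 0 <= g x) ->
  iter n step (fun x => f x + g x) x = iter n step f x + iter n step g x.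
Proof.
move=> f0 g0; elim: n x => [//|n IH] x.
rewrite iterS -[in RHS]/(step _ x + step _ x) -stepD; [|exact: steps_ge0..].
by apply: eq_step => y; rewrite IH.
Qed.

Lemma step_esum (I : choiceType) (f : I -> T -> \bar R) x :
  (forall i x, 0 <= f i x) ->
  step (fun x => \esum_(i in [set: I]) f i x) x =
  \esum_(i in [set: I]) step (f i) x.
Proof.
move=> f0; rewrite /step esum_swap; last by move=> *; rewrite mule_ge0.
by apply: eq_esum => z _; rewrite esumZl.
Qed.

Lemma steps_esum n (I : choiceType) (f : I -> T -> \bar R) x :
  (forall i x, 0 <= f i x) ->
  iter n step (fun x => \esum_(i in [set: I]) f i x) x =
  \esum_(i in [set: I]) iter n step (f i) x.
Proof.
move=> f0; elim: n x => [//|n IH] x; rewrite iterS.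
rewrite (_ : iter n step _ = fun x => \esum_(i in [set: I]) iter n step (f i) x).
  by rewrite step_esum// => i y; exact: steps_ge0.
exact/funext.
Qed.

Lemma stepsZ n (c : \bar R) f x : 0 <= c -> (forall x, 0 <= f x) ->
  iter n step (fun x => c * f x) x = c * iter n step f x.
Proof.
move=> c0 f0; elim: n x => [//|n IH] x; rewrite !iterS.
rewrite (_ : iter n step _ = fun x => c * iter n step f x); last exact/funext.
rewrite /step -esumZl//.
  by apply: eq_esum => z _; rewrite muleCA.
by move=> z; rewrite mule_ge0// steps_ge0.
Qed.

Lemma stepZ (c : \bar R) f x : 0 <= c -> (forall x, 0 <= f x) ->
  step (fun x => c * f x) x = c * step f x.
Proof. exact: (stepsZ 1). Qed.

Lemma pot_steps m h x : (forall x, 0 <= h x) ->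
  pot (iter m step h) x = \esum_(n in [set: nat]) iter (m + n) step h x.
Proof. by move=> h0; apply: eq_esum => n _; rewrite -iterD addnC. Qed.

Lemma pot_split m h x : (forall x, 0 <= h x) ->
  pot h x = \sum_(0 <= n < m) iter n step h x + pot (iter m step h) x.
Proof.
move=> h0; rewrite pot_steps// -(@esum_nat_split _ _ m)// => n.
exact: steps_ge0.
Qed.

Lemma steps_pot m h x : (forall x, 0 <= h x) ->
  iter m step (pot h) x = pot (iter m step h) x.
Proof.
move=> h0; rewrite pot_steps// steps_esum; last by move=> n y; exact: steps_ge0.
by apply: eq_esum => n _; rewrite -iterD.
Qed.

Lemma potD f g x : (forall x, 0 <= f x) -> (forall x, 0 <= g x) ->
  pot (fun x => f x + g x) x = pot f x + pot g x.
Proof.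
move=> f0 g0; rewrite /pot -esumD; [|by move=> *; exact: steps_ge0..].
by apply: eq_esum => n _; rewrite stepsD.
Qed.

Lemma delta0_ge0 y : 0 <= delta0 y.
Proof. by rewrite lee_fin. Qed.

Lemma esum_delta (f : T -> \bar R) x : (forall y, 0 <= f y) ->
  \esum_(y in [set: T]) (f y * delta0 (x - y)%R) = f x.
Proof.
move=> f0; rewrite -[RHS](@esum_set1 _ _ x f)// [RHS]esum_mkcond.
apply: eq_esum => y _; rewrite /delta0 subr_eq0 in_set1 eq_sym.
by case: eqP => // _; rewrite ?mule1 ?mule0.
Qed.

Lemma esum_delta0 (a : T) :
  \esum_(y in [set: T]) delta0 (y - a)%R = 1 :> \bar R.
Proof.
rewrite (esum_shift delta0 (- a)%R) -(esum_reflect delta0 0%R).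
transitivity (\esum_(y in [set: T]) (1 * delta0 (0 - y)%R : \bar R)).
  by apply: eq_esum => y _; rewrite mul1e.
by apply: (esum_delta (f := fun=> 1)) => y; exact: lee01.
Qed.

(** By translation invariance, everything is a convolution with the
    fundamental solution. *)
Lemma steps_conv n h x : (forall x, 0 <= h x) ->
  iter n step h x = \esum_(y in [set: T]) (h y * iter n step delta0 (x - y)%R).
Proof.
move=> h0; elim: n x => [|n IH] x; first by rewrite /= esum_delta.
rewrite iterS (_ : iter n step h = fun x =>
  \esum_(y in [set: T]) (h y * iter n step delta0 (x - y)%R)); last exact/funext.
rewrite step_esum; last first.
  by move=> y z; rewrite mule_ge0// steps_ge0//; exact: delta0_ge0.
apply: eq_esum => y _; rewrite iterS /step -esumZl//; last first.
  by move=> z; rewrite mule_ge0// steps_ge0//; exact: delta0_ge0.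
by apply: eq_esum => z _; rewrite muleCA addrAC.
Qed.

Lemma pot_conv h x : (forall x, 0 <= h x) ->
  pot h x = \esum_(y in [set: T]) (h y * pot delta0 (x - y)%R).
Proof.
move=> h0; rewrite /pot.
transitivity (\esum_(n in [set: nat]) \esum_(y in [set: T])
    (h y * iter n step delta0 (x - y)%R)).
  by apply: eq_esum => n _; exact: steps_conv.
have d0 n y : 0 <= iter n step delta0 y by apply: steps_ge0; exact: delta0_ge0.
rewrite esum_swap; last by move=> n y; rewrite mule_ge0.
by apply: eq_esum => y _; rewrite esumZl.
Qed.

Hypothesis t_sum1 : \esum_(z in [set: T]) t z = 1.

Lemma esum_step f : (forall x, 0 <= f x) ->
  \esum_(x in [set: T]) step f x = \esum_(x in [set: T]) f x.
Proof.
move=> f0; rewrite /step esum_swap; last by move=> *; rewrite mule_ge0.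
transitivity (\esum_(z in [set: T]) (t z * \esum_(x in [set: T]) f x)).
  by apply: eq_esum => z _; rewrite esumZl// esum_shift.
under eq_esum do rewrite muleC.
by rewrite esumZl ?esum_ge0// t_sum1 mule1.
Qed.

Lemma esum_steps n f : (forall x, 0 <= f x) ->
  \esum_(x in [set: T]) iter n step f x = \esum_(x in [set: T]) f x.
Proof.
by move=> f0; elim: n => [//|n IH]; rewrite -IH esum_step//; exact: steps_ge0.
Qed.

Lemma step_cst (c : \bar R) x : 0 <= c -> step (fun=> c) x = c.
Proof.
move=> c0; rewrite /step; under eq_esum do rewrite muleC.
by rewrite esumZl// t_sum1 mule1.
Qed.

End Potential.

(** * Asymptotics of a damped potential *)

(** Splits an additive error between a mass and the Green function that it
    multiplies. *)
Lemma two_margins (R : realFieldType) (M e : R) : 0 < M -> 0 < e ->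
  exists dl, [/\ 0 < dl, dl <= 1 & M - e <= (M - e / 2) * (1 - dl)].
Proof.
move=> M0 e0; have Me0 : 0 < M + e by lra.
exists (e / (2 * (M + e))).
have dl0 : 0 < e / (2 * (M + e)) by apply: divr_gt0 => //; lra.
have dlE : e / (2 * (M + e)) * (M + e) = e / 2 by field; rewrite gt_eqF.
split=> //; last by nra.
by rewrite ler_pdivrMr; lra.
Qed.

Section DampedPotential.
Local Open Scope ereal_scope.
Context {R : realType} {T : zmodType}.
Variable t : T -> \bar R.
Hypothesis t_ge0 : forall z, 0 <= t z.
Hypothesis t_sum1 : \esum_(z in [set: T]) t z = 1.
Variable kap : T -> R.
Hypothesis kap01 : forall y, (0 <= kap y <= 1)%R.
Local Notation step := (step t).
Local Notation pot := (pot t).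

Definition damp (f : T -> \bar R) y := (kap y)%:E * step f y.

Definition loss (f : T -> \bar R) y := (1 - kap y)%:E * step f y.

Let kap_ge0 y : 0 <= (kap y)%:E.
Proof. by rewrite lee_fin; case/andP: (kap01 y). Qed.

Let kapC_ge0 y : 0 <= (1 - kap y)%:E.
Proof. by rewrite lee_fin subr_ge0; case/andP: (kap01 y). Qed.

Lemma damp_ge0 f : (forall y, 0 <= f y) -> forall y, 0 <= damp f y.
Proof. by move=> f0 y; rewrite mule_ge0// step_ge0. Qed.

Lemma damps_ge0 n f : (forall y, 0 <= f y) -> forall y, 0 <= iter n damp f y.
Proof. by move=> f0; elim: n => [//|n IH] y; rewrite iterS damp_ge0. Qed.

Lemma loss_ge0 f : (forall y, 0 <= f y) -> forall y, 0 <= loss f y.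
Proof. by move=> f0 y; rewrite mule_ge0// step_ge0. Qed.

Lemma damp_loss f y : (forall y, 0 <= f y) -> damp f y + loss f y = step f y.
Proof.
move=> f0; rewrite /damp /loss -ge0_muleDl// -EFinD.
by rewrite addrC subrK mul1e.
Qed.

Lemma le_damp f g : (forall y, f y <= g y) -> forall y, damp f y <= damp g y.
Proof. by move=> fg y; rewrite lee_wpmul2l// le_step. Qed.

Lemma damps_le_steps n f : (forall y, 0 <= f y) ->
  forall y, iter n damp f y <= iter n step f y.
Proof.
move=> f0; elim: n => [//|n IH] y; rewrite !iterS.
apply: (@le_trans _ _ (step (iter n damp f) y)); last exact: le_step.
rewrite -[leRHS]mul1e lee_wpmul2r ?step_ge0//; first exact: damps_ge0.
by rewrite lee_fin; case/andP: (kap01 y).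
Qed.

Lemma dampZ (c : \bar R) f y : 0 <= c -> (forall y, 0 <= f y) ->
  damp (fun x => c * f x) y = c * damp f y.
Proof. by move=> c0 f0; rewrite /damp stepZ// muleCA. Qed.

Lemma damp_esum (I : choiceType) (f : I -> T -> \bar R) x :
  (forall i x, 0 <= f i x) ->
  damp (fun x => \esum_(i in [set: I]) f i x) x =
  \esum_(i in [set: I]) damp (f i) x.
Proof.
move=> f0; rewrite /damp step_esum// esumZl// => i.
exact: step_ge0.
Qed.

Section Asymptotics.
Variable F : set_system T.
Context {FF : Filter F}.
Variable gr : T -> R.
Hypothesis gr_ge0 : forall x, (0 <= gr x)%R.
Hypothesis pot_delta : forall x, pot delta0 x = (gr x)%:E.
Hypothesis gr_shift : forall (y : T) (e : R), (0 < e)%R ->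
  \forall x \near F, ((1 - e) * gr x <= gr (x - y))%R.

Let pot_convE h x : (forall y, 0 <= h y) ->
  pot h x = \esum_(y in [set: T]) (h y * (gr (x - y)%R)%:E).
Proof.
by move=> h0; rewrite pot_conv//; apply: eq_esum => y _; rewrite pot_delta.
Qed.

(** Fatou's lemma along F: seen from far away, every unit of mass of h
    contributes as if it sat at the origin, and none can be overcounted. *)
Lemma pot_fatou h (M e : R) : (forall y, 0 <= h y) ->
  M%:E <= \esum_(y in [set: T]) h y -> (0 < e)%R ->
  \forall x \near F, ((M - e) * gr x)%:E <= pot h x.
Proof.
move=> h0 hM e0.
have [M0|M0] := lerP M 0.
  apply: filterE => x; apply: (@le_trans _ _ 0); last exact: pot_ge0.
  rewrite lee_fin; apply: mulr_le0_ge0 => //; lra.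
have : (M - e / 2)%:E < \esum_(y in [set: T]) h y.
  by apply: lt_le_trans hM; rewrite lte_fin; lra.
move=> /esum_finite_approx[X hX].
have [dl [dl0 dl1 dlM]] := two_margins M0 e0.
have near_all : \forall x \near F, forall y : T, y \in X ->
    ((1 - dl) * gr x <= gr (x - y))%R.
  elim/finSet_rect: X {hX} => X IHX.
  have [->|[y yX]] := fset_0Vmem X; first by apply: filterE => x y.
  have := IHX (X `\ y)%fset (fproperD1 yX).
  have := gr_shift y dl0.
  apply: filterS2 => x Hy HX z zX.
  have [->//|zy] := eqVneq z y.
  by apply: HX; rewrite !inE zy.
apply: filterS near_all => x Hx; rewrite pot_convE//.
apply: (@le_trans _ _ (\sum_(y <- X) h y * (gr (x - y)%R)%:E)); last first.
  by apply: fset_sum_le_esum => y; rewrite mule_ge0// lee_fin.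
apply: (@le_trans _ _ (\sum_(y <- X) h y * ((1 - dl) * gr x)%:E)); last first.
  rewrite big_seq [leRHS]big_seq; apply: lee_sum => y yX.
  by rewrite lee_wpmul2l// lee_fin Hx.
have c0 : (0 <= (1 - dl) * gr x)%R by rewrite mulr_ge0// subr_ge0.
rewrite -ge0_sume_distrl//.
apply: (@le_trans _ _ ((M - e / 2)%:E * ((1 - dl) * gr x)%:E)); last first.
  by apply: lee_wpmul2r; [rewrite lee_fin|exact: ltW].
rewrite -EFinM lee_fin mulrA; exact: ler_wpM2r.
Qed.

Variables (u f h : T -> \bar R) (a : R).
Hypotheses (f_ge0 : forall y, 0 <= f y) (h_ge0 : forall y, 0 <= h y).
Hypothesis fhu : forall y, f y + h y = u y.
Hypothesis u_sum : \esum_(y in [set: T]) u y = a%:E.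
Hypothesis pot_u : forall e : R, (0 < e)%R ->
  \forall x \near F, pot u x <= ((a + e) * gr x)%:E.

Let u_ge0 y : 0 <= u y.
Proof. by rewrite -fhu adde_ge0. Qed.

(** The part of the undamped evolution of u that the damping has removed by
    time m. *)
Fixpoint removed (m : nat) : T -> \bar R :=
  if m is m'.+1 then fun y => step (removed m') y + loss (iter m' damp f) y
  else h.

Let removed_ge0 m y : 0 <= removed m y.
Proof.
elim: m y => [//|m IH] y /=; rewrite adde_ge0//; first exact: step_ge0.
by apply: loss_ge0; exact: damps_ge0.
Qed.

Lemma damps_removed m y : iter m damp f y + removed m y = iter m step u y.
Proof.
elim: m y => [|m IH] y /=; first exact: fhu.
rewrite addeCA damp_loss; last exact: damps_ge0.
rewrite addeC -stepD//; last exact: damps_ge0.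
by apply: eq_step.
Qed.

Let total m := \esum_(y in [set: T]) iter m damp f y.

Lemma total_removed m : total m + \esum_(y in [set: T]) removed m y = a%:E.
Proof.
rewrite -esumD//; last by move=> y _; exact: damps_ge0.
rewrite -u_sum -(esum_steps t_ge0 t_sum1 m u_ge0).
by apply: eq_esum => y _; exact: damps_removed.
Qed.

Definition damped_pot x := \esum_(k in [set: nat]) iter k damp f x.

(** At time m the damped and the removed parts add up to the undamped evolution;
    from then on the removed part moves freely, and the damped one can only
    lose. *)
Lemma damped_pot_removed m x : damped_pot x + pot (removed m) x <= pot u x.
Proof.
rewrite /damped_pot (@esum_nat_split _ _ m); last by move=> n; exact: damps_ge0.
rewrite (pot_split t_ge0 m x u_ge0) -addeA; apply: leeD.
  apply: lee_sum => n _; apply: le_trans (damps_le_steps n f_ge0 x) _.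
  by apply: le_steps => // y; rewrite -fhu leeDl.
have -> : pot (iter m step u) x =
    pot (iter m damp f) x + pot (removed m) x.
  rewrite -potD//; last exact: damps_ge0.
  by congr (pot _ _); apply/funext => y; rewrite damps_removed.
apply: leeD => //; apply: le_esum => n _.
by rewrite addnC iterD; apply: damps_le_steps; exact: damps_ge0.
Qed.

(** The removed mass a - M accounts for at least its share of the potential of u,
    which leaves at most M for the damped one. *)
Lemma damped_pot_upper m (M e : R) : total m = M%:E -> (0 < e)%R ->
  \forall x \near F, damped_pot x <= ((M + e) * gr x)%:E.
Proof.
move=> totalM e0; have e20 : (0 < e / 2)%R by lra.
have removedM : (a - M)%:E <= \esum_(y in [set: T]) removed m y.
  have := total_removed m; rewrite totalM => H.
  by rewrite EFinB -H addeAC subee// add0e.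
have := pot_fatou (removed_ge0 m) removedM e20.
have := pot_u e20; apply: filterS2 => x Hu Hr.
have damped_ge0 : 0 <= damped_pot x by apply: esum_ge0 => k _; exact: damps_ge0.
have := le_trans (le_trans (leeD2l (damped_pot x) Hr) (damped_pot_removed m x)) Hu.
rewrite -leeBrDr// -EFinB => /le_trans; apply.
by rewrite lee_fin; nra.
Qed.

(** The tail G of the damped potential satisfies
    G + loss G = iter m damp f + step G, and the potential inverts 1 - step.
    Since infinite values forbid subtraction, the identity is summed over
    finitely many steps. *)
Lemma damped_pot_loss m x :
  pot (iter m damp f) x <= damped_pot x +
  pot (loss (fun y => \esum_(k in [set: nat]) iter (m + k) damp f y)) x.
Proof.
pose G y := \esum_(k in [set: nat]) iter (m + k) damp f y.
have G0 y : 0 <= G y by apply: esum_ge0 => k _; exact: damps_ge0.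
have L0 y : 0 <= loss G y by exact: loss_ge0.
have GE y : G y + loss G y = iter m damp f y + step G y.
  rewrite -(damp_loss y G0) addeA; congr (_ + _).
  rewrite {1}/G (@esum_nat_split _ _ 1); last by move=> k; exact: damps_ge0.
  rewrite big_nat1 addn0; congr (_ + _).
  rewrite damp_esum; last by move=> k z; exact: damps_ge0.
  by apply: eq_esum => k _; rewrite addnCA add1n -iterS.
have finite_version n :
    \sum_(0 <= j < n) iter j step (iter m damp f) x + iter n step G x =
    G x + \sum_(0 <= j < n) iter j step (loss G) x.
  elim: n => [|n IH]; first by rewrite !big_nil add0e adde0.
  rewrite !big_nat_recr//= [RHS]addeA -IH -!addeA; congr (_ + _).
  rewrite -stepsD// -(_ : iter n step (step G) = step (iter n step G)); last first.
    by rewrite -iterSr.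
  rewrite -stepsD//; [|exact: damps_ge0|exact: step_ge0].
  by congr (iter n step _ _); apply/funext => y; rewrite GE.
apply: esum_nat_le => [n|n]; first by apply: steps_ge0 => //; exact: damps_ge0.
apply: (@le_trans _ _ (G x + \sum_(0 <= j < n) iter j step (loss G) x)).
  by rewrite -finite_version leeDl// steps_ge0.
apply: leeD; last by apply: esum_partial_le => j; exact: steps_ge0.
rewrite /damped_pot (@esum_nat_split _ _ m); last by move=> k; exact: damps_ge0.
by rewrite leeDr// sume_ge0// => k _; exact: damps_ge0.
Qed.

(** What the damping costs after time m, whatever happened before. *)
Definition late_loss m y := (1 - kap y)%:E * pot (iter m.+1 step u) y.

Lemma loss_tail_le m y :
  loss (fun y => \esum_(k in [set: nat]) iter (m + k) damp f y) y
  <= late_loss m y.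
Proof.
apply: lee_wpmul2l => //; rewrite step_esum//; last first.
  by move=> k z; exact: damps_ge0.
apply: le_esum => k _; rewrite -iterD addnS addnC iterS; apply: le_step => // z.
apply: le_trans (damps_le_steps _ f_ge0 z) _; apply: le_steps => // w.
by rewrite -fhu leeDl.
Qed.

Hypothesis late_loss_small : forall e : R, (0 < e)%R ->
  exists m0, forall m, (m0 <= m)%N ->
  \forall x \near F, pot (late_loss m) x <= (e * gr x)%:E.

Let late_loss_ge0 m y : 0 <= late_loss m y.
Proof. by rewrite mule_ge0// pot_ge0// => z; exact: steps_ge0. Qed.

Lemma damped_pot_lower (B e : R) : (forall m, B%:E <= total m) -> (0 < e)%R ->
  \forall x \near F, ((B - e) * gr x)%:E <= damped_pot x.
Proof.
move=> totalB e0; have e20 : (0 < e / 2)%R by lra.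
have [m /(_ m (leqnn m)) Hm] := late_loss_small e20.
have := pot_fatou (damps_ge0 m f_ge0) (totalB m) e20.
apply: filterS2 Hm => x Hl Hf.
have := le_trans Hf (le_trans (damped_pot_loss m x)
  (leeD2l _ (le_trans (le_pot t_ge0 (loss_tail_le m) x) Hl))).
rewrite -leeBlDr// -EFinB; apply: le_trans.
by rewrite lee_fin; nra.
Qed.

Lemma damped_pot_asymp (B : R) :
  (fun m => total m) @ \oo --> B%:E -> {homo total : m n / (m <= n)%N >-> m >= n} ->
  forall e : R, (0 < e)%R -> \forall x \near F,
    ((B - e) * gr x)%:E <= damped_pot x <= ((B + e) * gr x)%:E.
Proof.
move=> totalB total_dec e e0.
have lowB m : B%:E <= total m.
  rewrite -(cvg_lim _ totalB)//; apply: lime_le; first by apply/cvg_ex; exists B%:E.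
  by exists m => // n /= mn; exact: total_dec.
have e20 : (0 < e / 2)%R by lra.
have [m [M [totalM MB]]] : exists m, exists M : R,
    total m = M%:E /\ (M <= B + e / 2)%R.
  move/fine_cvgP: totalB => [[m1 _ fin_total] /cvgrPdist_lt/(_ _ e20)[m2 _ Hm2]].
  exists (maxn m1 m2); exists (fine (total (maxn m1 m2))).
  rewrite fineK; last by apply: fin_total; rewrite /= leq_maxl.
  split=> //; have := Hm2 (maxn m1 m2) (leq_maxr _ _).
  by rewrite /= ltr_norml => /andP[+ _]; lra.
have := damped_pot_upper totalM e20; have := damped_pot_lower lowB e0.
apply: filterS2 => x -> /= /le_trans; apply.
rewrite lee_fin; apply: ler_wpM2r => //; lra.
Qed.

End Asymptotics.

(** The mass that survives the damping stays away from zero: in the long run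
    next to nothing is lost, and whatever is lost at first is at most a fixed
    factor at each step. *)
Lemma damped_mass_pos (u f : T -> \bar R) (a k0 c0 : R) :
  (forall y, 0 <= u y) -> \esum_(y in [set: T]) u y = a%:E -> (0 < a)%R ->
  (0 < k0)%R -> (forall y, (k0 <= kap y)%R) ->
  (0 < c0)%R -> (forall y, c0%:E * u y <= f y) ->
  (forall e : R, (0 < e)%R ->
    exists m, \esum_(y in [set: T]) late_loss u m y < e%:E) ->
  exists2 b : R, (0 < b)%R &
    exists m, forall j, b%:E <= \esum_(y in [set: T]) iter (m + j) damp f y.
Proof.
move=> u0 u_sum a0 k00 kap_low c00 f_low loss_small.
have a20 : (0 < a / 2)%R by lra.
have [m Hm] := loss_small _ a20.
pose v := iter m step u.
have v0 y : 0 <= v y by exact: steps_ge0.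
have v_sum : \esum_(y in [set: T]) v y = a%:E by rewrite esum_steps.
have ck0 : (0 <= c0 * k0 ^+ m)%R by rewrite mulr_ge0// ?exprn_ge0// ltW.
have start y : (c0 * k0 ^+ m)%:E * v y <= iter m damp f y.
  rewrite /v; elim: (m) y => [|n IH] y; first by rewrite expr0 mulr1 f_low.
  have cn0 : 0 <= (c0 * k0 ^+ n)%:E.
    by rewrite lee_fin mulr_ge0// ?exprn_ge0// ltW.
  rewrite (iterS n damp); apply: le_trans (le_damp IH y).
  rewrite dampZ//; last by move=> z; exact: steps_ge0.
  rewrite exprSr mulrA EFinM -muleA; apply: lee_wpmul2l => //.
  rewrite /damp -iterS; apply: lee_wpmul2r; last by rewrite lee_fin.
  exact: steps_ge0.
have later j y : (c0 * k0 ^+ m)%:E * iter j damp v y <= iter (m + j) damp f y.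
  elim: j y => [|j IH] y; first by rewrite addn0.
  rewrite addnS !iterS; apply: le_trans (le_damp IH y).
  by rewrite dampZ// => z; exact: damps_ge0.
have balance j : \esum_(y in [set: T]) iter j damp v y +
    \sum_(0 <= i < j) \esum_(y in [set: T]) loss (iter i damp v) y = a%:E.
  elim: j => [|j IH]; first by rewrite big_nil adde0.
  rewrite big_nat_recr//= addeA addeAC -IH; congr (_ + _).
  rewrite -esumD => [|y _|y _]; last 2 first.
  - by apply: damp_ge0; exact: damps_ge0.
  - by apply: loss_ge0; exact: damps_ge0.
  rewrite -(esum_step t_ge0 t_sum1 (damps_ge0 j v0)).
  by apply: eq_esum => y _; rewrite damp_loss//; exact: damps_ge0.
have lossD j : \sum_(0 <= i < j) \esum_(y in [set: T]) loss (iter i damp v) y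
    <= (a / 2)%:E.
  apply: le_trans (ltW Hm); rewrite -esum_sum; last first.
    by move=> y i _ _; apply: loss_ge0; exact: damps_ge0.
  apply: le_esum => y _; rewrite /late_loss.
  apply: (@le_trans _ _ (\sum_(0 <= i < j) (1 - kap y)%:E * iter (m.+1 + i) step u y)).
    apply: lee_sum => i _; apply: lee_wpmul2l => //.
    rewrite addSn iterS; apply: le_step => // z.
    by rewrite addnC iterD; exact: damps_le_steps.
  rewrite -ge0_sume_distrr; last by move=> i _; exact: steps_ge0.
  apply: lee_wpmul2l => //; rewrite pot_steps//.
  by apply: esum_partial_le => i; exact: steps_ge0.
exists (c0 * k0 ^+ m * (a / 2))%R.
  by rewrite mulr_gt0// mulr_gt0// exprn_gt0.
exists m => j; apply: le_trans (le_esum (fun y _ => later j y)).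
rewrite esumZl//; last by move=> y; exact: damps_ge0.
rewrite EFinM; apply: lee_wpmul2l; first by rewrite lee_fin.
have loss_fin : \sum_(0 <= i < j) \esum_(y in [set: T]) loss (iter i damp v) y
    \is a fin_num.
  rewrite ge0_fin_numE; first by apply: le_lt_trans (lossD j) _; rewrite ltry.
  by apply: sume_ge0 => i _; apply: esum_ge0 => y _; apply: loss_ge0;
    exact: damps_ge0.
rewrite -(leeD2rE _ _ loss_fin) balance.
apply: (le_trans (leeD2l _ (lossD j))).
by rewrite -EFinD lee_fin; lra.
Qed.

End DampedPotential.

(** * Events that depend on a block of independent variables *)

Section BlockEvents.
Local Open Scope ereal_scope.
Context {R : realType} {dO : measure_display} {Om : measurableType dO}.
Variable P : probability Om R.

Lemma measurable_bigcup_countType (K : countType) (D : K -> set Om) :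
  (forall k, measurable (D k)) -> measurable (\bigcup_k D k).
Proof.
move=> mD; rewrite (_ : \bigcup_k D k =
    \bigcup_n (if @choice.unpickle K n is Some k then D k else set0)).
  apply: bigcup_measurable => n _.
  by case: (choice.unpickle n) => [k|]; [exact: mD|exact: measurable0].
apply/seteqP; split=> w [k _ Dk]; first by exists (choice.pickle k) => //; rewrite choice.pickleK.
by move: Dk; case: choice.unpickle => // i Di; exists i.
Qed.

Lemma prob_bigcup_countType (K : countType) (D : K -> set Om) :
  (forall k, measurable (D k)) -> trivIset setT D ->
  P (\bigcup_k D k) = \esum_(k in [set: K]) P (D k).
Proof.
move=> mD tD; pose G n := if @pickle_inv K n is Some k then D k else set0.
have GE : \bigcup_k D k = \bigcup_n G n.
  apply/seteqP; split=> w [k _ Dk].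
    by exists (choice.pickle k) => //; rewrite /G pickleK_inv.
  by move: Dk; rewrite /G; case: pickle_inv => // i Di; exists i.
have mG n : measurable (G n).
  by rewrite /G; case: pickle_inv => [k|]; [exact: mD|exact: measurable0].
have tG : trivIset setT G.
  move=> m n _ _ [w []]; rewrite /G.
  have := @pickle_invK K m; have := @pickle_invK K n.
  case: pickle_inv => [l|//]; case: pickle_inv => [k|//] /= <- <- Dk Dl.
  by congr choice.pickle; apply: (tD k l) => //; exists w.
rewrite GE measure_bigcup//.
rewrite (_ : \sum_(i <oo | i \in setT) P (G i) =
    \esum_(i in [set: nat]) P (G i)); last first.
  by rewrite -nneseries_esumT//; apply: eq_eseriesl => i; rewrite in_setT.
rewrite (esumID (range (@choice.pickle K)))//.
rewrite [X in _ + X]esum1 ?adde0; last first.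
  move=> n [_ Kn]; rewrite /G; have := @pickle_invK K n.
  case: pickle_inv => [k /= kn|_]; last by rewrite measure0.
  by exfalso; apply: Kn; exists k.
rewrite setTI esum_image; last by move=> x y _ _; exact: (pcan_inj choice.pickleK).
by apply: eq_esum => k _; rewrite /G pickleK_inv.
Qed.

Context {I : choiceType}.
Variable E : I -> set_system Om.
Hypothesis E_meas : forall i F, E i F -> measurable F.
Hypothesis E_indep : mutually_independent P E.
Implicit Types (V W : set I) (B D : set Om).

Definition indep_from V B : Prop := measurable B /\
  forall (J : {fset I}) (F : I -> set Om), [set` J] `<=` V ->
    (forall i, i \in J -> E i (F i)) ->
    P (B `&` \bigcap_(i in [set` J]) F i) = P B * \prod_(i <- J) P (F i).

(** The conditional probability of D given the variables outside the block V,
    tested against all events independent of that block rather than defined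
    through sigma-algebras: disjoint blocks then combine without a monotone
    class argument. *)
Definition block_event V D (c : \bar R) : Prop := measurable D /\
  forall B, indep_from V B -> P (B `&` D) = P B * c.

Lemma measurable_bigcap_fset (J : {fset I}) (F : I -> set Om) :
  (forall i, i \in J -> measurable (F i)) ->
  measurable (\bigcap_(i in [set` J]) F i).
Proof. by move=> mF; apply: fin_bigcap_measurable => // i /=; exact: mF. Qed.

Lemma indep_from_setT V : indep_from V setT.
Proof.
split; first exact: measurableT.
by move=> J F _ EF; rewrite setTI probability_setT mul1e E_indep.
Qed.

Lemma indep_from_sub V W B : V `<=` W -> indep_from W B -> indep_from V B.
Proof. by move=> VW [mB HB]; split=> // J F JV; apply: HB; exact: subset_trans VW. Qed.

Lemma block_event_prob V D c : block_event V D c -> P D = c.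
Proof.
move=> [_ /(_ _ (indep_from_setT V))].
by rewrite setTI probability_setT mul1e.
Qed.

Lemma block_event_sub V W D c : V `<=` W -> block_event V D c ->
  block_event W D c.
Proof.
by move=> VW [mD HD]; split=> // B /(indep_from_sub VW); exact: HD.
Qed.

(** A test family in V and one in W merge into a test family in their union, to
    which the hypothesis on B applies; this is where disjointness enters. *)
Lemma indep_fromI V W B D c : V `&` W = set0 -> indep_from (V `|` W) B ->
  block_event V D c -> indep_from W (B `&` D).
Proof.
move=> VW0 [mB HB] bD; split; first by apply: measurableI => //; case: bD.
move=> J F JW EF; case: (bD) => [mD HD].
have HBJ : P (B `&` \bigcap_(i in [set` J]) F i) = P B * \prod_(i <- J) P (F i).
  by apply: HB => // i /JW; right.
rewrite setIAC HD; last first.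
  split; first by apply: measurableI => //; apply: measurable_bigcap_fset => i /EF/E_meas.
  move=> J' F' J'V EF'.
  have disj i : i \in J -> i \in J' -> False.
    move=> /JW iW /J'V iV; have : (V `&` W) i by [].
    by rewrite VW0.
  pose G i := if i \in J then F i else F' i.
  have GE : \bigcap_(i in [set` J]) F i `&` \bigcap_(i in [set` J']) F' i =
      \bigcap_(i in [set` (J `|` J')%fset]) G i.
    apply/seteqP; split=> w.
      move=> [HJ HJ'] i /=; rewrite inE /G.
      by case: ifPn => [iJ _|_ /= iJ']; [exact: HJ|exact: HJ'].
    move=> H; split=> i /= iJ; have := H i; rewrite /= inE /G iJ ?orbT.
      by apply.
    by case: ifPn => [iJ2 _|_]; [case: (disj i)|apply].
  rewrite -setIA GE HB; last 2 first.
  - by move=> i /=; rewrite inE => /orP[/JW|/J'V]; [right|left].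
  - move=> i; rewrite inE /G => /orP[iJ|iJ'].
      by rewrite iJ; exact: EF.
    by case: ifPn => [iJ|_]; [exact: EF|exact: EF'].
  rewrite HBJ -muleA; congr (_ * _).
  rewrite (perm_big (enum_fset J ++ enum_fset J'))/=; last first.
    apply: uniq_perm => [||i]; first exact: fset_uniq.
      rewrite cat_uniq !fset_uniq andbT/=; apply/hasPn => i iJ'.
      by apply/negP => iJ; exact: disj iJ iJ'.
    by rewrite mem_cat inE.
  rewrite big_cat/=; congr (_ * _).
    by apply: eq_big_seq => i iJ; rewrite /G iJ.
  apply: eq_big_seq => i iJ'; rewrite /G; case: ifPn => // iJ.
  by case: (disj i).
rewrite HBJ HD; last by apply: indep_from_sub (conj mB HB); left.
by rewrite muleAC.
Qed.

Lemma block_eventI V W D D' c c' : V `&` W = set0 ->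
  block_event V D c -> block_event W D' c' ->
  block_event (V `|` W) (D `&` D') (c * c').
Proof.
move=> VW0 bD bD'; split; first by apply: measurableI; [case: bD|case: bD'].
move=> B HB; rewrite setIA; case: (bD') => _ ->; last exact: indep_fromI bD.
case: bD => _ ->; first by rewrite muleA.
by apply: indep_from_sub HB; left.
Qed.

Lemma block_event_var i (F : set Om) : E i F -> block_event [set i] F (P F).
Proof.
move=> EF; split; first exact: E_meas EF.
move=> B [_ HB].
have capE : \bigcap_(_ in [set` [fset i]%fset]) F = F.
  apply/seteqP; split=> w; last by move=> Fw j _.
  by move=> /(_ i); apply; rewrite /= inE.
have := HB [fset i]%fset (fun=> F); rewrite capE big_seq_fset1; apply.
- by move=> j; rewrite /= inE => /eqP ji; exact: ji.
- by move=> j; rewrite inE => /eqP ->.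
Qed.

Lemma block_event_setT V : block_event V setT 1.
Proof. by split; [exact: measurableT|move=> B _; rewrite setIT mule1]. Qed.

Lemma block_event_set0 V : block_event V set0 0.
Proof. by split; [exact: measurable0|move=> B _; rewrite setI0 measure0 mule0]. Qed.

Lemma block_event_bigcup (K : countType) V (D : K -> set Om) (c : K -> \bar R) :
  trivIset setT D -> (forall k, block_event V (D k) (c k)) ->
  block_event V (\bigcup_k D k) (\esum_(k in [set: K]) c k).
Proof.
move=> tD bD; have mD k : measurable (D k) by case: (bD k).
split; first exact: measurable_bigcup_countType.
move=> B HB; have mB : measurable B by case: HB.
have c0 k : 0 <= c k by rewrite -(block_event_prob (bD k)).
rewrite setI_bigcupr prob_bigcup_countType; last 2 first.
- by move=> k; exact: measurableI.
- by apply: trivIset_setIl.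
by rewrite -esumZl//; apply: eq_esum => k _; case: (bD k) => _ ->.
Qed.

Lemma block_event_bigcap V (D : nat -> set Om) (c : nat -> \bar R) (l : \bar R) :
  (forall n, D n.+1 `<=` D n) -> (forall n, block_event V (D n) (c n)) ->
  c @ \oo --> l -> block_event V (\bigcap_n D n) l.
Proof.
move=> decD bD cl; have mD k : measurable (D k) by case: (bD k).
split; first exact: bigcapT_measurable.
move=> B HB; have mB : measurable B by case: HB.
have mBD k : measurable (B `&` D k) by exact: measurableI.
have H1 : P (B `&` D n) @[n --> \oo] --> P (\bigcap_n (B `&` D n)).
  apply: nonincreasing_cvg_mu => //.
  - by rewrite (le_lt_trans (probability_le1 _ _))// ltry.
  - exact: bigcapT_measurable.
  - apply/nonincreasing_seqP => n; apply/subsetPset; exact: setIS.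
have H2 : P (B `&` D n) @[n --> \oo] --> P B * l.
  rewrite (_ : (fun n => _) = fun n => P B * c n); last first.
    by apply/funext => n; case: (bD n) => _ ->.
  by apply: cvgeZl => //; exact: fin_num_measure.
rewrite -(cvg_unique _ H1 H2)//; congr (P _).
apply/seteqP; split=> w.
  by move=> [Bw Dw] n _; split=> //; exact: Dw.
by move=> H; split=> [|n _]; [case: (H 0%N)|case: (H n)].
Qed.

Lemma block_event_ord (V : nat -> set I) (D : nat -> set Om) (c : \bar R) j :
  (forall i k, i != k -> V i `&` V k = set0) ->
  (forall i, block_event (V i) (D i) c) ->
  block_event (\bigcup_(i in [set i | (i < j)%N]) V i)
    [set w | forall i, (i < j)%N -> D i w] (c ^+ j).
Proof.
move=> V0 bD; elim: j => [|j IH].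
  rewrite (_ : [set w | _] = (setT : set Om)); last first.
    by apply/seteqP; split=> [//|w _ i].
  by rewrite expe0; exact: block_event_setT.
rewrite (_ : [set w | _] = [set w | forall i, (i < j)%N -> D i w] `&` D j).
  rewrite expeS muleC (_ : \bigcup_(_ in _) _ =
    (\bigcup_(i in [set i | (i < j)%N]) V i) `|` V j).
    apply: block_eventI => //; apply/seteqP; split=> // x [[i /= ij Vi] Vj].
    have : (V i `&` V j) x by [].
    by rewrite V0//; apply/eqP => ji; rewrite ji ltnn in ij.
  apply/seteqP; split=> x.
    move=> [i /=]; rewrite ltnS leq_eqVlt => /orP[/eqP ->|ij] Vx; first by right.
    by left; exists i.
  move=> [[i /= ij]|] Vx; first by exists i => //=; rewrite ltnS ltnW.
  by exists j => /=.
apply/seteqP; split=> w.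
  by move=> H; split=> [i ij|]; apply: H => //; rewrite ltnS ltnW.
by move=> [H Hj] i; rewrite ltnS leq_eqVlt => /orP[/eqP ->|]; [|exact: H].
Qed.

End BlockEvents.

(** * The branching recursion *)

HB.instance Definition _ (d : nat) := Countable.copy (lattice d) 'rV[int]_d.

Definition gf {R : realType} (m : nat -> \bar R) (s : \bar R) : \bar R :=
  (\esum_(j in [set: nat]) (m j * s ^+ j))%E.

(** Generating function of the number of siblings after the marked child of a
    vertex of the spine: the number j of children and the rank i < j of the
    marked one have joint mass m j, and j - i - 1 children come after it. *)
Definition branch_gf {R : realType} (m : nat -> \bar R) (s : \bar R) : \bar R :=
  (\esum_(a in [set: nat * nat])
    ((if (a.2 < a.1)%N then m a.1 else 0) * s ^+ (a.1 - a.2.+1)))%E.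

Section Forest.
Local Open Scope ereal_scope.
Context {R : realType} {d : nat} {dO : measure_display} {Om : measurableType dO}.
Variable P : probability Om R.
Context {I : choiceType}.
Variable E : I -> set_system Om.
Hypothesis E_meas : forall i F, E i F -> measurable F.
Hypothesis E_indep : mutually_independent P E.
Variable t : lattice d -> \bar R.

(** The jump leads to a random point, over whose values the events D are
    summed: this is where step comes from. *)
Lemma block_event_edge (X : Om -> lattice d) (jX : I) (S : set I)
    (D : lattice d -> set Om) (q : lattice d -> \bar R) (x : lattice d) :
  (forall z, E jX [set w | X w = z]) ->
  (forall z, P [set w | X w = z] = t z) -> ~ S jX ->
  (forall y, block_event P E S (D y) (q y)) ->
  block_event P E ([set jX] `|` S) [set w | D (x + X w)%R w] (step t q x).
Proof.
move=> EX PX SX bD.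
rewrite (_ : [set w | _] =
    \bigcup_z ([set w | X w = z] `&` D (x + z)%R)); last first.
  apply/seteqP; split=> w; first by move=> /= Dw; exists (X w).
  by move=> [z _ [/= -> ]].
apply: block_event_bigcup => //.
  by move=> z z' _ _ [w [[/= <- _] [/= <- _]]].
move=> z; rewrite -PX; apply: block_eventI => //.
  by apply/seteqP; split=> // i [/= ->].
exact: block_event_var.
Qed.

(** Children a, ..., b - 1 of a vertex at x, each sent along its edge. *)
Lemma block_event_forest (X : nat -> Om -> lattice d) (jX : nat -> I)
    (S : nat -> set I) (D : nat -> lattice d -> set Om)
    (q : lattice d -> \bar R) (x : lattice d) (a b : nat) :
  (forall i z, E (jX i) [set w | X i w = z]) ->
  (forall i z, P [set w | X i w = z] = t z) ->
  (forall i, ~ S i (jX i)) ->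
  (forall i k, i != k ->
    ([set jX i] `|` S i) `&` ([set jX k] `|` S k) = set0) ->
  (forall i y, block_event P E (S i) (D i y) (q y)) ->
  block_event P E (\bigcup_i ([set jX i] `|` S i))
    [set w | forall i, (a <= i < b)%N -> D i (x + X i w)%R w]
    (step t q x ^+ (b - a)).
Proof.
move=> EX PX SX disj bD.
rewrite (_ : [set w | _] = [set w | forall i, (i < b - a)%N ->
    D (a + i)%N (x + X (a + i)%N w)%R w]); last first.
  apply/seteqP; split=> w /= H i; first by move=> ib; apply: H; lia.
  by move=> iab; have := H (i - a)%N; rewrite subnKC; [apply; lia|lia].
apply: (@block_event_sub _ _ _ _ _ _
  (\bigcup_(i in [set i | (i < b - a)%N]) ([set jX (a + i)%N] `|` S (a + i)%N))).
  by move=> j [i _ ij]; exists (a + i)%N.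
apply: (block_event_ord E_meas (V :=
  fun i => [set jX (a + i)%N] `|` S (a + i)%N) (D :=
  fun i => [set w | D (a + i)%N (x + X (a + i)%N w)%R w])).
  by move=> i k ik; apply: disj; rewrite eqn_add2l.
by move=> i; exact: block_event_edge.
Qed.

End Forest.

Section FiniteTree.
Local Open Scope ereal_scope.
Context {d : nat}.
Variable A : set (lattice d).
Implicit Types (n : seq nat -> nat) (xi : seq nat -> lattice d).

Definition avoid h n xi (x : lattice d) : Prop :=
  forall u, in_tree n u -> (size u <= h)%N -> ~ A (tree_pos x xi u).

Lemma in_tree_cat1 n u i : in_tree n (u ++ [:: i]) =
  (i < n [::])%N && in_tree (fun v => n (v ++ [:: i])) u.
Proof.
elim: u => [|j u IH] /=; first by rewrite andbT.
by rewrite IH andbA.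
Qed.

Lemma tree_pos_cat1 xi x u i : tree_pos x xi (u ++ [:: i]) =
  tree_pos (x + xi [:: i])%R (fun v => xi (v ++ [:: i])) u.
Proof. by elim: u => [//|j u IH] /=; rewrite IH. Qed.

Lemma avoidS h n xi x : avoid h.+1 n xi x <->
  ~ A x /\ forall i, (i < n [::])%N ->
    avoid h (fun v => n (v ++ [:: i])) (fun v => xi (v ++ [:: i]))
      (x + xi [:: i])%R.
Proof.
split=> [H|[Ax H] u].
  split=> [|i iN u uT uh]; first exact: (H [::]).
  rewrite -tree_pos_cat1; apply: H; first by rewrite in_tree_cat1 iN.
  by rewrite size_cat addn1.
case/lastP: u => [//|u i]; rewrite -cats1 in_tree_cat1 => /andP[iN uT].
rewrite size_cat addn1 ltnS tree_pos_cat1; exact: H.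
Qed.

Lemma avoid0 n xi x : avoid 0 n xi x <-> ~ A x.
Proof.
split=> [/(_ [::] isT (leqnn _)) //|Ax u _].
by rewrite leqn0 => /nilP ->.
Qed.

Context {R : realType}.
Variables (m : nat -> \bar R) (t : lattice d -> \bar R).

Definition outside x : \bar R := ((x \notin A)%:R)%:E.

(** The probability that a tree rooted at x avoids A up to generation h, written
    as the recursion that the branching property yields. *)
Fixpoint avoid_prob (h : nat) (x : lattice d) : \bar R :=
  if h is h'.+1 then
    outside x * gf m (step t (avoid_prob h') x)
  else outside x.

Context {dO : measure_display} {Om : measurableType dO}.
Variable P : probability Om R.
Context {I : choiceType}.
Variable E : I -> set_system Om.
Hypothesis E_meas : forall i F, E i F -> measurable F.
Hypothesis E_indep : mutually_independent P E.
Variables (N : seq nat -> Om -> nat) (X : seq nat -> Om -> lattice d).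
Variables (iN iX : seq nat -> I).
Hypotheses (iN_inj : injective iN) (iX_inj : injective iX).
Hypothesis iNX : forall u v, iN u <> iX v.
Hypothesis EN : forall u j, E (iN u) [set w | N u w = j].
Hypothesis PN : forall u j, P [set w | N u w = j] = m j.
Hypothesis EX : forall u z, E (iX u) [set w | X u w = z].
Hypothesis PX : forall u z, P [set w | X u w = z] = t z.

(** The variables read by the tree rooted at v. The jump that leads to v is left
    out, so that the position of v can be conditioned upon. *)
Definition subtree_block (v : seq nat) : set I :=
  [set k | exists u, k = iN (u ++ v) \/ exists i, k = iX (u ++ i :: v)].

Definition subtree_avoid h v x : set Om :=
  [set w | avoid h (fun u => N (u ++ v) w) (fun u => X (u ++ v) w) x].

Lemma cat_cons_inj (u u' v : seq nat) i k : u ++ i :: v = u' ++ k :: v -> i = k.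
Proof.
move=> H; have su : size u = size u'.
  by have := congr1 size H; rewrite !size_cat /=; lia.
by move/eqP: H; rewrite eqseq_cat// => /andP[_ /eqP[]].
Qed.

Lemma block_event_outside V x D c : block_event P E V D c ->
  block_event P E V [set w | ~ A x /\ D w] (outside x * c).
Proof.
move=> bD; rewrite /outside.
have [xA|xA] := boolP (x \in A).
  rewrite (_ : [set w | _] = set0) ?mul0e; first exact: block_event_set0.
  by apply/seteqP; split=> w // [] /=; rewrite inE in xA.
rewrite (_ : [set w | _] = D) ?mul1e//.
apply/seteqP; split=> w; first by case.
by move=> Dw; split=> //; move: xA; rewrite notin_setE.
Qed.

Lemma subtree_disjoint v i k : i != k ->
  ([set iX (i :: v)] `|` subtree_block (i :: v)) `&`
  ([set iX (k :: v)] `|` subtree_block (k :: v)) = set0.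
Proof.
move=> /eqP ik; apply/seteqP; split=> // a.
have below j b : ([set iX (j :: v)] `|` subtree_block (j :: v)) b ->
    exists u, b = iN (u ++ j :: v) \/ b = iX (u ++ j :: v).
  move=> [->|[u [->|[l ->]]]]; first by exists [::]; right.
    by exists u; left.
  by exists (rcons u l); right; rewrite cat_rcons.
move=> [/below[u [->|->]] /below[u' [|]]].
- by move=> /iN_inj/cat_cons_inj.
- by move=> /iNX.
- by move=> /esym/iNX.
- by move=> /iX_inj/cat_cons_inj.
Qed.

Lemma subtree_block_edge v i : ~ subtree_block (i :: v) (iX (i :: v)).
Proof.
move=> [u [/esym/iNX //|[k /iX_inj/(congr1 size)]]].
by rewrite size_cat /=; lia.
Qed.

Section Offspring.
Variables (D : seq nat -> lattice d -> set Om) (q : lattice d -> \bar R).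
Hypothesis bD : forall v x, block_event P E (subtree_block v) (D v x) (q x).

Lemma block_event_children v x a b :
  block_event P E (\bigcup_i ([set iX (i :: v)] `|` subtree_block (i :: v)))
    [set w | forall i, (a <= i < b)%N -> D (i :: v) (x + X (i :: v) w)%R w]
    (step t q x ^+ (b - a)).
Proof.
apply: (block_event_forest E_meas E_indep (jX := fun i => iX (i :: v))
    (S := fun i => subtree_block (i :: v)) (X := fun i => X (i :: v))
    (D := fun i => D (i :: v))) => //.
- by move=> i; exact: subtree_block_edge.
- by move=> i k; exact: subtree_disjoint.
Qed.

Lemma block_event_offspring v x :
  block_event P E (subtree_block v)
    [set w | forall i, (i < N v w)%N -> D (i :: v) (x + X (i :: v) w)%R w]
    (gf m (step t q x)).
Proof.
rewrite (_ : [set w | _] = \bigcup_j ([set w | N v w = j] `&`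
  [set w | forall i, (0 <= i < j)%N -> D (i :: v) (x + X (i :: v) w)%R w]));
  last first.
  apply/seteqP; split=> w; first by move=> H; exists (N v w).
  by move=> [j _ [/= <-]].
apply: block_event_bigcup => //.
  by move=> j j' _ _ [w [[/= <- _] [/= <- _]]].
move=> j; rewrite -(PN v j) -[X in _ ^+ X](subn0 j).
apply: (@block_event_sub _ _ _ _ _ _ ([set iN v] `|`
  \bigcup_i ([set iX (i :: v)] `|` subtree_block (i :: v)))).
  move=> k [->|[i _ [->|[u [->|[l ->]]]]]].
  - by exists [::]; left.
  - by exists [::]; right; exists i.
  - by exists (rcons u i); left; rewrite cat_rcons.
  - by exists (rcons u l); right; exists i; rewrite cat_rcons.
apply: block_eventI => //.
- apply/seteqP; split=> // k [/= -> [i _ [/iNX //|[u [/iN_inj/(congr1 size)|]]]]].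
    by rewrite size_cat /=; lia.
  by move=> [l /iNX].
- by apply: block_event_var => //; exact: EN.
- exact: block_event_children.
Qed.

End Offspring.

Lemma subtree_avoidS h v x w : subtree_avoid h.+1 v x w <-> ~ A x /\
  forall i, (i < N v w)%N -> subtree_avoid h (i :: v) (x + X (i :: v) w)%R w.
Proof.
have shift (Z : Type) (f : seq nat -> Om -> Z) i :
    (fun u => f ((u ++ [:: i]) ++ v) w) = (fun u => f (u ++ i :: v) w).
  by apply/funext => u; rewrite -catA.
rewrite /subtree_avoid /=; split.
  by move=> /avoidS[Ax H]; split=> // i /H /=; rewrite !shift.
by move=> [Ax H]; apply/avoidS; split=> // i /H /=; rewrite !shift.
Qed.

Lemma block_event_subtree h v x :
  block_event P E (subtree_block v) (subtree_avoid h v x) (avoid_prob h x).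
Proof.
elim: h v x => [|h IH] v x.
  rewrite /= -[outside x]mule1 (_ : subtree_avoid 0 v x =
    [set w | ~ A x /\ setT w]).
    by apply: block_event_outside; exact: block_event_setT.
  apply/seteqP; split=> w; first by move/avoid0.
  by move=> [Ax _]; apply/avoid0.
rewrite (_ : subtree_avoid h.+1 v x = [set w | ~ A x /\
  [set w | forall i, (i < N v w)%N ->
    subtree_avoid h (i :: v) (x + X (i :: v) w)%R w] w]).
  by apply: block_event_outside; exact: block_event_offspring.
by apply/seteqP; split=> w /subtree_avoidS.
Qed.

Definition subtree_avoid_all v x : set Om :=
  [set w | forall h, subtree_avoid h v x w].

Lemma subtree_avoid_allE v x w : subtree_avoid_all v x w <-> ~ A x /\
  forall i, (i < N v w)%N -> subtree_avoid_all (i :: v) (x + X (i :: v) w)%R w.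
Proof.
split=> [H|[Ax H] [|h]].
- split=> [|i iv h]; first by have /subtree_avoidS[] := H 1%N.
  by have /subtree_avoidS[_] := H h.+1; apply.
- exact/avoid0.
- by apply/subtree_avoidS; split=> // i iv; exact: H.
Qed.

Lemma subtree_avoid_dec h v x :
  subtree_avoid h.+1 v x `<=` subtree_avoid h v x.
Proof. by move=> w H u uT uh; apply: H => //; exact: leqW. Qed.

Lemma block_event_avoid_all (q : lattice d -> \bar R) v x :
  (forall x, avoid_prob h x @[h --> \oo] --> q x) ->
  block_event P E (subtree_block v) (subtree_avoid_all v x) (q x).
Proof.
move=> qlim; rewrite (_ : subtree_avoid_all v x = \bigcap_h subtree_avoid h v x).
  apply: (block_event_bigcap _ _ (qlim x)) => h; first exact: subtree_avoid_dec.
  exact: block_event_subtree.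
by apply/seteqP; split=> w H h; [move=> _; exact: H|exact: H].
Qed.

Lemma avoid_prob_cvg x :
  avoid_prob h x @[h --> \oo] --> P (subtree_avoid_all [::] x).
Proof.
have mD h : measurable (subtree_avoid h [::] x).
  by case: (block_event_subtree h [::] x).
rewrite (_ : subtree_avoid_all [::] x = \bigcap_h subtree_avoid h [::] x).
  rewrite (_ : (fun h => _) = fun h => P (subtree_avoid h [::] x)).
    apply: nonincreasing_cvg_mu => //.
    - by rewrite (le_lt_trans (probability_le1 _ _))// ltry.
    - exact: bigcapT_measurable.
    - by apply/nonincreasing_seqP => h; apply/subsetPset; exact: subtree_avoid_dec.
  apply/funext => h; apply/esym.
  exact: (block_event_prob E_indep (block_event_subtree h [::] x)).
by apply/seteqP; split=> w H h; [move=> _; exact: H|exact: H].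
Qed.

(** The branching property at the root. *)
Lemma avoid_all_rec (q : lattice d -> \bar R) x :
  (forall x, avoid_prob h x @[h --> \oo] --> q x) ->
  q x = outside x * gf m (step t q x).
Proof.
move=> qlim.
have <- := block_event_prob E_indep (block_event_avoid_all [::] x qlim).
apply: (@block_event_prob _ _ _ P _ _ E_indep (subtree_block [::])).
rewrite (_ : subtree_avoid_all [::] x = [set w | ~ A x /\
  [set w | forall i, (i < N [::] w)%N ->
    subtree_avoid_all [:: i] (x + X [:: i] w)%R w] w]).
  apply: block_event_outside; apply: block_event_offspring => v y.
  exact: block_event_avoid_all.
by apply/seteqP; split=> w /subtree_avoid_allE.
Qed.

End FiniteTree.

(** * The vertices after the root in the infinite tree *)

Section SpineCombinatorics.
Variables (s : nat -> nat * nat) (n : vertex -> nat).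

Lemma iter_parent l k p : iter l parent (k, p) = (k + (l - size p), drop l p)%N.
Proof.
elim: l => [|l IH]; first by rewrite /= sub0n addn0 drop0.
rewrite iterS IH; case E: (drop l p) => [|i q] /=.
  have pl : (size p <= l)%N.
    by rewrite -subn_eq0 -size_drop E.
  by rewrite drop_oversize ?leqW// subSn// addnS.
have lp : (l < size p)%N.
  by rewrite ltnNge; apply/negP => /drop_oversize; rewrite E.
by rewrite -add1n -drop_drop E /= drop0; congr (_, _); lia.
Qed.

Lemma anc_eq_root u : anc_eq u root_inf <-> u.2 = [::].
Proof.
case: u => k p /=; split=> [[l]|->]; first by rewrite iter_parent /= => -[_ ->].
by exists k; rewrite iter_parent subn0.
Qed.

Lemma anc_eq_spine l k p : anc_eq (l, [::]) (k, p) <-> (k <= l)%N.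
Proof.
split=> [[h]|kl]; first by rewrite iter_parent => -[-> _]; rewrite leq_addr.
exists (size p + (l - k))%N; rewrite iter_parent; congr (_, _); first by lia.
by rewrite drop_oversize// leq_addr.
Qed.

(** The last common ancestor with c_0 is on the spine, and there the depth-first
    order compares the first step off the spine with the marked child. *)
Lemma T_plusE v : T_plus s n v <->
  [/\ in_inf_tree s n v, v.2 <> [::]
    & (0 < v.1)%N -> ((s v.1.-1).2 < last 0%N v.2)%N].
Proof.
case: v => k p /=; split.
  move=> [vT dv vr]; have k0p : k = 0%N -> p <> [::].
    by move=> k0 p0; move: vr; rewrite k0 p0.
  case: k => [|k] in vT dv vr k0p *; first by split=> //; exact: k0p.
  case: dv => [/anc_eq_spine //|[w [a [b [[wr wv wl] [pa ar] [pb bv] rab]]]]].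
  case: w => l q in wr wv wl pa pb.
  move/anc_eq_root: wr => /= q0; rewrite {}q0 in wv wl pa pb.
  move/anc_eq_spine: wv => kl.
  have lk : (l <= k.+1)%N.
    apply/anc_eq_spine; apply: wl; first exact/anc_eq_root.
    exact/anc_eq_spine.
  have {kl lk} lE : l = k.+1 by apply/eqP; rewrite eqn_leq lk kl.
  rewrite {}lE in wl pa pb.
  case: a => la qa in pa ar rab.
  move/anc_eq_root: ar => /= qa0; rewrite {}qa0 /= in pa rab; case: pa => laE.
  case: b => lb [|i qb] /= in pb bv rab.
    by case: pb => lbE; move/anc_eq_spine: bv; rewrite lbE ltnn.
  case: pb => lbE qb0; rewrite {}qb0 in bv; case: bv => h.
  rewrite iter_parent => -[_ dE].
  have pE : p = rcons (take h p) i by rewrite -cats1 dE cat_take_drop.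
  by split=> [//|p0|_]; [rewrite p0 in dE|rewrite pE last_rcons -laE].
move=> [vT p0 rk]; split=> //; last by apply/eqP => -[].
case: k => [|k] in vT rk *; first by left; exact/anc_eq_spine.
right; exists (k.+1, [::]), (k, [::]), (k.+1, [:: last 0%N p]); split=> //.
- split; [exact/anc_eq_root|exact/anc_eq_spine|].
  by case=> l q /anc_eq_root /= -> /anc_eq_spine kl; apply/anc_eq_spine.
- by split=> //; exact/anc_eq_root.
- split=> //; clear vT rk; case/lastP: p p0 => [//|p i] _.
  exists (size p); rewrite iter_parent last_rcons size_rcons drop_rcons//.
  by rewrite drop_size /=; congr (_, _); lia.
- exact: rk.
Qed.

Lemma in_inf_tree_cat1 k u i : in_inf_tree s n (k, u ++ [:: i]) =
  [&& (i < nb_children s n (k, [::]))%N,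
      ~~ ((0 < k)%N && (i == (s k.-1).2))
    & in_tree (fun v => n (k, v ++ [:: i])) u].
Proof.
rewrite /in_inf_tree /=; elim: u => [|j u IH] /=; first by rewrite andbT.
rewrite IH -!andbA; congr [&& _, _, _ & _].
by case: k {IH} => [|k] /=; case: u => [|j' u] /=; rewrite ?andbT ?andbF.
Qed.

Context {d : nat}.
Variable xi : vertex -> lattice d.

(** The position of c_{-k} for a walk that is at x at c_0. *)
Definition spine_pos (x : lattice d) (k : nat) : lattice d :=
  x - \sum_(j < k) xi (j : nat, [::]).

Lemma spine_posS x k : spine_pos x k.+1 = spine_pos x k - xi (k, [::]).
Proof. by rewrite /spine_pos big_ord_recr /= opprD addrA. Qed.

Lemma inf_pos_cat1 x k u i : inf_pos x xi (k, u ++ [:: i]) =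
  tree_pos (spine_pos x k + xi (k, [:: i])) (fun v => xi (k, v ++ [:: i])) u.
Proof.
rewrite /inf_pos /=; elim: u => [//|j u IH] /=.
by rewrite IH.
Qed.

(** Every vertex of T_plus lies below exactly one first vertex off the spine, so
    that avoidance splits over the branches that leave the spine. *)
Lemma T_plus_range_avoid (A : set (lattice d)) x :
  T_plus_range s n xi x `&` A = set0 <->
  forall k i, (if k is k'.+1 then (s k').2 < i < (s k').1 else i < n (0, [::]))%N ->
    forall u, in_tree (fun v => n (k, v ++ [:: i])) u ->
    ~ A (tree_pos (spine_pos x k + xi (k, [:: i])) (fun v => xi (k, v ++ [:: i])) u).
Proof.
split=> [H k i ki u uT Au|H].
  have : (T_plus_range s n xi x `&` A) (inf_pos x xi (k, u ++ [:: i])).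
    split; last by rewrite inf_pos_cat1.
    exists (k, u ++ [:: i]) => //; apply/T_plusE; split=> /=.
    - rewrite in_inf_tree_cat1 uT andbT.
      case: k ki {uT Au} => [->//|k /= /andP[ki ->]] /=.
      by rewrite gtn_eqF.
    - by case: u {uT Au}.
    - by case: k ki {uT Au} => [//|k /= /andP[ki _] _]; rewrite last_cat.
  by rewrite H.
apply/seteqP; split=> // y [[[k p] /T_plusE[]]] /= + + + <-.
case/lastP: p => [//|u i]; rewrite -cats1 in_inf_tree_cat1 inf_pos_cat1 last_cat.
move=> /and3P[iN _ uT] _ /= rk; apply: H => //.
by case: k iN rk {uT} => [//|k] /= -> ->.
Qed.

End SpineCombinatorics.

(** * The infinite tree seen from its spine *)

Section SpineWalk.
Local Open Scope ereal_scope.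
Context {R : realType} {d : nat}.
Variable A : set (lattice d).
Variables (m : nat -> \bar R) (t : lattice d -> \bar R).
Context {dO : measure_display} {Om : measurableType dO}.
Variable P : probability Om R.
Let I : choiceType := (nat + (vertex + vertex))%type.
Variable E : I -> set_system Om.
Hypothesis E_meas : forall i F, E i F -> measurable F.
Hypothesis E_indep : mutually_independent P E.
Variables (S : nat -> Om -> nat * nat) (N : vertex -> Om -> nat)
  (X : vertex -> Om -> lattice d).
Let iS k : I := inl k.
Let iN v : I := inr (inl v).
Let iX v : I := inr (inr v).
Hypothesis ES : forall k a, E (iS k) [set w | S k w = a].
Hypothesis PS : forall k j i,
  P [set w | S k w = (j, i)] = if (i < j)%N then m j else 0.
Hypothesis EN : forall v j, E (iN v) [set w | N v w = j].
Hypothesis PN : forall v j, P [set w | N v w = j] = m j.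
Hypothesis EX : forall v z, E (iX v) [set w | X v w = z].
Hypothesis PX : forall v z, P [set w | X v w = z] = t z.
Variable q : lattice d -> \bar R.
Hypothesis q_lim :
  forall x, avoid_prob A m t h x @[h --> \oo] --> q x.

Let avoids k i x : set Om :=
  subtree_avoid_all A (fun u => N (k, u)) (fun u => X (k, u)) [:: i] x.

Definition first_branch (k : nat) (w : Om) : nat :=
  if k is k'.+1 then (S k' w).2.+1 else 0%N.

Definition nb_branches (k : nat) (w : Om) : nat :=
  if k is k'.+1 then (S k' w).1 else N (0%N, [::]) w.

Definition level_avoid k y : set Om :=
  [set w | forall i, (first_branch k w <= i < nb_branches k w)%N ->
    avoids k i (y + X (k, [:: i]) w)%R w].

Let level_block k : set I := [set a |
  (exists2 l, k = l.+1 & a = iS l) \/ (exists u, a = iN (k, u)) \/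
  (exists i u, a = iX (k, i :: u))].

Let level_block_inj l k b : level_block l b -> level_block k b -> l = k.
Proof.
move=> [[l1 -> ->]|[[u ->]|[i [u ->]]]] [[l2 -> []]|[[u2 []]|[i2 [u2 []]]]] //.
by move=> ->.
Qed.

Let level_block_spine k l : ~ level_block k (iX (l, [::])).
Proof. by move=> [[l2 //]|[[u //]|[i [u []]]]]. Qed.

Let iN_inj k : injective (fun u => iN (k, u)). Proof. by move=> u v []. Qed.
Let iX_inj k : injective (fun u => iX (k, u)). Proof. by move=> u v []. Qed.
Let iNX k u v : iN (k, u) <> iX (k, v). Proof. by []. Qed.

Let avoids_block k v x :
  block_event P E (subtree_block (fun u => iN (k, u)) (fun u => iX (k, u)) v)
    (subtree_avoid_all A (fun u => N (k, u)) (fun u => X (k, u)) v x) (q x).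
Proof.
by apply: (block_event_avoid_all E_meas E_indep (@iN_inj k) (@iX_inj k)
  (@iNX k) (fun u => EN (k, u)) (fun u => PN (k, u)) (fun u => EX (k, u))
  (fun u => PX (k, u))).
Qed.

Lemma block_event_level0 y :
  block_event P E (level_block 0) (level_avoid 0 y) (gf m (step t q y)).
Proof.
have bO := block_event_offspring E_meas E_indep
  (@iN_inj 0%N) (@iX_inj 0%N) (@iNX 0%N) (fun u => EN (0%N, u)) (fun u => PN (0%N, u))
  (fun u => EX (0%N, u)) (fun u => PX (0%N, u)) (avoids_block 0%N) [::] y.
apply: block_event_sub bO.
move=> b [u [->|[i ->]]]; first by right; left; exists (u ++ [::]).
right; right; case: u => [|j u]; first by exists i, [::].
by exists j, (u ++ [:: i]).
Qed.

Lemma block_event_levelS k y :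
  block_event P E (level_block k.+1) (level_avoid k.+1 y)
    (branch_gf m (step t q y)).
Proof.
rewrite (_ : level_avoid _ _ = \bigcup_(a : nat * nat)
    ([set w | S k w = a] `&` [set w | forall i, (a.2.+1 <= i < a.1)%N ->
      avoids k.+1 i (y + X (k.+1, [:: i]) w)%R w])); last first.
  apply/seteqP; split=> w; first by move=> H; exists (S k w).
  by move=> [[j r] _ [/= Sk H]] i /=; rewrite Sk; exact: H.
apply: (block_event_bigcup E_indep) => [a b _ _ [w [[/= <- _] [/= <- _]]] //|[j r]].
rewrite /= -(PS k j r); apply: (@block_event_sub _ _ _ _ _ _ ([set iS k] `|`
  \bigcup_i ([set iX (k.+1, [:: i])] `|` subtree_block (fun u => iN (k.+1, u))
    (fun u => iX (k.+1, u)) [:: i]))).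
  move=> a [->|[i _ [->|[u [->|[l ->]]]]]].
  - by left; exists k.
  - by right; right; exists i, [::].
  - by right; left; exists (u ++ [:: i]).
  - right; right; case: u => [|j' u]; first by exists l, [:: i].
    by exists j', (u ++ [:: l; i]).
apply: (block_eventI E_meas).
- by apply/seteqP; split=> // a [-> [i _ [//|[u [//|[l //]]]]]].
- by apply: block_event_var => //; exact: ES.
- exact: (block_event_children E_meas E_indep
    (@iN_inj k.+1) (@iX_inj k.+1) (@iNX k.+1) (fun u => EX (k.+1, u))
    (fun u => PX (k.+1, u)) (avoids_block k.+1) [::] y).
Qed.

Variable a : lattice d.

Let pos k w := spine_pos (fun v => X v w) a k.

Let spine_event k y : set Om :=
  [set w | pos k w = y /\ forall l, (l <= k)%N -> level_avoid l (pos l w) w].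

Let spine_block k : set I := [set b |
  (exists2 l, (l <= k)%N & level_block l b) \/
  (exists2 l, (l < k)%N & b = iX (l, [::]))].

Let start (y : lattice d) : \bar R := gf m (step t q y) * delta0 (y - a)%R.

(** Killed evolution of the position of c_{-k}. Jumps go from parent to child,
    so that the mass at y comes from the points y + z, which step averages. *)
Definition spine_prob k (y : lattice d) : \bar R :=
  iter k (fun f y => branch_gf m (step t q y) * step t f y) start y.

Let block_event_spine k y :
  block_event P E (spine_block k) (spine_event k y) (spine_prob k y).
Proof.
have level0 : level_block 0 `<=` spine_block 0.
  by move=> b Hb; left; exists 0%N.
elim: k y => [|k IH] y.
  have pos0 w : pos 0 w = a by rewrite /pos /spine_pos big_ord0 subr0.
  rewrite /= /start /delta0 subr_eq0; have [->|ya] := eqVneq y a.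
    rewrite mule1; apply: (block_event_sub level0).
    rewrite (_ : spine_event 0 a = level_avoid 0 a).
      exact: block_event_level0.
    apply/seteqP; split=> w; first by move=> [_ /(_ 0%N (leqnn _))]; rewrite pos0.
    by move=> H; split=> // l; rewrite leqn0 => /eqP ->; rewrite pos0.
  rewrite mule0 (_ : spine_event 0 y = set0); first exact: block_event_set0.
  apply/seteqP; split=> w // [+ _]; rewrite pos0 => ay.
  by rewrite ay eqxx in ya.
rewrite (_ : spine_event k.+1 y =
    (\bigcup_z (spine_event k (y + z)%R `&` [set w | X (k, [::]) w = z]))
    `&` level_avoid k.+1 y); last first.
  have posS w : pos k.+1 w = (pos k w - X (k, [::]) w)%R.
    by rewrite /pos spine_posS.
  apply/seteqP; split=> w.
    move=> [<- H]; split; last by apply: H.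
    exists (X (k, [::]) w) => //; split=> //; split=> [|l lk].
      by rewrite posS subrK.
    by apply: H; exact: leqW.
  move=> [[z _ [[pk H] /= Xz]] Hk]; have pkS : pos k.+1 w = y.
    by rewrite posS pk Xz addrK.
  split=> // l; rewrite leq_eqVlt => /orP[/eqP ->|]; first by rewrite pkS.
  by rewrite ltnS; exact: H.
rewrite /spine_prob iterS muleC -/(spine_prob k).
apply: (@block_event_sub _ _ _ _ _ _
    ((spine_block k `|` [set iX (k, [::])]) `|` level_block k.+1)).
  move=> b [[[[l lk Hb]|[l lk Hb]]|->]|Hb].
  - by left; exists l => //; exact: leqW.
  - by right; exists l => //; exact: leqW.
  - by right; exists k.
  - by left; exists k.+1.
apply: (block_eventI E_meas); last exact: block_event_levelS.
  apply/seteqP; split=> // b [[[[l lk Hb]|[l lk ->]]|->]].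
  - by move=> /(level_block_inj Hb) lE; rewrite lE ltnn in lk.
  - by move=> /level_block_spine.
  - by move=> /level_block_spine.
apply: (block_event_bigcup E_indep).
  by move=> z z' _ _ [w [[_ /= <-] [_ /= <-]]].
move=> z; rewrite muleC -(PX (k, [::]) z); apply: (block_eventI E_meas).
- apply/seteqP; split=> // b [[[l lk Hb]|[l lk ->]] /= bE]; last first.
    by case: bE => lE; rewrite lE ltnn in lk.
  by rewrite bE in Hb; case: (level_block_spine Hb).
- exact: IH.
- by apply: block_event_var => //; exact: EX.
Qed.

Let spine_event_avoid k : set Om := \bigcup_y spine_event k y.

Let T_plus_avoidE :
  [set w | T_plus_range (fun k => S k w) (fun v => N v w) (fun v => X v w) a
     `&` A = set0] = \bigcap_k spine_event_avoid k.
Proof.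
have avoid_allE k i w : avoids k i (pos k w + X (k, [:: i]) w)%R w <->
  forall u, in_tree (fun v => N (k, v ++ [:: i]) w) u ->
    ~ A (tree_pos (pos k w + X (k, [:: i]) w)%R
          (fun v => X (k, v ++ [:: i]) w) u).
  split=> [H u uT|H h u uT _]; last exact: H.
  exact: (H (size u)).
apply/seteqP; split=> w.
  move=> /T_plus_range_avoid H k _; exists (pos k w) => //; split=> // l _ i li.
  by apply/avoid_allE; apply: H; case: l li.
move=> H; apply/T_plus_range_avoid => k i ki; apply/avoid_allE.
by have [y _ [_ /(_ k (leqnn k))]] := H k Logic.I; apply; case: k ki.
Qed.

(** Reading the spine from c_0 outwards, avoidance by the branches acts on
    the reversed walk as a killing. *)
Lemma T_plus_avoid_cvg :
  \esum_(y in [set: lattice d]) spine_prob k y @[k --> \oo] -->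
  P [set w | T_plus_range (fun k => S k w) (fun v => N v w) (fun v => X v w) a
     `&` A = set0].
Proof.
have tI k : trivIset setT (spine_event k).
  by move=> y y' _ _ [w [[<- _] [<- _]]].
have mD k : measurable (spine_event_avoid k).
  by apply: measurable_bigcup_countType => y; case: (block_event_spine k y).
rewrite T_plus_avoidE.
rewrite (_ : (fun k => _) = fun k => P (spine_event_avoid k)); last first.
  apply/funext => k; rewrite /spine_event_avoid prob_bigcup_countType//.
    apply: eq_esum => y _.
    exact/esym/(block_event_prob E_indep (block_event_spine k y)).
  by move=> y; case: (block_event_spine k y).
apply: nonincreasing_cvg_mu => //.
- by rewrite (le_lt_trans (probability_le1 _ _))// ltry.
- exact: bigcapT_measurable.
- apply/nonincreasing_seqP => k; apply/subsetPset => w [y _ [_ H]].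
  by exists (pos k w) => //; split=> // l lk; apply: H; exact: leqW.
Qed.

End SpineWalk.

(** * Generating functions of a critical offspring law *)

Section Offspring.
Local Open Scope ereal_scope.
Context {R : realType}.
Variable m : nat -> \bar R.
Hypothesis m_ge0 : forall j, 0 <= m j.
Hypothesis m_sum : \esum_(j in [set: nat]) m j = 1.
Hypothesis m_mean : \esum_(j in [set: nat]) (j%:R%:E * m j) = 1.

Lemma gf_ge0 (s : R) : (0 <= s)%R -> 0 <= gf m s%:E.
Proof.
by move=> s0; apply: esum_ge0 => j _; rewrite mule_ge0// -EFin_expe lee_fin exprn_ge0.
Qed.

Lemma branch_gf_ge0 (s : R) : (0 <= s)%R -> 0 <= branch_gf m s%:E.
Proof.
move=> s0; apply: esum_ge0 => a _; rewrite mule_ge0//; first by case: ifP.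
by rewrite -EFin_expe lee_fin exprn_ge0.
Qed.

Lemma le_branch_gf (s s' : R) : (0 <= s)%R -> (s <= s')%R ->
  branch_gf m s%:E <= branch_gf m s'%:E.
Proof.
move=> s0 ss'; apply: le_esum => a _; apply: lee_wpmul2l; first by case: ifP.
by rewrite -!EFin_expe lee_fin lerXn2r// nnegrE (le_trans s0).
Qed.

Lemma branch_gfE (s : R) : (0 <= s)%R ->
  branch_gf m s%:E =
  \esum_(j in [set: nat]) (m j * (\sum_(0 <= i < j) s ^+ i)%:E).
Proof.
move=> s0; rewrite /branch_gf.
pose a j i := (if (i < j)%N then m j else 0) * s%:E ^+ (j - i.+1).
have a0 j i : 0 <= a j i.
  rewrite /a mule_ge0//; first by case: ifP.
  by rewrite -EFin_expe lee_fin exprn_ge0.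
transitivity (\esum_(j in [set: nat]) \esum_(i in [set: nat]) a j i).
  rewrite esum_esum//; congr (esum _ _).
  by apply/seteqP; split.
apply: eq_esum => j _; rewrite (@esum_nat_split _ _ j)//.
rewrite [X in _ + X]esum1 ?adde0; last first.
  by move=> i _; rewrite /a ltnNge leq_addr mul0e.
rewrite big_nat_rev/= -sumEFin ge0_sume_distrr; last first.
  by move=> i _; rewrite lee_fin exprn_ge0.
rewrite [LHS]big_nat [RHS]big_nat; apply: eq_bigr => i /= ij.
rewrite /a add0n (_ : (j - i.+1 < j)%N) -?EFin_expe; last by lia.
by congr (_ * (_ ^+ _)%:E); lia.
Qed.

Lemma branch_gf1 : branch_gf m 1%:E = 1.
Proof.
rewrite branch_gfE// -[RHS]m_mean; apply: eq_esum => j _.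
rewrite muleC; congr (_%:E * _); under eq_bigr do rewrite expr1n.
by rewrite sumr_const_nat subn0.
Qed.

Lemma branch_gf_le1 (s : R) : (0 <= s <= 1)%R -> branch_gf m s%:E <= 1.
Proof. by move=> /andP[s0 s1]; rewrite -branch_gf1 le_branch_gf. Qed.

(** Summing by parts, that is: when each child is chosen independently with
    probability 1 - s and some child is chosen, there is a last chosen one. *)
Lemma branch_gf_gf (s : R) : (0 <= s <= 1)%R ->
  branch_gf m s%:E * (1 - s)%:E + gf m s%:E = 1.
Proof.
move=> /andP[s0 s1]; have s1' : (0 <= 1 - s)%R by rewrite subr_ge0.
have sum0 j : (0 <= \sum_(0 <= i < j) s ^+ i)%R.
  by apply: sumr_ge0 => i _; rewrite exprn_ge0.
rewrite branch_gfE// muleC -esumZl//; last first.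
  by move=> j; rewrite mule_ge0// lee_fin.
rewrite -esumD; last 2 first.
- by move=> j _; rewrite mule_ge0// mule_ge0// lee_fin.
- by move=> j _; rewrite mule_ge0// -EFin_expe lee_fin exprn_ge0.
rewrite -[RHS]m_sum; apply: eq_esum => j _.
rewrite muleCA -EFin_expe -ge0_muleDr ?lee_fin ?mulr_ge0 ?exprn_ge0//.
rewrite -EFinM -EFinD big_mkord -opprB mulNr -subrX1 opprB subrK.
by rewrite mule1.
Qed.

Lemma gf_le1 (s : R) : (0 <= s <= 1)%R -> gf m s%:E <= 1.
Proof.
move=> s01; rewrite -(branch_gf_gf s01) leeDr// mule_ge0//.
  by rewrite branch_gf_ge0; case/andP: s01.
by rewrite lee_fin subr_ge0; case/andP: s01.
Qed.

Lemma gf_bernoulli (s : R) : (0 <= s <= 1)%R -> 1 <= gf m s%:E + (1 - s)%:E.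
Proof.
move=> s01; rewrite -{1}(branch_gf_gf s01) addeC leeD2l// -[leRHS]mul1e.
by rewrite lee_wpmul2r ?branch_gf_le1// lee_fin subr_ge0; case/andP: s01.
Qed.

Lemma gf_ge (s : R) : (0 <= s)%R -> m 0%N <= gf m s%:E.
Proof.
move=> s0; rewrite -[leLHS]mule1.
apply: (@esum_term _ _ (fun j => m j * s%:E ^+ j) 0%N) => j.
by rewrite mule_ge0// -EFin_expe lee_fin exprn_ge0.
Qed.

Let m_fin j : m j \is a fin_num.
Proof.
rewrite ge0_fin_numE//; apply: le_lt_trans (ltry 1); rewrite -m_sum.
exact: esum_term.
Qed.

(** Whatever s is, the marked child may be the last one. *)
Lemma branch_gf_pos : exists2 k0 : R, (0 < k0)%R &
  forall s : R, (0 <= s)%R -> k0%:E <= branch_gf m s%:E.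
Proof.
have [j j0 mj] : exists2 j, (0 < j)%N & 0 < m j.
  apply: contrapT => H; have : 0%R = 1 :> \bar R; last by move=> /eqP; rewrite lt_eqF.
  rewrite -m_mean esum1// => -[|j] _; first by rewrite mul0e.
  suff -> : m j.+1 = 0 by rewrite mule0.
  apply/eqP; rewrite eq_le m_ge0 andbT leNgt; apply/negP => mj.
  by apply: H; exists j.+1.
exists (fine (m j)); first by rewrite fine_gt0// mj ltey_eq m_fin.
move=> s s0; rewrite fineK// branch_gfE//.
apply: (@le_trans _ _ (m j * (\sum_(0 <= i < j) s ^+ i)%:E)).
  rewrite -[leLHS]mule1; apply: lee_wpmul2l => //; rewrite lee_fin.
  case: j j0 {mj} => // j _; rewrite big_nat_recl// expr0 lerDl.
  by apply: sumr_ge0 => i _; rewrite exprn_ge0.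
apply: (@esum_term _ _ (fun j => m j * (\sum_(0 <= i < j) s ^+ i)%:E)) => i.
by rewrite mule_ge0// lee_fin sumr_ge0// => l _; rewrite exprn_ge0.
Qed.

(** Without mass at 0, the mean exceeds the total mass by the sum of
    (j - 1) * m j, which must therefore vanish. *)
Lemma critical_extinct : m 0%N = 0 -> m 1%N = 1 /\ forall j, j != 1%N -> m j = 0.
Proof.
move=> m00.
have fin_sum : \esum_(j in [set: nat]) m j \is a fin_num by rewrite m_sum.
have split j : j%:R%:E * m j = m j + j.-1%:R%:E * m j.
  case: j => [|j]; first by rewrite m00 !mule0 adde0.
  by rewrite -{2}[m j.+1]mul1e -ge0_muleDl// -EFinD -mulrS.
have excess0 : \esum_(j in [set: nat]) (j.-1%:R%:E * m j) = 0.
  have := m_mean; under eq_esum do rewrite split.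
  rewrite esumD// => [|j _]; last by rewrite mule_ge0.
  rewrite m_sum => /(congr1 (fun z => z - 1)).
  by rewrite addeAC subee// add0e.
have m0 j : j != 1%N -> m j = 0.
  case: j => [//|[//|j] _].
  apply/eqP; rewrite eq_le m_ge0 andbT.
  apply: (@le_trans _ _ (j.+1%:R%:E * m j.+2)).
    by rewrite -[leLHS]mul1e lee_wpmul2r// lee_fin ler1n.
  rewrite -excess0; apply: (@esum_term _ _ (fun j => j.-1%:R%:E * m j) j.+2).
  by move=> i; rewrite mule_ge0.
split=> //; rewrite -m_sum (@esum_nat_split _ _ 2)//.
rewrite [X in _ + X]esum1 ?adde0; last by move=> j _; exact: m0.
by rewrite !big_nat_recr//= big_nil m00 !add0e.
Qed.

End Offspring.

(** * The dyadic form of the dimension condition *)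

Section DyadicSum.
Context {R : realType}.
Variables (alpha : R) (L psi : R -> R) (D : nat).
Hypothesis alpha1 : 1 < alpha.
Hypothesis D0 : (0 < D)%N.
Hypothesis L_slow : slowly_varying L.
Hypothesis psiE : forall e, 0 < e <= 1 -> psi e = e `^ (alpha - 1) * L e^-1.
Hypothesis psi_ge0 : forall e, 0 < e <= 1 -> 0 <= psi e.
Hypothesis le_psi : forall e e', 0 < e -> e <= e' -> e' <= 1 -> psi e <= psi e'.

Let rho : R := (2 ^+ D)^-1.

(** At distance about 2 ^ j from the origin, hitting probabilities are of order
    rho ^ j, which psi turns into the damping; the Green function sums to about
    4 ^ j over that shell. *)
Definition dyadic_term (j : nat) : R := 4 ^+ j * psi (rho ^+ j).

Let rho0 : 0 < rho. Proof. by rewrite invr_gt0 exprn_gt0. Qed.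

Let rhoj j : 0 < rho ^+ j <= 1.
Proof.
rewrite exprn_gt0//= exprn_ile1//; first exact: ltW.
by rewrite invf_le1 ?exprn_gt0// exprn_ege1// ler1n.
Qed.

Lemma dyadic_term_ge0 j : 0 <= dyadic_term j.
Proof. by rewrite mulr_ge0 ?exprn_ge0 ?psi_ge0. Qed.

Let powR_expn (a r : R) j : 0 <= a -> (a ^+ j) `^ r = (a `^ r) ^+ j.
Proof.
move=> a0; rewrite -(powR_mulrn j a0) -(powR_mulrn j (powR_ge0 a r)).
exact: powRAC.
Qed.

Let power_natE (n : nat) : (n%:R ^+ D)^-1 `^ (alpha - 1) =
  n%:R `^ (- (D%:R * (alpha - 1))) :> R.
Proof. by rewrite -(powR_mulrn D (ler0n R n)) -powRN -powRrM mulNr. Qed.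

(** By slow variation, the ratio of consecutive terms tends to
    4 * rho `^ (alpha - 1), which is less than 1. *)
Lemma dyadic_sum_ratio : 2 / (alpha - 1) < D%:R ->
  (\esum_(j in [set: nat]) (dyadic_term j)%:E < +oo)%E.
Proof.
move=> Dbig; have a0 : 0 < alpha - 1 by rewrite subr_gt0.
have Dbig' : 2 < D%:R * (alpha - 1) by rewrite -ltr_pdivrMr.
pose r : R := 4 * rho `^ (alpha - 1).
have rho_pow0 : 0 < rho `^ (alpha - 1) by exact: powR_gt0.
have r0 : 0 < r by rewrite mulr_gt0.
have r1 : r < 1.
  have : rho `^ (alpha - 1) < 4^-1.
    rewrite /rho power_natE (_ : 4^-1 = 2 `^ (- 2)); last first.
      by rewrite (powR_invn 2)// -natrX.
    rewrite !powRN ltf_pV2 ?posrE ?powR_gt0//.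
    rewrite lt_neqAle (ler_powR _ (ltW Dbig')) ?ler1n// andbT.
    have l2 : ln (2 : R) != 0 by rewrite gt_eqF// ln_gt0// ltr1n.
    apply/eqP => /(congr1 (@ln R)); rewrite !ln_powR => /(mulIf l2) H.
    by rewrite -H ltxx in Dbig'.
  by rewrite /r => H; rewrite mulrC -ltr_pdivlMr// mul1r.
have termE j : dyadic_term j = r ^+ j * L ((2 ^+ D) ^+ j).
  rewrite /dyadic_term psiE// powR_expn ?(ltW rho0)// mulrA -exprMn.
  by rewrite -exprVn /rho invrK.
have [[x0 [_ Lpos]] Lcvg] := L_slow.
pose eta := (r + 1) / 2.
have reta : r < eta by rewrite /eta; lra.
have eta1 : eta < 1 by rewrite /eta; lra.
have eta0 : 0 < eta by lra.
have etar : 0 < eta / r - 1 by rewrite subr_gt0 ltr_pdivlMr// mul1r.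
have c0 : (0 : R) < 2 ^+ D by rewrite exprn_gt0.
have c2 : (2 : R) <= 2 ^+ D.
  by rewrite -[leLHS]expr1 ler_weXn2l// ler1n.
have /cvgrPdist_lt /(_ _ etar) [T0 [_ HT0]] := Lcvg _ c0.
pose M := Num.max T0 x0.
have [j0 Hj0] : exists j0, forall j, (j0 <= j)%N -> M < (2 ^+ D : R) ^+ j.
  pose j0 := (Num.truncn `|M|).+1; exists j0 => j j0j.
  have h1 : M < j0%:R.
    by apply: le_lt_trans (ler_norm _) _; exact: truncnS_gt.
  apply: (lt_le_trans h1).
  apply: (@le_trans _ _ (2 ^+ j)).
    rewrite -natrX ler_nat; apply: leq_trans j0j _.
    exact/ltnW/ltn_expl.
  by apply: lerXn2r => //; rewrite nnegrE// ltW.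
have ratio j : (j0 <= j)%N -> dyadic_term j.+1 <= eta * dyadic_term j.
  move=> /Hj0; set x := (2 ^+ D) ^+ j; rewrite gt_max => /andP[T0x x0x].
  have Lx : 0 < L x by apply: Lpos; exact: ltW.
  have := HT0 x T0x; rewrite /= ltr_norml => /andP[Hr _].
  have Hq : L (2 ^+ D * x) / L x <= eta / r by lra.
  rewrite !termE !exprS -/x; move: Hq; rewrite ler_pdivrMr// => Hq.
  rewrite -mulrA [leRHS]mulrCA (mulrCA r); apply: ler_wpM2l.
    by rewrite exprn_ge0// ltW.
  have -> : eta * L x = r * (eta / r * L x) by field; rewrite gt_eqF.
  by apply: ler_wpM2l; [exact: ltW|].
have geom k : dyadic_term (j0 + k) <= eta ^+ k * dyadic_term j0.
  elim: k => [|k IH]; first by rewrite addn0 mul1r.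
  rewrite addnS (le_trans (ratio _ _)) ?leq_addr// exprS -mulrA.
  by apply: ler_wpM2l => //; exact: ltW.
rewrite (@esum_nat_split _ _ j0); last first.
  by move=> n; rewrite lee_fin dyadic_term_ge0.
rewrite sumEFin lte_add_pinfty ?ltry//.
apply: (@le_lt_trans _ _ ((1 - eta)^-1 * dyadic_term j0)%:E); last exact: ltry.
apply: esum_nat_le => n; first by rewrite lee_fin dyadic_term_ge0.
rewrite sumEFin lee_fin.
apply: (@le_trans _ _ (\sum_(0 <= k < n) eta ^+ k * dyadic_term j0)).
  by apply: ler_sum => k _; exact: geom.
rewrite -mulr_suml; apply: ler_wpM2r; first exact: dyadic_term_ge0.
have e1 : 0 < 1 - eta by rewrite subr_gt0.
rewrite -[leRHS]mul1r ler_pdivlMr// big_mkord mulrC.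
rewrite -opprB mulNr -subrX1 opprB gerBl exprn_ge0// ltW//.
Qed.

(** Cauchy condensation; psi is monotone, although L need not be. *)
Lemma dyadic_sum_critical : D%:R = 2 / (alpha - 1) ->
  (\sum_(1 <= n <oo) (L (n%:R `^ (2 / (alpha - 1))) / n%:R)%:E < +oo)%E ->
  (\esum_(j in [set: nat]) (dyadic_term j)%:E < +oo)%E.
Proof.
move=> DE; rewrite -DE => Lsum.
have a0 : 0 < alpha - 1 by rewrite subr_gt0.
have Da : D%:R * (alpha - 1) = 2 by rewrite DE divfK// gt_eqF.
pose v n := n%:R * psi ((n%:R ^+ D)^-1).
have unit_interval n : (0 < n)%N -> 0 < ((n%:R : R) ^+ D)^-1 <= 1.
  move=> n0; rewrite invr_gt0 exprn_gt0 ?ltr0n//= invf_le1 ?exprn_gt0 ?ltr0n//.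
  by rewrite exprn_ege1// ler1n.
have v0 n : 0 <= v n.
  case: n => [|n]; first by rewrite /v mul0r.
  by rewrite mulr_ge0// psi_ge0// unit_interval.
have vE n : (0 < n)%N -> L (n%:R `^ D%:R) / n%:R = v n.
  move=> n0; rewrite /v psiE ?unit_interval// power_natE Da (powR_invn 2)//.
  rewrite invrK powR_mulrn// mulrA mulrC; congr (_ * _).
  by rewrite expr2 invfM mulrA divff ?mul1r// pnatr_eq0 -lt0n.
pose S := (\sum_(1 <= n <oo) (v n)%:E)%E.
have Sfin : (S < +oo)%E.
  apply: le_lt_trans Lsum; rewrite /S le_eqVlt; apply/orP; left; apply/eqP.
  apply: congr_lim; apply/funext => N /=.
  by rewrite [LHS]big_nat [RHS]big_nat; apply: eq_bigr => n /andP[n0 _]; rewrite vE.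
have block J : \sum_(0 <= j < J) dyadic_term j.+1 <= 4 * \sum_(2 <= n < (2 ^ J).+1) v n.
  elim: J => [|J IH]; first by rewrite !big_geq// mulr0.
  have J2 : (1 < (2 ^ J).+1)%N by rewrite ltnS expn_gt0.
  have JJ : ((2 ^ J).+1 <= (2 ^ J.+1).+1)%N by rewrite ltnS leq_exp2l.
  rewrite big_nat_recr//= (big_cat_nat J2 JJ)/= mulrDr lerD//.
  apply: (@le_trans _ _
    (4 * \sum_((2 ^ J).+1 <= n < (2 ^ J.+1).+1) 2 ^+ J * psi (rho ^+ J.+1))).
    rewrite sumr_const_nat subSS expnS mul2n -addnn addnK.
    rewrite /dyadic_term -(mulr_natr _ (2 ^ J)%N) natrX; set p := psi _.
    have -> : 4 ^+ J.+1 = 4 * (2 ^+ J * 2 ^+ J) :> R.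
      by rewrite -exprMn exprS -natrM.
    by rewrite le_eqVlt; apply/orP; left; apply/eqP; ring.
  apply: ler_wpM2l => //; rewrite [leLHS]big_nat [leRHS]big_nat.
  apply: ler_sum => n /andP[Jn nJ].
  have n0 : (0 < n)%N by exact: leq_trans Jn.
  apply: ler_pM => //.
  - by rewrite psi_ge0.
  - by rewrite -natrX ler_nat ltnW.
  apply: le_psi; [by case/andP: (rhoj J.+1)| |by case/andP: (unit_interval _ n0)].
  rewrite /rho exprVn -exprM mulnC exprM -exprVn exprVn lef_pV2 ?posrE.
  - by apply: lerXn2r; rewrite ?nnegrE// -natrX ler_nat -ltnS.
  - by rewrite exprn_gt0// exprn_gt0.
  - by rewrite exprn_gt0// ltr0n.
apply: (@le_lt_trans _ _ ((dyadic_term 0)%:E + 4%:E * S)%E); last first.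
  have S0 : (0 <= S)%E by apply: nneseries_ge0 => n _ _; rewrite lee_fin.
  by rewrite lte_add_pinfty ?ltry// lte_mul_pinfty// lee_fin.
rewrite (@esum_nat_split _ _ 1); last by move=> n; rewrite lee_fin dyadic_term_ge0.
rewrite big_nat1 leeD2l// esum_nat_le// => [n|J].
  by rewrite lee_fin dyadic_term_ge0.
rewrite sumEFin; apply: (@le_trans _ _ (4 * \sum_(2 <= n < (2 ^ J).+1) v n)%:E).
  by rewrite lee_fin; exact: block.
rewrite EFinM; apply: lee_wpmul2l => //; rewrite -sumEFin.
apply: (@le_trans _ _ (\sum_(1 <= n < (2 ^ J).+1) (v n)%:E)%E).
  by rewrite [leRHS]big_ltn ?ltnS ?expn_gt0// leeDr// lee_fin.
by apply: nneseries_lim_ge => n _ _; rewrite lee_fin.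
Qed.

End DyadicSum.

(** * Dyadic shells of the lattice *)

Section Shells.
Context {d : nat}.

Definition nrm (x : lattice d) : nat := \max_(i < d) `|x ord0 i|%N.

(** The dyadic scale of x; the successor places the origin in shell 0. *)
Definition lev (x : lattice d) : nat := trunc_log 2 (nrm x).+1.

Lemma nrm_coord (x : lattice d) i : (`|x ord0 i| <= nrm x)%N.
Proof. exact: (leq_bigmax i). Qed.

Lemma lev_bounds (x : lattice d) : (2 ^ lev x <= (nrm x).+1 < 2 ^ (lev x).+1)%N.
Proof. by rewrite trunc_logP//= trunc_log_ltn. Qed.

Lemma lattice_subE (x y : lattice d) i :
  (x - y)%R ord0 i = (x ord0 i - y ord0 i)%R.
Proof.
have -> : (x - y)%R ord0 i = ((x : 'rV[int]_d) - y)%R ord0 i by [].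
by rewrite !mxE.
Qed.

Lemma nrm_sub (x y : lattice d) : (nrm x <= nrm y + nrm (x - y)%R)%N.
Proof.
apply/bigmax_leqP => i _; apply: leq_trans (leq_add (nrm_coord y i) (nrm_coord (x - y)%R i)).
by rewrite lattice_subE; lia.
Qed.

(** The triangle inequality for scales costs one level. *)
Lemma lev_sub (x y : lattice d) : ((lev x).-1 <= lev y)%N || ((lev x).-1 <= lev (x - y)%R)%N.
Proof.
rewrite -[_ || _]negbK negb_or; apply/negP => /andP[]; rewrite -!ltnNge => hy hz.
have lx : (0 < lev x)%N by lia.
have /andP[hx _] := lev_bounds x.
have /andP[_ by1] := lev_bounds y; have /andP[_ bz1] := lev_bounds (x - y)%R.
have py : (2 ^ (lev y).+1 <= 2 ^ (lev x).-1)%N by rewrite leq_exp2l.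
have pz : (2 ^ (lev (x - y)%R).+1 <= 2 ^ (lev x).-1)%N by rewrite leq_exp2l.
have e2 : (2 ^ lev x = 2 * 2 ^ (lev x).-1)%N by rewrite -expnS prednK.
rewrite e2 in hx; move: hx (leq_trans by1 py) (leq_trans bz1 pz) (nrm_sub x y).
by move: (nrm x) (nrm y) (nrm (x - y)%R) (2 ^ (lev x).-1)%N => *; lia.
Qed.

Lemma size_ball (n : nat) (s : seq (lattice d)) : uniq s ->
  (forall x, x \in s -> (nrm x <= n)%N) -> (size s <= (2 * n).+1 ^ d)%N.
Proof.
move=> us sn.
pose code (x : lattice d) : {ffun 'I_d -> 'I_(2 * n).+1} :=
  [ffun i => inord `|(x ord0 i + n%:Z)%R|%N].
have code_inj : {in s &, injective code}.
  move=> x y /sn xn /sn yn /ffunP xy; apply/matrixP => i0 i.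
  rewrite (ord1 i0); have := xy i; rewrite !ffunE => /(congr1 val) /=.
  have := leq_trans (nrm_coord x i) xn; have := leq_trans (nrm_coord y i) yn.
  move=> h1 h2; rewrite !inordK; [move=> h|lia|lia].
  by have : x ord0 i = y ord0 i by lia.
have us' : uniq (map code s) by rewrite map_inj_in_uniq.
rewrite -(size_map code) -(card_uniqP us'); apply: leq_trans (max_card _) _.
by rewrite card_ffun !card_ord.
Qed.

Context {R : realType}.

Lemma esum_lev (f : nat -> \bar R) : (forall j, (0 <= f j)%E) ->
  (\esum_(x in [set: lattice d]) f (lev x) <=
   \esum_(j in [set: nat]) (((4 * 2 ^ j) ^ d)%N%:R%:E * f j))%E.
Proof.
move=> f0.
have shell j : (\esum_(x in [set: lattice d]) (((lev x == j)%:R : R)%:E) <=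
    ((4 * 2 ^ j) ^ d)%N%:R%:E)%E.
  apply: ge_ereal_sup => _ [X [finX _] <-].
  rewrite fsbig_finite//= sumEFin lee_fin -natr_sum ler_nat.
  rewrite -big_mkcond /= sum1_count -size_filter.
  apply: leq_trans (_ : ((2 * (2 ^ j.+1).-1).+1 ^ d <= _)%N); last first.
    have : ((2 * (2 ^ j.+1).-1).+1 <= 4 * 2 ^ j)%N by rewrite expnS; lia.
    by move: (2 * _).+1 (4 * _)%N => k l kl; case: (d) => // d'; rewrite leq_exp2r.
  apply: size_ball; first by rewrite filter_uniq// fset_uniq.
  move=> x; rewrite mem_filter => /andP[/eqP <- _].
  by have /andP[_] := lev_bounds x; lia.
apply: (@le_trans _ _ (\esum_(x in [set: lattice d]) \esum_(j in [set: nat])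
    (((lev x == j)%:R : R)%:E * f j)%E)).
  apply: le_esum => x _.
  have := @esum_term _ _ (fun j => ((lev x == j)%:R : R)%:E * f j)%E (lev x).
  by rewrite eqxx mul1e; apply => j; rewrite mule_ge0.
rewrite esum_swap; last by move=> x j; rewrite mule_ge0.
apply: le_esum => j _; under eq_esum do rewrite muleC.
by rewrite esumZl// muleC; apply: lee_wpmul2r.
Qed.

End Shells.

(** * Late losses are negligible *)

Section LateLoss.
Local Open Scope ereal_scope.
Context {R : realType} {d : nat}.
Variable D : nat.
Hypothesis dE : d = D.+2.
Variable t : lattice d -> \bar R.
Hypothesis t_ge0 : forall z, 0 <= t z.
Variable kap : lattice d -> R.
Hypothesis kap01 : forall y, (0 <= kap y <= 1)%R.
Variable u : lattice d -> \bar R.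
Hypothesis u_ge0 : forall y, 0 <= u y.
Local Notation pot := (pot t).
Let rho : R := ((2 ^+ D)^-1)%R.
Variables (b : nat -> R) (C' : R).
Hypothesis C'_ge0 : (0 <= C')%R.
Hypothesis pot_u_upper : forall x, pot u x <= (C' * rho ^+ lev x)%:E.
Hypothesis b_ge0 : forall j, (0 <= b j)%R.
Hypothesis b_dec : forall i j, (i <= j)%N -> (b j <= b i)%R.
Hypothesis kap_b : forall y, (1 - kap y <= b (lev y))%R.
Hypothesis b_sum : \esum_(j in [set: nat]) (4 ^+ j * b j)%:E < +oo.

Let rho_gt0 : (0 < rho)%R. Proof. by rewrite invr_gt0 exprn_gt0. Qed.

Let rho_ge0 j : (0 <= rho ^+ j)%R. Proof. by rewrite exprn_ge0// ltW. Qed.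

Let K : R := ((4 ^ d)%N%:R)%R.

Let K_ge0 : (0 <= K)%R. Proof. exact: ler0n. Qed.

(** On a shell of level j there are about 2 ^ (j d) points, at each of which the
    Green function is about 2 ^ (- j (d - 2)). *)
Let shell_mass j : ((((4 * 2 ^ j) ^ d)%N%:R : R) * rho ^+ j)%R = (K * 4 ^+ j)%R.
Proof.
rewrite expnMn natrM -mulrA; congr (_ * _)%R.
rewrite natrX natrX -exprM /rho exprVn -exprM dE.
rewrite (_ : (j * D.+2 = D * j + (j + j))%N); last by lia.
rewrite exprD mulrAC mulfV ?mul1r; last by rewrite expf_neq0.
by rewrite exprD -exprMn -natrM.
Qed.

Let late m y := late_loss t kap u m y.

Let kapC_ge0 y : 0 <= (1 - kap y)%:E.
Proof. by rewrite lee_fin subr_ge0; case/andP: (kap01 y). Qed.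

Let late_ge0 m y : 0 <= late m y.
Proof. by rewrite mule_ge0// pot_ge0// => z; exact: steps_ge0. Qed.

Let late_pointwise m y : late m y <= (b (lev y) * (C' * rho ^+ lev y))%:E.
Proof.
have pot_le : pot (iter m.+1 (step t) u) y <= (C' * rho ^+ lev y)%:E.
  apply: le_trans (pot_u_upper y).
  by rewrite (pot_split t_ge0 m.+1 y u_ge0) leeDr// sume_ge0// => n _;
    exact: steps_ge0.
rewrite EFinM; apply: (@le_trans _ _ ((1 - kap y)%:E * (C' * rho ^+ lev y)%:E)).
  exact: lee_wpmul2l.
by apply: lee_wpmul2r; rewrite lee_fin ?mulr_ge0.
Qed.

Let late_sum m : \esum_(y in [set: lattice d]) late m y =
  \esum_(n in [set: nat]) \esum_(y in [set: lattice d])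
    ((1 - kap y)%:E * iter (m.+1 + n) (step t) u y).
Proof.
rewrite esum_swap; last by move=> n y; rewrite mule_ge0// steps_ge0.
apply: eq_esum => y _; rewrite /late /late_loss pot_steps// esumZl// => n.
exact: steps_ge0.
Qed.

(** The losses at all times have a finite sum by the dyadic condition, and the
    late ones are a tail of it. *)
Lemma late_mass_small (e : R) : (0 < e)%R -> exists m0, forall m, (m0 <= m)%N ->
  \esum_(y in [set: lattice d]) late_loss t kap u m y < e%:E.
Proof.
move=> e0.
pose c n := \esum_(y in [set: lattice d]) ((1 - kap y)%:E * iter n (step t) u y).
have c0 n : 0 <= c n.
  by apply: esum_ge0 => y _; rewrite mule_ge0// steps_ge0.
have csum : \esum_(n in [set: nat]) c (1 + n)%N < +oo.
  rewrite -[X in X < _](late_sum 0).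
  apply: le_lt_trans (le_esum (fun y _ => late_pointwise 0 y)) _.
  apply: le_lt_trans (esum_lev (f := fun j => (b j * (C' * rho ^+ j))%:E) _) _.
    by move=> j; rewrite lee_fin !mulr_ge0.
  rewrite (_ : (fun j => _) = fun j => (K * C')%:E * (4 ^+ j * b j)%:E); last first.
    apply/funext => j; rewrite -!EFinM; congr _%:E.
    transitivity (((((4 * 2 ^ j) ^ d)%N%:R : R) * rho ^+ j) * (C' * b j))%R.
      by ring.
    by rewrite shell_mass; ring.
  rewrite esumZl; last 2 first.
  - by rewrite lee_fin mulr_ge0.
  - by move=> j; rewrite lee_fin mulr_ge0// exprn_ge0.
  by rewrite lte_mul_pinfty// lee_fin mulr_ge0.
have [m0 Hm0] := esum_tail_small (fun n => c0 (1 + n)%N) csum e0.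
exists m0 => m /Hm0; rewrite -/(late m) late_sum.
by congr (_ < _); apply: eq_esum => n _; rewrite /c addnA.
Qed.

Let b_small (e : R) : (0 < e)%R -> exists n, forall j, (n <= j)%N ->
  (4 ^+ j * b j <= e)%R.
Proof.
move=> e0; have b0 j : 0 <= (4 ^+ j * b j)%:E.
  by rewrite lee_fin mulr_ge0// exprn_ge0.
have [n Hn] := esum_tail_small b0 b_sum e0.
exists n => j /Hn /ltW Hj; rewrite -lee_fin; apply: le_trans Hj.
have := @esum_term _ _ (fun i => (4 ^+ (j + i) * b (j + i))%:E) 0%N.
by rewrite addn0; apply => i; exact: b0.
Qed.

Variables (gr : lattice d -> R) (C : R).
Hypothesis gr_ge0 : forall x, (0 <= gr x)%R.
Hypothesis pot_delta : forall x, pot delta0 x = (gr x)%:E.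
Hypothesis C_ge0 : (0 <= C)%R.
Hypothesis gr_upper : forall x, (gr x <= C * rho ^+ lev x)%R.
Variable F : set_system (lattice d).
Context {FF : Filter F}.
Variable c : R.
Hypothesis c_gt0 : (0 < c)%R.
Hypothesis gr_lower : \forall x \near F, (c * rho ^+ lev x <= gr x)%R.
Hypothesis lev_infty : forall n, \forall x \near F, (n <= lev x)%N.

Let near_ball J : (\esum_(z in [set: lattice d])
  (if (lev z <= J)%N then C * rho ^+ lev z else 0)%:E <= (C * K * 4 ^+ J.+1)%:E).
Proof.
pose f j := (if (j <= J)%N then C * rho ^+ j else 0)%R.
have f0 j : 0 <= (f j)%:E.
  by rewrite lee_fin /f; case: ifP => // _; rewrite mulr_ge0.
apply: le_trans (esum_lev f0) _.
rewrite (@esum_nat_split _ _ J.+1); last by move=> j; rewrite mule_ge0// lee_fin.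
rewrite [X in _ + X]esum1 ?adde0; last first.
  by move=> i _; rewrite /f (_ : (J.+1 + i <= J)%N = false) ?mule0//; lia.
under eq_bigr do rewrite -EFinM.
rewrite sumEFin lee_fin.
apply: (@le_trans _ _ (\sum_(0 <= j < J.+1) (C * K) * 4 ^+ j)%R).
  rewrite [leLHS]big_nat [leRHS]big_nat; apply: ler_sum => j /andP[_ jJ].
  rewrite /f -ltnS jJ mulrCA shell_mass.
  by rewrite mulrA.
rewrite -mulr_sumr; apply: ler_wpM2l; first by rewrite mulr_ge0.
elim: {f f0} J.+1 => [|k IH]; first by rewrite big_geq// exprn_ge0.
rewrite big_nat_recr//= exprS; have := IH; have : (0 <= (4 : R) ^+ k)%R by exact: exprn_ge0.
by lra.
Qed.

(** Either y is at distance comparable to x from x, and then the Green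
    function between them is at most a constant times its value at x; or y is
    at distance comparable to x from the origin, where the damping is weak. *)
Let late_split m x J : J = (lev x).-1 ->
  pot (late m) x <=
  (\esum_(y in [set: lattice d]) late m y) * (C * rho ^+ J)%:E +
  (b J * (C' * rho ^+ J))%:E * (C * K * 4 ^+ J.+1)%:E.
Proof.
move=> JE.
pose f (z : lattice d) := (if (lev z <= J)%N then C * rho ^+ lev z else 0)%:E.
have f0 z : 0 <= f z.
  by rewrite lee_fin; case: ifP => // _; rewrite mulr_ge0.
have rho_le i : (J <= i)%N -> (rho ^+ i <= rho ^+ J)%R.
  move=> Ji; apply: ler_wiXn2l => //; first exact: ltW.
  by rewrite /rho invf_le1 ?exprn_gt0// exprn_ege1// ler1n.
have A2 : 0 <= (b J * (C' * rho ^+ J))%:E by rewrite lee_fin !mulr_ge0.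
have A1 : 0 <= (C * rho ^+ J)%:E by rewrite lee_fin mulr_ge0.
rewrite pot_conv//.
apply: (@le_trans _ _ (\esum_(y in [set: lattice d])
   (late m y * (C * rho ^+ J)%:E + (b J * (C' * rho ^+ J))%:E * f (x - y)%R))).
  apply: le_esum => y _; rewrite pot_delta.
  have [Jxy|Jxy] := leqP J (lev (x - y)%R).
    rewrite -[leLHS]adde0; apply: leeD; last exact: mule_ge0.
    apply: lee_wpmul2l => //; rewrite lee_fin; apply: le_trans (gr_upper _) _.
    by apply: ler_wpM2l => //; exact: rho_le.
  have Jy : (J <= lev y)%N.
    by have /orP[] := lev_sub x y; rewrite -JE// leqNgt Jxy.
  rewrite -[leLHS]add0e; apply: leeD; first exact: mule_ge0.
  apply: lee_pmul => //; first by rewrite lee_fin.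
    apply: le_trans (late_pointwise m y) _; rewrite lee_fin.
    apply: ler_pM => //; first by rewrite mulr_ge0.
      exact: b_dec.
    by apply: ler_wpM2l => //; exact: rho_le.
  by rewrite /f (ltnW Jxy) lee_fin.
rewrite esumD; last 2 first.
- by move=> y _; exact: mule_ge0.
- by move=> y _; exact: mule_ge0.
apply: leeD.
  by under eq_esum do rewrite muleC; rewrite esumZl// muleC.
rewrite esumZl//; apply: lee_wpmul2l => //.
by rewrite (esum_reflect f x); exact: near_ball.
Qed.

Lemma late_loss_small (e : R) : (0 < e)%R -> exists m0, forall m, (m0 <= m)%N ->
  \forall x \near F, pot (late_loss t kap u m) x <= (e * gr x)%:E.
Proof.
move=> e0.
have p2 : (0 < (2 : R) ^+ D)%R by exact: exprn_gt0.
have CK0 : (0 <= C' * C * K)%R by rewrite !mulr_ge0.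
(* e1 and e2 share e * c between the two terms of late_split; the factor 2 ^+ D
   pays for passing from lev x to its predecessor. *)
pose e1 := (e * c / (2 * 2 ^+ D * (C + 1)))%R.
pose e2 := (e * c / (2 * 2 ^+ D * (4 * (C' * C * K) + 1)))%R.
have ec0 : (0 < e * c)%R by exact: mulr_gt0.
have e10 : (0 < e1)%R.
  by rewrite divr_gt0// !mulr_gt0//; exact: ltr_wpDl.
have e20 : (0 < e2)%R.
  by rewrite divr_gt0// !mulr_gt0//; apply: ltr_wpDl => //; exact: mulr_ge0.
have margins : (2 ^+ D * (e1 * C + 4 * (C' * C * K) * e2) <= e * c)%R.
  have E1 : (2 ^+ D * (e1 * (C + 1)) = e * c / 2)%R.
    by rewrite /e1; field; rewrite !gt_eqF//; exact: ltr_wpDl.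
  have E2 : (2 ^+ D * ((4 * (C' * C * K) + 1) * e2) = e * c / 2)%R.
    rewrite /e2; field; rewrite !gt_eqF//.
    by apply: ltr_wpDl => //; exact: mulr_ge0.
  move: E1 E2; clear -p2 e10 e20 => E1 E2.
  have h1 : (2 ^+ D * (e1 * C) <= e * c / 2)%R.
    by rewrite -E1; apply: ler_wpM2l; [exact: ltW|];
      apply: ler_wpM2l; [exact: ltW|rewrite lerDl].
  have h2 : (2 ^+ D * (4 * (C' * C * K) * e2) <= e * c / 2)%R.
    by rewrite -E2; apply: ler_wpM2l; [exact: ltW|];
      apply: ler_wpM2r; [exact: ltW|rewrite lerDl].
  by rewrite mulrDr; apply: le_trans (lerD h1 h2) _; rewrite -splitr.
have [m0 Hm0] := late_mass_small e10; have [n Hn] := b_small e20.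
exists m0 => m m0m.
apply: filterS2 gr_lower (lev_infty n.+1) => x glow nx.
apply: le_trans (late_split m (erefl (lev x).-1)) _.
have Jx : lev x = (lev x).-1.+1 by rewrite prednK//; exact: leq_ltn_trans nx.
set J := (lev x).-1 in Jx *.
have nJ : (n <= J)%N by rewrite -ltnS -Jx.
have A1 : 0 <= (C * rho ^+ J)%:E by rewrite lee_fin mulr_ge0.
apply: (@le_trans _ _ (e1%:E * (C * rho ^+ J)%:E +
    (b J * (C' * rho ^+ J))%:E * (C * K * 4 ^+ J.+1)%:E)).
  by rewrite leeD2r// lee_wpmul2r// ltW// Hm0.
rewrite -!EFinM -EFinD lee_fin.
apply: (@le_trans _ _ (rho ^+ J * (e1 * C + 4 * (C' * C * K) * e2))%R).
  have -> : (e1 * (C * rho ^+ J) + b J * (C' * rho ^+ J) * (C * K * 4 ^+ J.+1) =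
      rho ^+ J * (e1 * C + 4 * (C' * C * K) * (4 ^+ J * b J)))%R.
    rewrite exprS; move: (e1) (K) (rho ^+ J)%R (b J) (4 ^+ J : R)%R => e' k r bJ j4.
    by ring.
  apply: ler_wpM2l => //; rewrite lerD2l; apply: ler_wpM2l; last exact: Hn.
  by rewrite mulr_ge0.
apply: (@le_trans _ _ (e * (c * rho ^+ lev x))%R); last first.
  by apply: ler_wpM2l => //; exact: ltW.
have rJ : (rho ^+ J = 2 ^+ D * rho ^+ lev x)%R.
  by rewrite Jx exprS mulrA /rho mulfV ?mul1r// gt_eqF.
by rewrite rJ mulrAC [leRHS]mulrA; apply: ler_wpM2r.
Qed.

End LateLoss.

(** * The constant of the Green function is positive *)

Section GammaPositive.
Import measurable_realfun.
Context {R : realType}.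

(** Gamma is the finite part of an integral, which would be 0 if the integral
    were infinite: besides being positive on [1, 2], the integrand has to be
    dominated, here by an exponential density of parameter 1 / 2. *)
Lemma Gamma_gt0 (s : R) : 1 <= s -> 0 < Gamma s.
Proof.
move=> s1; pose f (t : R) : \bar R := (t `^ (s - 1) * expR (- t))%:E.
have f0 t : (0 <= f t)%E by rewrite lee_fin mulr_ge0 ?powR_ge0 ?expR_ge0.
have mf (D : set R) : measurable D -> measurable_fun D f.
  move=> mD; apply/measurable_EFinP; apply: measurable_funM.
    exact: measurable_funTS (measurable_powR _).
  apply: measurable_funTS; apply: measurableT_comp => //.
pose n := Num.truncn (s - 1).
pose K : R := 2 ^+ n.+1 * n.+1`!%:R + 1.
have K0 : 0 <= K by rewrite addr_ge0// mulr_ge0// exprn_ge0.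
have half0 : (0 : R) < 2^-1 by rewrite invr_gt0.
have fK t : 0 < t -> (f t <= (2 * K)%:E * (exponential_pdf 2^-1 t)%:E)%E.
  move=> t0; rewrite -EFinM lee_fin exponential_pdfE ?(ltW t0)//.
  have tp : t `^ (s - 1) <= K * expR (t / 2).
    have e1 : 1 <= expR (t / 2) by rewrite (le_trans _ (expR_ge1Dx _))// lerDl divr_ge0// ltW.
    have [t1|t1] := leP t 1.
      apply: (@le_trans _ _ 1).
        rewrite [leRHS](_ : 1 = 1 `^ (s - 1)); last by rewrite powR1.
        apply: ge0_ler_powR => //.
        - by rewrite subr_ge0.
        - by rewrite nnegrE ltW.
        - by rewrite nnegrE.
      rewrite -[leLHS]mulr1; apply: ler_pM => //.
      by rewrite /K lerDr mulr_ge0// exprn_ge0.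
    apply: (@le_trans _ _ (t ^+ n.+1)).
      rewrite -(powR_mulrn n.+1 (ltW t0)); apply: ler_powR; first exact: ltW.
      exact/ltW/truncnS_gt.
    have tE : t ^+ n.+1 = 2 ^+ n.+1 * (t / 2) ^+ n.+1.
      by rewrite -exprMn mulrCA divff ?mulr1.
    have := expR_ge1Dxn n (divr_ge0 (ltW t0) (ler0n R 2)).
    set E := expR _; set P := (t / 2) ^+ n.+1 => H.
    have fa : (0 : R) < n.+1`!%:R by rewrite ltr0n fact_gt0.
    have PE : P <= n.+1`!%:R * E.
      rewrite mulrC -ler_pdivrMr//; apply: le_trans H; rewrite lerDr//.
    rewrite tE /K mulrDl mul1r -mulrA -[leLHS]addr0; apply: lerD; last exact: expR_ge0.
    by apply: ler_wpM2l => //; exact: exprn_ge0.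
  have -> : 2 * K * (2^-1 * expR (- 2^-1 * t)) = (K * expR (t / 2)) * expR (- t).
    rewrite -[RHS]mulrA -expRD (_ : t / 2 + - t = - 2^-1 * t); last by field.
    by field.
  by apply: ler_wpM2r => //; exact: expR_ge0.
have mI : measurable (`]0, +oo[%classic : set R) by exact: measurable_itv.
have mE (D : set R) : measurable D ->
    measurable_fun D (fun t => (exponential_pdf (2^-1 : R) t)%:E).
  move=> mD; apply/measurable_EFinP; apply: measurable_funTS.
  exact: measurable_exponential_pdf.
have e0 t : (0 <= (exponential_pdf (2^-1 : R) t)%:E)%E.
  by rewrite lee_fin exponential_pdf_ge0// ltW.
have finG : (\int[lebesgue_measure]_(t in `]0%R, +oo[) f t < +oo)%E.
  apply: (@le_lt_trans _ _ ((2 * K)%:E *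
    \int[lebesgue_measure]_(t in `]0%R, +oo[) (exponential_pdf (2^-1 : R) t)%:E)%E).
    rewrite -ge0_integralZl//; last 2 first.
    - exact: mE.
    - by rewrite lee_fin mulr_ge0.
    apply: ge0_le_integral => //.
    - exact: mf.
    - by apply: measurable_funeM; exact: mE.
    - by move=> t; rewrite /= in_itv/= andbT; exact: fK.
  rewrite lte_mul_pinfty ?lee_fin ?mulr_ge0//.
  apply: (@le_lt_trans _ _ (\int[lebesgue_measure]_(t in setT)
      (exponential_pdf (2^-1 : R) t)%:E)%E); last first.
    by rewrite integral_exponential_pdf// ltry.
  by apply: ge0_subset_integral => //; exact: mE.
have posG : (0 < \int[lebesgue_measure]_(t in `]0%R, +oo[) f t)%E.
  have m12 : measurable (`[1, 2]%classic : set R) by exact: measurable_itv.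
  apply: (@lt_le_trans _ _ (\int[lebesgue_measure]_(t in `[1%R, 2%R])
    cst (expR (- 2) : R)%:E t)%E).
    have L12 : @lebesgue_measure R `[1, 2]%classic = 1%E.
      rewrite lebesgue_measure_itv/= lte_fin ltr1n -EFinD; congr _%:E; lra.
    rewrite integral_cst// [X in (_ * X)%E](_ : _ = 1%E); last exact: L12.
    by rewrite mule1 lte_fin expR_gt0.
  apply: (@le_trans _ _ (\int[lebesgue_measure]_(t in `[1%R, 2%R]) f t)%E).
    apply: ge0_le_integral => //.
    - by move=> t _; rewrite lee_fin expR_ge0.
    - exact: mf.
    - move=> t; rewrite /= in_itv/= => /andP[t1 t2]; rewrite lee_fin.
      rewrite -[leLHS]mul1r; apply: ler_pM => //.
        rewrite -[leLHS](powRr0 t); apply: ler_powR => //.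
        by rewrite subr_ge0.
      by rewrite ler_expR lerN2.
  apply: ge0_subset_integral => //; first exact: mf.
  by move=> t; rewrite /= !in_itv/= andbT => /andP[/(lt_le_trans ltr01)].
by rewrite /Gamma fine_gt0// posG.
Qed.

End GammaPositive.

(** * Norms on the lattice *)

Lemma nrmN (d : nat) (x : lattice d) : nrm (- x) = nrm x.
Proof.
apply: eq_bigr => i _; rewrite -[- x]add0r lattice_subE.
by rewrite (_ : (0 : lattice d) ord0 i = 0) ?sub0r ?abszN// mxE.
Qed.

Lemma finite_ball (d n : nat) : finite_set [set x : lattice d | (nrm x <= n)%N].
Proof.
pose decode (f : {ffun 'I_d -> 'I_(2 * n).+1}) : lattice d :=
  \row_i ((f i : nat)%:Z - n%:Z).
apply: (@sub_finite_set _ _ (range decode)); last first.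
  by apply: finite_image; exact: finite_finset.
move=> x /= xn; exists [ffun i => inord `|(x ord0 i + n%:Z)%R|%N] => //.
apply/rowP => i; rewrite mxE ffunE inordK.
  by have := nrm_coord x i; have : x ord0 i = x 0 i by []; lia.
by have := nrm_coord x i; lia.
Qed.

Section Norms.
Context {R : realType} {d : nat}.

Lemma eucl_ge0 (v : 'rV[R]_d) : 0 <= eucl v.
Proof. exact: sqrtr_ge0. Qed.

Lemma coord_le_eucl (v : 'rV[R]_d) i : `|v ord0 i| <= eucl v.
Proof.
rewrite -sqrtr_sqr /eucl ler_sqrt; last by apply: sumr_ge0 => j _; exact: sqr_ge0.
rewrite (bigD1 i)//= lerDl; apply: sumr_ge0 => j _; exact: sqr_ge0.
Qed.

Lemma sqr_eucl (v : 'rV[R]_d) : eucl v ^+ 2 = \sum_i v ord0 i ^+ 2.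
Proof. by rewrite sqr_sqrtr// sumr_ge0// => j _; exact: sqr_ge0. Qed.

Let sum_sqr_le (w : 'rV[R]_d) :
  \sum_i w ord0 i ^+ 2 <= (\sum_i `|w ord0 i|) ^+ 2.
Proof.
rewrite expr2 mulr_suml; apply: ler_sum => i _.
rewrite -(real_normK (num_real _)) expr2; apply: ler_wpM2l => //.
by rewrite (bigD1 i)//= lerDl sumr_ge0.
Qed.

(** A triangle inequality that is enough to compare norms at infinity. *)
Lemma eucl_sub_le (v w : 'rV[R]_d) :
  eucl (v - w) <= eucl v + \sum_i `|w ord0 i|.
Proof.
have S0 : 0 <= \sum_i `|w ord0 i| by exact: sumr_ge0.
rewrite -(ler_pXn2r (_ : (0 < 2)%N))// ?nnegrE ?addr_ge0 ?eucl_ge0//.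
rewrite sqrrD sqr_eucl sqr_eucl.
apply: (@le_trans _ _ (\sum_i (v ord0 i ^+ 2 + (eucl v * `|w ord0 i|) *+ 2 +
    w ord0 i ^+ 2))).
  apply: ler_sum => i _; rewrite !mxE sqrrB; apply: lerD => //.
  rewrite lerD2l -mulNrn; apply: ler_wMn2r.
  apply: le_trans (ler_norm _) _; rewrite normrN normrM.
  by apply: ler_wpM2r => //; exact: coord_le_eucl.
by rewrite big_split/= big_split/= sumrMnl -mulr_sumr; apply: lerD.
Qed.

Lemma eucl_le_sum (v : 'rV[R]_d) : eucl v <= \sum_i `|v ord0 i|.
Proof.
have S0 : 0 <= \sum_i `|v ord0 i| by exact: sumr_ge0.
rewrite -(ler_pXn2r (_ : (0 < 2)%N))// ?nnegrE ?eucl_ge0//.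
by rewrite sqr_eucl.
Qed.

Lemma to_real_coord (x : lattice d) i :
  `|to_real R x ord0 i| <= (nrm x)%:R.
Proof.
rewrite mxE /lcoord -intr_norm; apply: (@le_trans _ _ (`|x ord0 i|%N%:R)).
  by rewrite -natr_absz.
by rewrite ler_nat; exact: nrm_coord.
Qed.

Lemma nrm_le_eucl (x : lattice d) : (nrm x)%:R <= eucl (to_real R x).
Proof.
rewrite -truncn_ge_nat ?eucl_ge0//; apply/bigmax_leqP => i _.
rewrite truncn_ge_nat ?eucl_ge0//; apply: le_trans (coord_le_eucl _ i).
by rewrite mxE /lcoord -intr_norm -natr_absz.
Qed.

Lemma eucl_le_nrm (x : lattice d) : eucl (to_real R x) <= d%:R * (nrm x)%:R.
Proof.
apply: le_trans (eucl_le_sum _) _.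
apply: (@le_trans _ _ (\sum_(i < d) (nrm x)%:R)).
  by apply: ler_sum => i _; exact: to_real_coord.
by rewrite sumr_const card_ord mulr_natl.
Qed.

Lemma near_latticeP (U : set (lattice d)) :
  (\forall x \near lattice_infty R d, U x) <->
  exists n, forall x, (n <= nrm x)%N -> U x.
Proof.
split=> [[M HM]|[n Hn]].
  exists (Num.truncn `|M|).+1 => x nx; apply: HM.
  apply: lt_le_trans (nrm_le_eucl x); apply: (@lt_le_trans _ _ (Num.truncn `|M|).+1%:R).
    exact: le_lt_trans (ler_norm _) (truncnS_gt _).
  by rewrite ler_nat.
exists (d%:R * n%:R) => x dn; apply: Hn; rewrite leqNgt; apply/negP => xn.
have := lt_le_trans dn (eucl_le_nrm x); apply/negP; rewrite -leNgt.
by apply: ler_wpM2l => //; rewrite ler_nat ltnW.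
Qed.

Variable Sigma : 'M[R]_d.
Hypothesis Sigma_unit : Sigma \in unitmx.

Lemma sigma_norm_upper : exists2 c : R, 0 < c &
  forall x : lattice d, sigma_norm Sigma x <= c * (nrm x)%:R.
Proof.
pose c := \sum_i \sum_j `|invmx Sigma j i|.
have c0 : 0 <= c by apply: sumr_ge0 => i _; exact: sumr_ge0.
exists (c + 1); first by rewrite ltr_wpDl.
move=> x; apply: le_trans (eucl_le_sum _) _.
apply: (@le_trans _ _ (c * (nrm x)%:R)); last by apply: ler_wpM2r => //; rewrite lerDl.
rewrite mulr_suml; apply: ler_sum => i _; rewrite mxE.
apply: le_trans (ler_norm_sum _ _ _) _; rewrite mulr_suml; apply: ler_sum => j _.
by rewrite normrM mulrC; apply: ler_wpM2l => //; exact: to_real_coord.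
Qed.

Lemma sigma_norm_lower : exists2 c : R, 0 < c &
  forall x : lattice d, c * (nrm x)%:R <= sigma_norm Sigma x.
Proof.
pose c := \sum_i \sum_j `|Sigma j i|.
have c0 : 0 <= c by apply: sumr_ge0 => i _; exact: sumr_ge0.
have c1 : 0 < c + 1 by rewrite ltr_wpDl.
exists (c + 1)^-1; first by rewrite invr_gt0.
move=> x; rewrite mulrC ler_pdivrMr//.
have vE : to_real R x = (to_real R x *m invmx Sigma) *m Sigma by rewrite mulmxKV.
have s0 : 0 <= sigma_norm Sigma x by exact: eucl_ge0.
rewrite -truncn_ge_nat ?mulr_ge0 ?(ltW c1)//; apply/bigmax_leqP => i _.
rewrite truncn_ge_nat ?mulr_ge0 ?(ltW c1)//.
have -> : `|x ord0 i|%N%:R = `|to_real R x ord0 i|.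
  by rewrite [in RHS]mxE /lcoord -intr_norm -natr_absz.
rewrite vE mxE; apply: le_trans (ler_norm_sum _ _ _) _.
apply: (@le_trans _ _ (\sum_j sigma_norm Sigma x * `|Sigma j i|)).
  apply: ler_sum => j _; rewrite normrM; apply: ler_wpM2r => //.
  exact: coord_le_eucl.
rewrite -mulr_sumr; apply: ler_wpM2l => //.
apply: (@le_trans _ _ c); last by rewrite lerDl.
by rewrite /c [leRHS](bigD1 i)//= lerDl sumr_ge0// => k _; exact: sumr_ge0.
Qed.

Lemma to_realB (x y : lattice d) : to_real R (x - y) = to_real R x - to_real R y.
Proof. by apply/rowP => i; rewrite !mxE /lcoord lattice_subE intrB. Qed.

Lemma sigma_norm_shift (y : lattice d) (e : R) : 0 < e ->
  \forall x \near lattice_infty R d,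
    sigma_norm Sigma (x - y) <= (1 + e) * sigma_norm Sigma x.
Proof.
move=> e0; have [c c0 Hc] := sigma_norm_lower.
pose B := \sum_i `|(to_real R y *m invmx Sigma) ord0 i|.
have B0 : 0 <= B by exact: sumr_ge0.
apply/near_latticeP; exists (Num.truncn (B / (e * c))).+1 => x nx.
rewrite /sigma_norm to_realB mulmxBl; apply: le_trans (eucl_sub_le _ _) _.
rewrite -/(sigma_norm Sigma x) -/B mulrDl mul1r lerD2l.
apply: (@le_trans _ _ (e * (c * (nrm x)%:R))); last first.
  by apply: ler_wpM2l; [exact: ltW|].
rewrite mulrA mulrC -ler_pdivrMr ?mulr_gt0//.
apply: (@le_trans _ _ (Num.truncn (B / (e * c))).+1%:R).
  exact/ltW/truncnS_gt.
by rewrite ler_nat.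
Qed.

Lemma sigma_normN (x : lattice d) : sigma_norm Sigma (- x) = sigma_norm Sigma x.
Proof.
rewrite /sigma_norm /eucl; congr (Num.sqrt _); apply: eq_bigr => i _.
have -> : to_real R (- x) = - to_real R x.
  rewrite -[- x]add0r to_realB -[RHS]add0r; congr (_ - _).
  apply/rowP => j; rewrite !mxE /lcoord.
  by rewrite (_ : (0 : lattice d) ord0 j = 0)// mxE.
by rewrite mulNmx mxE sqrrN.
Qed.

Lemma near_lattice_opp (U : set (lattice d)) :
  (\forall x \near lattice_infty R d, U x) ->
  \forall x \near lattice_infty R d, U (- x).
Proof.
move=> /near_latticeP[n Hn]; apply/near_latticeP; exists n => x nx.
by apply: Hn; rewrite nrmN.
Qed.

Lemma near_lattice_shift (U : set (lattice d)) y :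
  (\forall x \near lattice_infty R d, U x) ->
  \forall x \near lattice_infty R d, U (x - y).
Proof.
move=> /near_latticeP[n Hn]; apply/near_latticeP; exists (n + nrm y)%N => x nx.
apply: Hn; rewrite -(leq_add2r (nrm y)); apply: (leq_trans nx).
by rewrite addnC; exact: nrm_sub.
Qed.

Lemma near_lattice_ex (U : set (lattice d)) : (0 < d)%N ->
  (\forall x \near lattice_infty R d, U x) -> exists x, U x.
Proof.
move=> d0 /near_latticeP[n Hn]; exists (const_mx n%:Z : 'rV[int]_d).
apply: Hn; have := nrm_coord (const_mx n%:Z : 'rV[int]_d) (Ordinal d0).
by rewrite mxE.
Qed.

Lemma near_lev n : \forall x \near lattice_infty R d, (n <= lev x)%N.
Proof.
apply/near_latticeP; exists (2 ^ n)%N => x nx.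
by apply: trunc_log_max => //; exact: leqW.
Qed.

End Norms.

Lemma C_green_gt0 (R : realType) (d : nat) (theta : probability (lattice d) R)
    (Sigma : 'M[R]_d) : (3 < d)%N -> cov_matrix theta \in unitmx ->
  is_sqrtmx Sigma (cov_matrix theta) -> 0 < C_green theta.
Proof.
move=> d4 Cu [_ _ SS]; rewrite /C_green divr_gt0//.
  apply: Gamma_gt0; have : (4 : R) <= d%:R by rewrite ler_nat.
  lra.
rewrite mulr_gt0// sqrtr_gt0 detZ mulr_gt0 ?exprn_gt0 ?pi_gt0//.
rewrite -SS det_mulmx -expr2 lt_neqAle sqr_ge0 andbT eq_sym expf_eq0/=.
by move: Cu; rewrite -SS unitmxE det_mulmx unitfE mulf_eq0 orbb.
Qed.

(** * Estimates on the Green function *)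

Lemma bernoulli_le (R : realDomainType) (a : R) n : 0 <= a <= 1 ->
  1 - n%:R * a <= (1 - a) ^+ n.
Proof.
move=> /andP[a0 a1]; elim: n => [|n IH]; first by rewrite mul0r subr0 expr0.
rewrite exprSr; apply: (@le_trans _ _ ((1 - n%:R * a) * (1 - a))).
  have : 0 <= n%:R * a * a by rewrite !mulr_ge0.
  rewrite -natr1; lra.
by apply: ler_wpM2r => //; rewrite subr_ge0.
Qed.

Section GreenEstimates.
Context {R : realType} {d : nat}.
Variable D : nat.
Hypothesis dE : d = D.+2.
Variable t : lattice d -> \bar R.
Hypothesis t_ge0 : forall z, (0 <= t z)%E.
Variable Sigma : 'M[R]_d.
Hypothesis Sigma_unit : Sigma \in unitmx.
Variable C : R.
Hypothesis C_gt0 : 0 < C.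
Let h (x : lattice d) : R := C * (sigma_norm Sigma x ^+ D)^-1.

Definition green_fun (x : lattice d) : R := fine (pot t delta0 x).

Local Notation gr := green_fun.
Hypothesis gr_asymp : forall e : R, 0 < e ->
  \forall x \near lattice_infty R d, `|gr x - h x| <= e * h x.
Let rho : R := (2 ^+ D)^-1.

Let d_gt0 : (0 < d)%N. Proof. by rewrite dE. Qed.

Lemma green_fun_ge0 x : 0 <= gr x.
Proof. by apply: fine_ge0; apply: pot_ge0 => // y; exact: delta0_ge0. Qed.

Let h_ge0 x : 0 <= h x.
Proof. by rewrite mulr_ge0 ?invr_ge0 ?exprn_ge0 ?eucl_ge0// ltW. Qed.

Let h_gt0 : \forall x \near lattice_infty R d, 0 < h x.
Proof.
have [c c0 Hc] := sigma_norm_lower Sigma_unit.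
apply/near_latticeP; exists 1%N => x nx.
rewrite mulr_gt0// invr_gt0 exprn_gt0//; apply: lt_le_trans (Hc x).
by rewrite mulr_gt0// ltr0n.
Qed.

Let near_two_sided e : 0 < e -> \forall x \near lattice_infty R d,
  (1 - e) * h x <= gr x <= (1 + e) * h x.
Proof.
move=> /gr_asymp; apply: filterS => x; rewrite ler_norml => /andP[h1 h2].
by apply/andP; split; lra.
Qed.

(** Near infinity the Green function is finite; elsewhere, start from far away
    and first go to the point under consideration. *)
Lemma pot_delta_fin x : pot t delta0 x = (gr x)%:E.
Proof.
have pot0 y : (0 <= pot t delta0 y)%E by apply: pot_ge0 => // z; exact: delta0_ge0.
have gr_pos : \forall x \near lattice_infty R d, 0 < gr x.
  have half : (0 : R) < 1 / 2 by lra.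
  apply: filterS2 h_gt0 (near_two_sided half) => y hy /andP[+ _].
  by apply: lt_le_trans; rewrite mulr_gt0//; lra.
have [z [zpos xzpos]] : exists z, 0 < gr z /\ 0 < gr (z - (- x)).
  apply: near_lattice_ex => //.
  by apply: filterS2 gr_pos (near_lattice_shift (- x) gr_pos).
rewrite opprK in xzpos.
have fin_pos y : 0 < gr y -> (0 < pot t delta0 y < +oo)%E.
  rewrite /green_fun; move: (pot0 y); case: (pot t delta0 y) => [r _|_|//] /=.
    by rewrite lte_fin ltry andbT.
  by move=> H0; rewrite ltxx in H0.
have /andP[zpot _] := fin_pos _ zpos; have /andP[_ xzfin] := fin_pos _ xzpos.
have [n zn] : exists n, (0 < iter n (step t) delta0 z)%E.
  apply: contrapT => /forallNP H; move: zpot; rewrite /pot esum1 ?ltxx// => n _.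
  apply/eqP; rewrite eq_le steps_ge0 ?andbT; last 2 first.
  - by [].
  - by move=> y; exact: delta0_ge0.
  by rewrite leNgt; apply/negP; exact: H.
rewrite fineK// ge0_fin_numE//.
have steps0 y : (0 <= iter n (step t) delta0 y)%E.
  by apply: steps_ge0 => // w; exact: delta0_ge0.
have : (pot t delta0 x * iter n (step t) delta0 z < +oo)%E.
  apply: le_lt_trans xzfin; rewrite (pot_split t_ge0 n (z + x)%R delta0_ge0).
  apply: (@le_trans _ _ (iter n (step t) (pot t delta0) (z + x)%R)).
    rewrite (steps_conv t_ge0 n (z + x)%R pot0).
    have := @esum_term _ _
      (fun y => (pot t delta0 y * iter n (step t) delta0 (z + x - y)%R)%E) x.
    by rewrite addrK; apply => y; rewrite mule_ge0.
  rewrite steps_pot//; last by move=> y; exact: delta0_ge0.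
  rewrite leeDr// sume_ge0// => k _; apply: steps_ge0 => // w; exact: delta0_ge0.
rewrite !ltNge; apply: contraNN; rewrite leye_eq => /eqP ->.
by rewrite gt0_mulye.
Qed.

(** A translation changes the norm by a factor that tends to 1. *)
Lemma green_fun_shift (y : lattice d) (e : R) : 0 < e ->
  \forall x \near lattice_infty R d, (1 - e) * gr x <= gr (x - y).
Proof.
move=> e0; have [e1|e1] := leP 1 e.
  apply: filterE => x; apply: le_trans (green_fun_ge0 _).
  by apply: mulr_le0_ge0; [rewrite subr_le0|exact: green_fun_ge0].
have e40 : 0 < e / 4 by lra.
pose a := e / 4 / D.+1%:R.
have a0 : 0 < a by rewrite divr_gt0// ltr0n.
have aD : D%:R * a <= e / 4.
  rewrite /a mulrA ler_pdivrMr ?ltr0n// mulrC; apply: ler_wpM2l; first exact: ltW.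
  by rewrite ler_nat.
have a1 : a <= 1.
  rewrite /a ler_pdivrMr ?ltr0n// mul1r; have : (1 : R) <= D.+1%:R by rewrite ler1n.
  lra.
near=> x.
have hx : 0 < h x by near: x; exact: h_gt0.
have hxy : 0 < h (x - y).
  near: x; apply: (near_lattice_shift (U := fun z => 0 < h z)); exact: h_gt0.
have /andP[_ gx] : (1 - e / 4) * h x <= gr x <= (1 + e / 4) * h x.
  by near: x; exact: near_two_sided.
have /andP[gxy _] : (1 - e / 4) * h (x - y) <= gr (x - y) <= (1 + e / 4) * h (x - y).
  near: x; apply: (near_lattice_shift (U := fun z =>
    (1 - e / 4) * h z <= gr z <= (1 + e / 4) * h z)).
  exact: near_two_sided.
have sxy : sigma_norm Sigma (x - y) <= (1 + a) * sigma_norm Sigma x.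
  by near: x; exact: sigma_norm_shift.
have hh : (1 - e / 4) * h x <= h (x - y).
  move: hx hxy; rewrite /h !pmulr_rgt0// !invr_gt0 => sx sxy0.
  rewrite mulrCA; apply: ler_wpM2l; first exact: ltW.
  rewrite ler_pdivrMr// [leRHS]mulrC ler_pdivlMr//.
  have e4 : 0 <= 1 - e / 4 by lra.
  have s0 : 0 <= sigma_norm Sigma x ^+ D by exact: ltW.
  apply: (@le_trans _ _ ((1 - a) ^+ D * ((1 + a) * sigma_norm Sigma x) ^+ D)).
    apply: ler_pM => //; first exact: ltW.
      by apply: le_trans (bernoulli_le D _); [lra|rewrite ltW].
    by apply: lerXn2r; rewrite ?nnegrE ?mulr_ge0 ?eucl_ge0//; lra.
  rewrite exprMn mulrA -exprMn -[leRHS]mul1r; apply: ler_wpM2r => //.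
  have aa : 0 <= a * a by rewrite mulr_ge0// ltW.
  have aa1 : a * a <= 1 by rewrite mulr_ile1// ltW.
  rewrite (_ : (1 - a) * (1 + a) = 1 - a * a); last by ring.
  by apply: exprn_ile1; lra.
apply: le_trans gxy.
apply: (@le_trans _ _ ((1 - e) * ((1 + e / 4) * h x))).
  by apply: ler_wpM2l => //; lra.
apply: (@le_trans _ _ ((1 - e / 4) * ((1 - e / 4) * h x))); last first.
  by apply: ler_wpM2l => //; lra.
by rewrite [leLHS]mulrA [leRHS]mulrA; apply: ler_wpM2r => //; nra.
Unshelve. all: by end_near. Qed.

Lemma green_fun_lower : exists2 c : R, 0 < c &
  \forall x \near lattice_infty R d, c * rho ^+ lev x <= gr x.
Proof.
have [c c0 Hc] := sigma_norm_upper Sigma.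
have half : (0 : R) < 1 / 2 by lra.
have rho0 : 0 < rho by rewrite invr_gt0 exprn_gt0.
pose k := C / 2 * ((c ^+ D)^-1 * rho).
exists k; first by rewrite !mulr_gt0 ?invr_gt0 ?exprn_gt0//; lra.
apply: filterS2 h_gt0 (near_two_sided half) => x hx /andP[hg _].
apply: le_trans hg; rewrite /h /k.
set Y := (sigma_norm Sigma x ^+ D)^-1.
have -> : (1 - 1 / 2) * (C * Y) = C / 2 * Y by field.
have -> : C / 2 * ((c ^+ D)^-1 * rho) * rho ^+ lev x =
    C / 2 * ((c ^+ D)^-1 * (rho * rho ^+ lev x)) by rewrite -!mulrA.
apply: ler_wpM2l; first by rewrite divr_ge0// ltW.
rewrite {}/Y.
rewrite -exprS /rho exprVn -invfM lef_pV2 ?posrE; last 2 first.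
- by rewrite mulr_gt0 ?exprn_gt0// exprn_gt0.
- by move: hx; rewrite /h pmulr_rgt0// invr_gt0.
rewrite -exprM mulnC exprM -exprMn; apply: lerXn2r; rewrite ?nnegrE ?eucl_ge0//.
  by rewrite mulr_ge0 ?exprn_ge0// ltW.
apply: le_trans (Hc x) _; apply: ler_wpM2l; first exact: ltW.
have /andP[_] := lev_bounds x; rewrite -natrX ler_nat => /ltnW.
exact: leq_trans.
Qed.

(** The asymptotics give the bound outside a ball; the finitely many points of
    the ball only affect the constant. *)
Lemma green_fun_upper : exists2 c : R, 0 <= c & forall x, gr x <= c * rho ^+ lev x.
Proof.
have [c c0 Hc] := sigma_norm_lower Sigma_unit.
have half : (0 : R) < 1 / 2 by lra.
have rho0 : 0 < rho by rewrite invr_gt0 exprn_gt0.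
have /near_latticeP[n Hn] : \forall x \near lattice_infty R d,
    0 < h x /\ (1 - 1 / 2) * h x <= gr x <= (1 + 1 / 2) * h x.
  by apply: filterS2 h_gt0 (near_two_sided half) => x.
pose S := \sum_(x \in [set x : lattice d | (nrm x <= n)%N]) gr x.
have fin_ball : finite_set [set x : lattice d | (nrm x <= n)%N] by exact: finite_ball.
have S0 : 0 <= S.
  rewrite /S fsbig_finite//=; apply: sumr_ge0 => x _; exact: green_fun_ge0.
pose k1 := S * (2 ^+ D) ^+ n.+1; pose k2 := (1 + 1 / 2) * C * (2 ^+ D / c ^+ D).
have k10 : 0 <= k1 by rewrite mulr_ge0// exprn_ge0// exprn_ge0.
have k20 : 0 <= k2.
  rewrite /k2; apply: mulr_ge0; first by apply: mulr_ge0; [lra|exact: ltW].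
  by apply: divr_ge0; apply: exprn_ge0 => //; exact: ltW.
exists (k1 + k2); first exact: addr_ge0.
move=> x; have r0 : 0 <= rho ^+ lev x by rewrite exprn_ge0// ltW.
rewrite mulrDl; have [xn|nx] := leqP (nrm x) n.
  apply: (@le_trans _ _ (k1 * rho ^+ lev x)); last by rewrite lerDl mulr_ge0.
  have gS : gr x <= S.
    rewrite /S fsbig_finite//= (big_fsetD1 x)/=; last by rewrite in_fset_set// inE.
    by rewrite lerDl; apply: sumr_ge0 => y _; exact: green_fun_ge0.
  apply: le_trans gS _; rewrite /k1 -mulrA -[leLHS]mulr1; apply: ler_wpM2l => //.
  have xn' : (lev x <= n.+1)%N.
    have /andP[h1 _] := lev_bounds x.
    have := ltn_expl (lev x) (ltnSn 1) => /leq_trans/(_ h1)/ltnW.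
    by move=> /leq_trans; apply.
  rewrite -(subnK xn') exprD -mulrA /rho exprVn mulfV ?mulr1; last first.
    by rewrite expf_neq0// expf_neq0.
  by apply: exprn_ege1; apply: exprn_ege1; rewrite ler1n.
apply: (@le_trans _ _ (k2 * rho ^+ lev x)); last by rewrite lerDr mulr_ge0.
have [hx /andP[_ gx]] := Hn x (ltnW nx).
have n0 : (0 < nrm x)%N by exact: leq_ltn_trans nx.
apply: le_trans gx _; rewrite /h /k2 -!mulrA; apply: ler_wpM2l; first by lra.
apply: ler_wpM2l; first exact: ltW.
have sg : 0 < sigma_norm Sigma x.
  by apply: lt_le_trans (Hc x); rewrite mulr_gt0// ltr0n.
rewrite -[leLHS]mul1r ler_pdivrMr ?exprn_gt0//.
have l0 : (0 : R) < 2 ^+ lev x by exact: exprn_gt0.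
have -> : rho ^+ lev x = ((2 ^+ lev x) ^+ D)^-1.
  by rewrite /rho exprVn -!exprM mulnC.
have -> : 2 ^+ D * ((c ^+ D)^-1 / (2 ^+ lev x) ^+ D) * sigma_norm Sigma x ^+ D =
    (2 * (c^-1 * ((2 ^+ lev x)^-1 * sigma_norm Sigma x))) ^+ D.
  by rewrite !exprMn !exprVn !mulrA.
apply: exprn_ege1.
have -> : 2 * (c^-1 * ((2 ^+ lev x)^-1 * sigma_norm Sigma x)) =
    (2 * sigma_norm Sigma x) / (c * 2 ^+ lev x).
  move: (2 ^+ lev x) l0 (sigma_norm Sigma x) => l l0 n'.
  by field; rewrite !gt_eqF.
rewrite ler_pdivlMr ?mulr_gt0// mul1r.
apply: (@le_trans _ _ (2 * (c * (nrm x)%:R))); last by apply: ler_wpM2l.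
rewrite mulrCA; apply: ler_wpM2l; first exact: ltW.
rewrite -natrX -natrM ler_nat; have /andP[h1 _] := lev_bounds x.
by apply: leq_trans h1 _; rewrite mul2n -addnn -addn1 leq_add2l.
Qed.

Lemma pot_finite_set (X : {fset lattice d}) x :
  pot t (fun y => ((y \in X)%:R)%:E) x = (\sum_(a <- X) gr (x - a))%:E.
Proof.
have u0 y : (0 <= ((y \in X)%:R : R)%:E)%E by rewrite lee_fin.
rewrite pot_conv// -sumEFin.
transitivity (\esum_(y in [set: lattice d]) (if y \in [set` X] then
    (gr (x - y))%:E else 0))%E.
  apply: eq_esum => y _; rewrite pot_delta_fin.
  have -> : (y \in [set` X]) = (y \in X) by apply/idP/idP; rewrite inE.
  by case: ifP => _; rewrite ?mul1e ?mul0e.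
rewrite -esum_mkcond esum_fset//; last first.
  by move=> y _; rewrite lee_fin green_fun_ge0.
by rewrite fsbig_finite//= set_fsetK.
Qed.

(** Finitely many translates behave, far away, like as many copies at the
    origin. *)
Lemma pot_finite_set_asymp (X : {fset lattice d}) (e : R) : 0 < e ->
  \forall x \near lattice_infty R d,
    (pot t (fun y => ((y \in X)%:R)%:E) x <= ((#|` X|%:R + e) * gr x)%:E)%E.
Proof.
move=> e0; pose n : R := #|` X|%:R.
have n0 : 0 <= n by exact: ler0n.
pose k := e / (n + e).
have ne0 : 0 < n + e by rewrite ltr_wpDl.
have k0 : 0 < k by exact: divr_gt0.
have near_all : \forall x \near lattice_infty R d, forall a : lattice d, a \in X ->
    (1 - k) * gr (x - a) <= gr x.
  have step1 (a : lattice d) : \forall x \near lattice_infty R d,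
      (1 - k) * gr (x - a) <= gr x.
    have := near_lattice_shift a (green_fun_shift (- a) k0).
    by apply: filterS => x; rewrite opprK subrK.
  elim/finSet_rect: (X) => Y IHY.
  have [->|[a aY]] := fset_0Vmem Y; first by apply: filterE => x a.
  apply: filterS2 (step1 a) (IHY (Y `\ a)%fset (fproperD1 aY)) => x Ha HY b bY.
  have [->//|ba] := eqVneq b a.
  by apply: HY; rewrite !inE ba.
apply: filterS near_all => x Hx; rewrite pot_finite_set lee_fin.
have [X0|Xpos] := posnP #|` X|.
  move/cardfs0_eq: X0 => X0; rewrite {1}X0 big_seq_fset0.
  by rewrite mulr_ge0 ?green_fun_ge0// ltW.
have npos : 0 < n by rewrite /n ltr0n.
have kE : 1 - k = n / (n + e) by rewrite /k; field; rewrite gt_eqF.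
apply: (@le_trans _ _ (\sum_(a <- X) (n + e) / n * gr x)); last first.
  rewrite big_const_seq count_predT iter_addr_0 -[X in X *+ _]mulr1 -mulrnAr.
  rewrite (_ : 1 *+ size X = n)// mulrAC.
  by rewrite (_ : (n + e) / n * n = n + e)//; field; rewrite gt_eqF.
rewrite big_seq [leRHS]big_seq; apply: ler_sum => a /Hx.
rewrite kE -[X in X * _ <= _]invf_div mulrC ler_pdivrMr ?divr_gt0//.
by rewrite mulrC.
Qed.

Lemma pot_finite_set_upper (X : {fset lattice d}) : exists2 c : R, 0 <= c &
  forall x, (pot t (fun y => ((y \in X)%:R)%:E) x <= (c * rho ^+ lev x)%:E)%E.
Proof.
have [c c0 Hc] := green_fun_upper.
have D1 : (1 : R) <= 2 ^+ D by rewrite exprn_ege1// ler1n.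
have rho0 : 0 < rho by rewrite invr_gt0 exprn_gt0.
have rho1 : rho <= 1 by rewrite /rho invf_le1// exprn_gt0.
exists (\sum_(a <- X) c * (2 ^+ D) ^+ (lev a).+1).
  by apply: sumr_ge0 => a _; rewrite mulr_ge0// exprn_ge0// exprn_ge0.
move=> x; rewrite pot_finite_set lee_fin mulr_suml; apply: ler_sum => a _.
apply: le_trans (Hc _) _; rewrite -mulrA; apply: ler_wpM2l => //.
have l1 : (lev x <= lev (x - a)%R + (lev a).+1)%N.
  have /orP[h1|h1] := lev_sub x a; first by lia.
  rewrite addnS; apply: leq_trans (leqSpred (lev x)) _; rewrite ltnS.
  exact: leq_trans h1 (leq_addr _ _).
apply: (@le_trans _ _ ((2 ^+ D) ^+ (lev a).+1 * rho ^+ (lev (x - a)%R + (lev a).+1)%N)).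
  rewrite exprD mulrCA {2}/rho -exprMn divff ?gt_eqF ?exprn_gt0//.
  by rewrite expr1n mulr1.
apply: ler_wpM2l; first by rewrite exprn_ge0// exprn_ge0.
by apply: ler_wiXn2l => //; exact: ltW.
Qed.

End GreenEstimates.

(** * From the trees to the damped potential *)

Section DampedFixpoint.
Local Open Scope ereal_scope.
Context {R : realType} {T : zmodType}.
Variable t : T -> \bar R.
Hypothesis t_ge0 : forall z, 0 <= t z.
Variable kap : T -> R.
Hypothesis kap01 : forall y, (0 <= kap y <= 1)%R.

(** The linear equation p = f + damp p has one solution only below a finite
    potential, because the remainders of its iteration are tails of the
    series of that potential. *)
Lemma damped_fixpoint (f p u : T -> \bar R) :
  (forall y, 0 <= f y) -> (forall y, 0 <= p y) -> (forall y, 0 <= u y) ->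
  (forall y, p y = f y + damp t kap p y) ->
  (forall y, p y <= pot t u y) -> (forall y, pot t u y < +oo) ->
  forall x, p x = damped_pot t kap f x.
Proof.
move=> f0 p0 u0 pE pu ufin x.
have fn0 n y : 0 <= iter n (damp t kap) f y by exact: damps_ge0.
have dampD (g g' : T -> \bar R) y : (forall y, 0 <= g y) -> (forall y, 0 <= g' y) ->
    damp t kap (fun y => g y + g' y) y = damp t kap g y + damp t kap g' y.
  move=> g0 g'0; rewrite /damp stepD// ge0_muleDr//; exact: step_ge0.
have iterE N : p x = \sum_(0 <= k < N) iter k (damp t kap) f x +
    iter N (damp t kap) p x.
  elim: N => [|N IH]; first by rewrite big_nil add0e.
  rewrite big_nat_recr//= {1}IH -addeA; congr (_ + _).
  elim: (N) x {IH} => [|n IHn] y /=; first exact: pE.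
  rewrite -dampD//; last by move=> z; rewrite -iterS; exact: damps_ge0.
  by congr (_ * _); apply: eq_step => z; exact: IHn.
apply/eqP; rewrite eq_le; apply/andP; split; last first.
  apply: esum_nat_le => // N; rewrite (iterE N) leeDl//.
  exact: damps_ge0.
apply/lee_addgt0Pr => e e0.
have [N /(_ N (leqnn N)) tail] :=
  esum_tail_small (fun n => steps_ge0 t_ge0 n u0 x) (ufin x) e0.
rewrite (iterE N); apply: leeD; first exact: esum_partial_le.
apply: le_trans (ltW tail); apply: le_trans (damps_le_steps t_ge0 kap01 N p0 x) _.
apply: (@le_trans _ _ (iter N (step t) (pot t u) x)); first exact: le_steps.
by rewrite steps_pot// pot_steps.
Qed.

Lemma damps_sum (I : Type) (s : seq I) (g : I -> T -> \bar R) k y :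
  (forall i y, 0 <= g i y) ->
  iter k (damp t kap) (fun y => \sum_(i <- s) g i y) y =
  \sum_(i <- s) iter k (damp t kap) (g i) y.
Proof.
move=> g0; elim: k y => [//|k IH] y /=.
rewrite (_ : iter k _ _ = fun y => \sum_(i <- s) iter k (damp t kap) (g i) y);
  last exact/funext.
have gk0 i z : 0 <= iter k (damp t kap) (g i) z by exact: damps_ge0.
rewrite /damp /step.
elim: s {IH} => [|i s IHs].
  by rewrite big_nil esum1 ?mule0// => z _; rewrite big_nil mule0.
rewrite big_cons -IHs -ge0_muleDr ?esum_ge0//; last 2 first.
- by move=> z _; exact: mule_ge0.
- by move=> z _; rewrite mule_ge0// sume_ge0.
rewrite -esumD; last 2 first.
- by move=> z _; exact: mule_ge0.
- by move=> z _; rewrite mule_ge0// sume_ge0.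
congr (_ * _); apply: eq_esum => z _.
by rewrite big_cons ge0_muleDr// sume_ge0.
Qed.

End DampedFixpoint.

Section UnionBound.
Local Open Scope ereal_scope.
Context {R : realType} {d : nat}.
Variable A : set (lattice d).
Variables (m : nat -> \bar R) (t : lattice d -> \bar R).
Hypothesis m_ge0 : forall j, 0 <= m j.
Hypothesis m_sum : \esum_(j in [set: nat]) m j = 1.
Hypothesis m_mean : \esum_(j in [set: nat]) (j%:R%:E * m j) = 1.
Hypothesis t_ge0 : forall z, 0 <= t z.
Hypothesis t_sum1 : \esum_(z in [set: lattice d]) t z = 1.
Let u (y : lattice d) : \bar R := ((y \in A)%:R)%:E.

Let u_ge0 y : 0 <= u y. Proof. by rewrite lee_fin. Qed.

Lemma step_avoid_real (q : lattice d -> \bar R) : (forall y, 0 <= q y <= 1) ->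
  forall y, exists2 s : R, step t q y = s%:E & (0 <= s <= 1)%R.
Proof.
move=> q01 y; have q0 z : 0 <= q z by case/andP: (q01 z).
have s1 : step t q y <= 1.
  rewrite -(step_cst t_ge0 t_sum1 y (@lee01 R)); apply: le_step => // z.
  by case/andP: (q01 z).
have s0 := step_ge0 t_ge0 q0 y.
exists (fine (step t q y)).
  by rewrite fineK// ge0_fin_numE// (le_lt_trans s1)// ltry.
by rewrite fine_ge0// -lee_fin fineK// ge0_fin_numE// (le_lt_trans s1)// ltry.
Qed.

Let avoid_prob01 h x : 0 <= avoid_prob A m t h x <= 1.
Proof.
have out01 y : 0 <= (outside A y : \bar R) <= 1.
  by rewrite /outside !lee_fin; case: (y \notin A); rewrite /= ?lexx ?ler01.
elim: h x => [|h IH] x /=; first exact: out01.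
have [s -> s01] := step_avoid_real IH x.
have /andP[a0 a1] := out01 x; have /andP[s0 _] := s01.
rewrite mule_ge0 ?gf_ge0//= -[leRHS]mule1.
by apply: lee_pmul => //; [exact: gf_ge0|exact: gf_le1].
Qed.

(** The expected number of visits to A is the potential of A: a union bound,
    generation by generation. *)
Lemma avoid_prob_pot h x : 1 <= avoid_prob A m t h x + pot t u x.
Proof.
elim: h x => [|h IH] x.
  apply: (@le_trans _ _ (outside A x + u x)).
    by rewrite -EFinD lee_fin; case: (x \in A); rewrite ?addr0 ?add0r.
  rewrite leeD2l// (pot_split t_ge0 1 x u_ge0) big_nat1 leeDl// pot_ge0//.
  exact: step_ge0.
rewrite /=; have [s sE s01] := step_avoid_real (avoid_prob01 h) x.
have /andP[s0 s1] := s01.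
have potE : pot t u x = u x + step t (pot t u) x.
  by rewrite (pot_split t_ge0 1 x u_ge0) big_nat1 -(steps_pot t_ge0 1).
have rest0 : 0 <= step t (pot t u) x by apply: step_ge0 => // y; exact: pot_ge0.
rewrite potE sE /outside /u; case: (x \in A) => /=.
  by rewrite mul0e add0e leeDl.
rewrite mul1e add0e; apply: le_trans (gf_bernoulli m_ge0 m_sum m_mean s01) _.
rewrite leeD2l//; have := le_step t_ge0 IH x.
rewrite (step_cst t_ge0 t_sum1)// stepD//; last 2 first.
- by move=> y; case/andP: (avoid_prob01 h y).
- exact: pot_ge0.
rewrite sE; case: (step t (pot t u) x) rest0 => [r| |//] _; last by move=> _; rewrite leey.
by rewrite -EFinD !lee_fin lerBlDl.
Qed.

End UnionBound.

Section WalkGreen.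
Local Open Scope ereal_scope.
Context {R : realType} {d : nat}.

Lemma jump_sum1 (theta : probability (lattice d) R) :
  \esum_(z in [set: lattice d]) theta [set z] = 1.
Proof.
rewrite -(probability_setT theta) -prob_bigcup_countType//.
  by congr (theta _); apply/seteqP; split=> // z _; exists z.
by move=> z z' _ _ [w [/= -> ->]].
Qed.

Context {dO : measure_display} {Om : measurableType dO}.
Variable P : probability Om R.

Lemma events_of_measurable (dE : measure_display) (S : measurableType dE)
    (X : {RV P >-> S}) (F : set Om) : events_of X F -> measurable F.
Proof.
by move=> [B mB <-]; rewrite -[_ @^-1` _]setTI; exact: measurable_funP.
Qed.

Lemma events_of_point (dE : measure_display) (S : measurableType dE)
    (X : {RV P >-> S}) (z : S) : measurable [set z] ->
  events_of X [set w | X w = z].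
Proof. by move=> mz; exists [set z]. Qed.

Lemma has_law_point (dE : measure_display) (S : measurableType dE)
    (X : {RV P >-> S}) (nu : probability S R) (z : S) : measurable [set z] ->
  has_law X nu -> P [set w | X w = z] = nu [set z].
Proof. by move=> mz /(_ _ mz) <-. Qed.

Variables (theta : probability (lattice d) R) (xi : nat -> {RV P >-> lattice d}).
Hypothesis xi_steps : walk_steps xi theta.
Let t z := theta [set z].

Lemma block_event_walk n x :
  block_event P (fun n => events_of (xi n)) [set i | (i < n)%N]
    [set w | (\sum_(j < n) xi j w)%R = x] (iter n (step t) delta0 (- x)%R).
Proof.
have [xi_law xi_indep] := xi_steps.
have E_meas i F : events_of (xi i) F -> measurable F by exact: events_of_measurable.
elim: n x => [|n IH] x.
  rewrite /= /delta0 oppr_eq0; have [->|x0] := eqVneq x 0%R.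
    rewrite [X in block_event _ _ _ X](_ : _ = setT).
      exact: (block_event_setT P (fun n => events_of (xi n))).
    by apply/seteqP; split=> // w _ /=; rewrite big_ord0.
  rewrite [X in block_event _ _ _ X](_ : _ = set0).
    exact: (block_event_set0 P (fun n => events_of (xi n))).
  apply/seteqP; split=> // w /=; rewrite big_ord0 => H.
  by rewrite -H eqxx in x0.
rewrite (_ : [set w | _] = \bigcup_z ([set w | xi n w = z] `&`
    [set w | (\sum_(j < n) xi j w)%R = (x - z)%R])); last first.
  apply/seteqP; split=> w /=.
    rewrite big_ord_recr/= => H; exists (xi n w) => //; split=> //=.
    by rewrite -H addrK.
  by move=> [z _ [/= <- H]]; rewrite big_ord_recr/= H subrK.
rewrite iterS /step; apply: (block_event_bigcup xi_indep).
  by move=> z z' _ _ [w [[/= <- _] [/= <- _]]].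
move=> z; rewrite -[t z](has_law_point _ (xi_law n))//.
apply: (@block_event_sub _ _ _ _ _ _ ([set n] `|` [set i | (i < n)%N])).
  by move=> i [->|/= /ltnW] /=.
apply: block_eventI => //.
- by apply/seteqP; split=> // i [/= -> ]; rewrite ltnn.
- by apply: block_event_var => //; exact: events_of_point.
- have -> : (- x + z = - (x - z))%R by rewrite opprB addrC.
  exact: IH.
Qed.

Lemma green_pot x : green xi x = pot t delta0 (- x)%R.
Proof.
rewrite /green nneseries_esumT//; apply: eq_esum => n _.
have [_ xi_indep] := xi_steps.
exact: (block_event_prob xi_indep (block_event_walk n x)).
Qed.

End WalkGreen.

(** * The critical law and the hitting probability *)

Section CriticalLaw.
Local Open Scope ereal_scope.
Context {R : realType}.
Variable mu : probability nat R.
Let m j := mu [set j].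

Let m_ge0 j : 0 <= m j. Proof. exact: measure_ge0. Qed.

Lemma offspring_sum1 : \esum_(j in [set: nat]) m j = 1.
Proof.
rewrite -(probability_setT mu) -prob_bigcup_countType//.
  by congr (mu _); apply/seteqP; split=> // z _; exists z.
by move=> z z' _ _ [w [/= -> ->]].
Qed.

Lemma massE j : (mass mu j)%:E = m j.
Proof. by rewrite /mass fineK// fin_num_measure. Qed.

Hypothesis mu_crit : critical mu.

Lemma offspring_mean : \esum_(j in [set: nat]) (j%:R%:E * m j) = 1.
Proof.
have [<- _] := mu_crit; rewrite nneseries_esumT.
  by apply: eq_esum => j _; rewrite EFinM massE.
by move=> j; rewrite EFinM massE mule_ge0// lee_fin.
Qed.

Lemma extinct_at_once_pos : 0 < m 0%N.
Proof.
rewrite lt_neqAle measure_ge0 andbT; apply/eqP => /esym m0.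
have [m1 _] := critical_extinct m_ge0 offspring_sum1
  offspring_mean m0.
have [_ []] := mu_crit; move=> B.
rewrite diracE; have [B1|B1] := boolP (1%N \in B).
  apply/eqP; rewrite eq_le probability_le1//= -m1; apply: le_measure => //.
  - by rewrite inE.
  - by rewrite inE.
  - by move=> k /= ->; rewrite inE in B1.
apply/eqP; rewrite eq_le measure_ge0 andbT.
have disj : [set 1%N] `&` B = set0.
  by apply/seteqP; split=> // k [/= -> Bk]; rewrite notin_setE in B1.
have : mu ([set 1%N] `|` B) <= 1 by exact: probability_le1.
have U : mu ([set 1%N] `|` B) = 1 + mu B.
  transitivity (mu [set 1%N] + mu B); first by rewrite measureU.
  by congr (_ + _).
by rewrite U => H; rewrite -(@leeD2lE _ 1)// adde0.
Qed.

Lemma Gen_gf (s : R) : (0 <= s <= 1)%R -> (Gen mu s)%:E = gf m s%:E.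
Proof.
move=> s01; have /andP[s0 s1] := s01.
have term0 j : 0 <= m j * s%:E ^+ j.
  by rewrite mule_ge0// -EFin_expe lee_fin exprn_ge0.
have gf_fin : gf m s%:E \is a fin_num.
  rewrite ge0_fin_numE ?gf_ge0//.
    apply: (@le_lt_trans _ _ 1); last exact: ltry.
    exact: (gf_le1 m_ge0 offspring_sum1 s01).
have cvgE : (fun n => (series (fun k => mass mu k * s ^+ k)%R n)%:E) @ \oo -->
    gf m s%:E.
  rewrite /gf -nneseries_esumT//.
  have := @is_cvg_nneseries _ (fun j => m j * s%:E ^+ j) xpredT 0%N
    (fun j _ _ => term0 j).
  apply: cvg_trans; apply: near_eq_cvg; apply: nearW => n.
  rewrite /series/= -sumEFin; apply: eq_bigr => j _.
  by rewrite EFinM massE EFin_expe.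
rewrite -(fineK gf_fin) in cvgE *; congr _%:E.
by move/fine_cvgP : cvgE => [_ /cvg_lim <-].
Qed.

(** What the damping takes away where the hitting probability, one jump later,
    is e. Summation by parts gives e * psi e = Gen mu (1 - e) - (1 - e), which is
    the quantity that describes the domain of attraction. *)
Definition psi (e : R) : R := (1 - fine (branch_gf m (1 - e)%:E))%R.

Lemma branch_gf_fin (s : R) : (0 <= s <= 1)%R -> branch_gf m s%:E \is a fin_num.
Proof.
move=> s01; have /andP[s0 s1] := s01.
rewrite ge0_fin_numE ?branch_gf_ge0//; apply: (@le_lt_trans _ _ 1); last exact: ltry.
exact: (branch_gf_le1 m_ge0 offspring_mean s01).
Qed.

Lemma psi_ge0 (e : R) : (0 <= e <= 1)%R -> (0 <= psi e)%R.
Proof.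
move=> /andP[e0 e1]; have s01 : (0 <= 1 - e <= 1)%R by lra.
rewrite subr_ge0 -lee_fin fineK ?branch_gf_fin//.
exact: (branch_gf_le1 m_ge0 offspring_mean s01).
Qed.

Lemma le_psi (e e' : R) : (0 <= e)%R -> (e <= e')%R -> (e' <= 1)%R ->
  (psi e <= psi e')%R.
Proof.
move=> e0 ee' e1; have s01 : (0 <= 1 - e <= 1)%R by lra.
have s01' : (0 <= 1 - e' <= 1)%R by lra.
rewrite lerD2l lerN2 -lee_fin !fineK ?branch_gf_fin//.
by apply: le_branch_gf => //; lra.
Qed.

Lemma psi_in_dom (alpha : R) (L : R -> R) (e : R) : (1 < alpha)%R ->
  in_dom mu alpha L -> (0 < e <= 1)%R ->
  psi e = (e `^ (alpha - 1) * L e^-1)%R.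
Proof.
move=> alpha1 [_ Ldom] e01; have /andP[e0 e1] := e01.
have s01 : (0 <= 1 - e <= 1)%R by lra.
have := branch_gf_gf m_ge0 offspring_sum1 s01.
rewrite -(Gen_gf s01) /psi -{1}(fineK (branch_gf_fin s01)).
set b := fine _; rewrite -EFinM -EFinD => -[bE].
have a0 : (0 < alpha)%R by lra.
have := Ldom e e01; rewrite -(mulr_powRB1 (ltW e0) a0) => LE.
by apply: (mulfI (lt0r_neq0 e0)); rewrite [RHS]mulrA -LE; lra.
Qed.

End CriticalLaw.

Section HittingProbability.
Local Open Scope ereal_scope.
Context {R : realType} {d : nat} {dO : measure_display} {Om : measurableType dO}.
Variable P : probability Om R.
Variables (N : seq nat -> {RV P >-> nat}) (X : seq nat -> {RV P >-> lattice d}).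
Variables (mu : probability nat R) (theta : probability (lattice d) R).
Hypothesis NX : is_tree_walk N X mu theta.
Variable A : set (lattice d).
Let m j := mu [set j].
Let t z := theta [set z].

Definition avoid_limit (x : lattice d) : \bar R :=
  P (subtree_avoid_all A (fun u => N u : Om -> nat) (fun u => X u : Om -> lattice d)
       [::] x).

Let E (i : seq nat + seq nat) : set_system Om :=
  match i with inl u => events_of (N u) | inr u => events_of (X u) end.

Let E_meas i F : E i F -> measurable F.
Proof. by case: i => u; exact: events_of_measurable. Qed.

Let N_pt u j : E (inl u) [set w | N u w = j].
Proof. exact: events_of_point. Qed.

Let X_pt u z : E (inr u) [set w | X u w = z].
Proof. exact: events_of_point. Qed.

Let N_law u j : P [set w | N u w = j] = m j.
Proof. by apply: has_law_point => //; case: NX. Qed.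

Let X_law u z : P [set w | X u w = z] = t z.
Proof. by apply: has_law_point => //; case: NX. Qed.

Let E_indep : mutually_independent P E. Proof. by case: NX. Qed.

Let inl_inj : injective (@inl (seq nat) (seq nat)). Proof. by move=> u v []. Qed.
Let inr_inj : injective (@inr (seq nat) (seq nat)). Proof. by move=> u v []. Qed.
Let inlr u v : @inl (seq nat) (seq nat) u <> inr v. Proof. by []. Qed.

Lemma avoid_limit_cvg x :
  avoid_prob A m t h x @[h --> \oo] --> avoid_limit x.
Proof.
exact: (avoid_prob_cvg (A := A) E_meas E_indep inl_inj inr_inj inlr N_pt N_law X_pt X_law).
Qed.

Lemma avoid_limit01 x : 0 <= avoid_limit x <= 1.
Proof.
rewrite measure_ge0/= probability_le1//.
by case: (block_event_avoid_all E_meas E_indep inl_inj inr_inj inlr N_pt N_law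
  X_pt X_law [::] x avoid_limit_cvg).
Qed.

Lemma avoid_limit_fin x : avoid_limit x \is a fin_num.
Proof.
have /andP[q0 q1] := avoid_limit01 x.
by rewrite ge0_fin_numE// (le_lt_trans q1)// ltry.
Qed.

Lemma avoid_limit_rec x :
  avoid_limit x = outside A x * gf m (step t avoid_limit x).
Proof.
exact: (avoid_all_rec (A := A) E_meas E_indep inl_inj inr_inj inlr N_pt N_law X_pt X_law
  x avoid_limit_cvg).
Qed.

Lemma avoid_limit_hit x : (hit_prob N X A x)%:E = 1 - avoid_limit x.
Proof.
have mD : measurable (subtree_avoid_all A (fun u => N u : Om -> nat)
    (fun u => X u : Om -> lattice d) [::] x).
  by case: (block_event_avoid_all E_meas E_indep inl_inj inr_inj inlr N_pt N_law
    X_pt X_law [::] x avoid_limit_cvg).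
rewrite /avoid_limit -probability_setC// /hit_prob.
rewrite [X in (fine (P X))%:E](_ : _ = ~` subtree_avoid_all A
    (fun u => N u : Om -> nat) (fun u => X u : Om -> lattice d) [::] x).
  by rewrite fineK// fin_num_measure//; exact: measurableC.
apply/seteqP; split=> w.
  move=> [y [[u uT <-] Ay]] H; apply: (H (size u) u) => //.
    by rewrite (_ : (fun v => _) = (N^~ w))//; apply/funext => v; rewrite cats0.
  rewrite (_ : (fun v => _) = (X^~ w))//; apply/funext => v; by rewrite cats0.
move=> /= H; apply: contrapT => H'; apply: H => h u uT _ Au; apply: H'.
exists (tree_pos x (X^~ w) u); split.
  exists u => //; move: uT.
  by rewrite (_ : (fun v => _) = (N^~ w))//; apply/funext => v; rewrite cats0.
move: Au; rewrite (_ : (fun v => _) = (X^~ w))//; apply/funext => v; by rewrite cats0.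
Qed.

Hypothesis mu_crit : critical mu.

Lemma hit_prob_pot x :
  (hit_prob N X A x)%:E <= pot t (fun y => ((y \in A)%:R)%:E) x.
Proof.
have pot0 : 0 <= pot t (fun y => ((y \in A)%:R : R)%:E) x.
  by apply: pot_ge0 => // y; rewrite lee_fin.
have a1 : 1 <= avoid_limit x + pot t (fun y => ((y \in A)%:R)%:E) x.
  have [pfin|pinf] := boolP (pot t (fun y => ((y \in A)%:R : R)%:E) x \is a fin_num).
    rewrite -leeBlDr//.
    rewrite -(cvg_lim _ (avoid_limit_cvg (x := x)))//.
    apply: lime_ge; first by apply/cvg_ex; exists (avoid_limit x); exact: avoid_limit_cvg.
    apply: nearW => h; rewrite leeBlDr//.
    apply: avoid_prob_pot => //; [exact: offspring_sum1|exact: offspring_mean|].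
    exact: jump_sum1.
  move: pinf; rewrite ge0_fin_numE// -leNgt leye_eq => /eqP ->.
  by rewrite addey ?leey// -ltNye (lt_le_trans _ (measure_ge0 _ _)).
by rewrite avoid_limit_hit leeBlDl// avoid_limit_fin.
Qed.

End HittingProbability.

(** * Branching capacity and the hitting probability *)

Section Capacity.
Local Open Scope ereal_scope.
Context {R : realType} {d : nat}.
Variables (mu : probability nat R) (theta : probability (lattice d) R).
Let m j := mu [set j].
Let t z := theta [set z].
Context {dO : measure_display} {Om : measurableType dO}.
Variable P : probability Om R.
Variables (S : nat -> {RV P >-> (nat * nat)%type}) (N : vertex -> {RV P >-> nat})
  (X : vertex -> {RV P >-> lattice d}).
Hypothesis SNX : is_inf_tree_walk S N X mu theta.
Variable A : set (lattice d).
Variable q : lattice d -> \bar R.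
Hypothesis q_lim : forall x, avoid_prob A m t h x @[h --> \oo] --> q x.

Definition escape_prob (a : lattice d) : \bar R :=
  P [set w | T_plus_range (S^~ w) (N^~ w) (X^~ w) a `&` A = set0].

Lemma escape_prob_cvg a :
  \esum_(y in [set: lattice d]) spine_prob m t q a k y @[k --> \oo] -->
  escape_prob a.
Proof.
case: SNX => S_law N_law X_law indep.
pose E (i : nat + (vertex + vertex)) : set_system Om :=
  match i with
  | inl k => events_of (S k)
  | inr (inl v) => events_of (N v)
  | inr (inr v) => events_of (X v)
  end.
have m2 (b : nat * nat) : measurable [set b].
  case: b => i j; rewrite (_ : [set (i, j)] = [set i] `*` [set j]).
    exact: measurableX.
  by apply/seteqP; split=> -[k l] /=; [move=> [-> ->]|move=> [-> ->]].
apply: (@T_plus_avoid_cvg R d A m t dO Om P E _ indep (fun k w => S k w)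
  (fun v w => N v w) (fun v w => X v w)) => //.
- by move=> [k|[v|v]] F; exact: events_of_measurable.
- by move=> k b; exact: events_of_point.
- move=> k j i; have := S_law k j i; rewrite /spine_mass => SE.
  transitivity (distribution P (S k) [set (j, i)]); first by [].
  rewrite SE; case: ifP => ij; last by rewrite mulr0.
  rewrite mulrAC mulfV ?mul1r ?massE//.
  by rewrite pnatr_eq0 -lt0n; exact: leq_ltn_trans ij.
- by move=> v j; exact: events_of_point.
- by move=> v j; apply: has_law_point.
- by move=> v z; exact: events_of_point.
- by move=> v z; apply: has_law_point.
Qed.

End Capacity.

Section Assembly.
Local Open Scope ereal_scope.
Context {R : realType} {d : nat}.
Variables (mu : probability nat R) (theta : probability (lattice d) R).
Hypothesis mu_crit : critical mu.
Let m j := mu [set j].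
Let t z := theta [set z].
Let m_ge0 j : 0 <= m j. Proof. exact: measure_ge0. Qed.
Let t_ge0 z : 0 <= t z. Proof. exact: measure_ge0. Qed.
Let t_sum1 : \esum_(z in [set: lattice d]) t z = 1. Proof. exact: jump_sum1. Qed.

Context {d1 : measure_display} {Om1 : measurableType d1}.
Variable P1 : probability Om1 R.
Variables (N : seq nat -> {RV P1 >-> nat}) (X : seq nat -> {RV P1 >-> lattice d}).
Hypothesis NX : is_tree_walk N X mu theta.
Context {d2 : measure_display} {Om2 : measurableType d2}.
Variable P2 : probability Om2 R.
Variables (S' : nat -> {RV P2 >-> (nat * nat)%type})
  (N' : vertex -> {RV P2 >-> nat}) (X' : vertex -> {RV P2 >-> lattice d}).
Hypothesis SNX : is_inf_tree_walk S' N' X' mu theta.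

Variables (Sigma : 'M[R]_d) (C : R) (D : nat).
Hypothesis dE : d = D.+2.
Hypothesis D_gt0 : (0 < D)%N.
Hypothesis Sigma_unit : Sigma \in unitmx.
Hypothesis C_gt0 : (0 < C)%R.
Local Notation gr := (green_fun t).
Hypothesis gr_asymp : forall e : R, (0 < e)%R ->
  \forall x \near lattice_infty R d,
    (`|gr x - C * (sigma_norm Sigma x ^+ D)^-1|
      <= e * (C * (sigma_norm Sigma x ^+ D)^-1))%R.
Hypothesis psi_sum :
  \esum_(j in [set: nat]) (dyadic_term (psi mu) D j)%:E < +oo.
Let rho : R := ((2 ^+ D)^-1)%R.

Variable A : set (lattice d).
Hypothesis finA : finite_set A.
Let F : {fset lattice d} := fset_set A.

Let AF y : (y \in A) = (y \in F).
Proof. by rewrite in_fset_set. Qed.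

Let q := avoid_limit N X A.
Let q01 y : 0 <= q y <= 1. Proof. exact: (avoid_limit01 NX A y). Qed.
Let s y : R := fine (step t q y).

Let s_spec y : step t q y = (s y)%:E /\ (0 <= s y <= 1)%R.
Proof.
by have [r rE r01] := step_avoid_real t_ge0 t_sum1 q01 y; rewrite /s rE /=.
Qed.

Let sE y : step t q y = (s y)%:E. Proof. by case: (s_spec y). Qed.
Let s01 y : (0 <= s y <= 1)%R. Proof. by case: (s_spec y). Qed.

Let kap y : R := fine (branch_gf m (step t q y)).

Let kapE y : branch_gf m (step t q y) = (kap y)%:E.
Proof. by rewrite /kap fineK// sE branch_gf_fin. Qed.

Let kap01 y : (0 <= kap y <= 1)%R.
Proof.
have /andP[s0 _] := s01 y.
rewrite -!lee_fin -kapE sE branch_gf_ge0//=.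
exact: (branch_gf_le1 m_ge0 (offspring_mean mu_crit) (s01 y)).
Qed.

Let r y : R := fine (gf m (s y)%:E).

Let rE y : gf m (step t q y) = (r y)%:E.
Proof.
have /andP[s0 _] := s01 y; rewrite sE /r; apply/esym/fineK.
rewrite ge0_fin_numE; last exact: gf_ge0.
apply: (@le_lt_trans _ _ 1); last exact: ltry.
exact: (gf_le1 m_ge0 (offspring_sum1 mu) (s01 y)).
Qed.

Let r01 y : (0 <= r y <= 1)%R.
Proof.
have /andP[s0 _] := s01 y; rewrite -!lee_fin -rE sE gf_ge0//=.
exact: (gf_le1 m_ge0 (offspring_sum1 mu) (s01 y)).
Qed.

Let u (y : lattice d) : \bar R := ((y \in A)%:R)%:E.
Let f (y : lattice d) : \bar R := ((y \in A)%:R * r y)%:E.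
Let f' (y : lattice d) : \bar R := ((y \in A)%:R * (1 - r y))%:E.
Let p y : \bar R := (hit_prob N X A y)%:E.

Let u_ge0 y : 0 <= u y. Proof. by rewrite lee_fin. Qed.
Let f_ge0 y : 0 <= f y.
Proof. by rewrite lee_fin mulr_ge0//; case/andP: (r01 y). Qed.
Let f'_ge0 y : 0 <= f' y.
Proof. by rewrite lee_fin mulr_ge0// subr_ge0; case/andP: (r01 y). Qed.
Let ff'u y : f y + f' y = u y.
Proof. by rewrite -EFinD -mulrDr addrC subrK mulr1. Qed.

Let pq y : p y + q y = 1.
Proof. by rewrite /p (avoid_limit_hit NX A y) subeK// (avoid_limit_fin NX A). Qed.

Let p_ge0 y : 0 <= p y.
Proof.
rewrite /p (avoid_limit_hit NX A y) leeBrDr; last exact: (avoid_limit_fin NX A).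
by rewrite add0e; case/andP: (q01 y).
Qed.

Let q_ge0 y : 0 <= q y. Proof. by case/andP: (q01 y). Qed.

Let step_p y : step t p y = (1 - s y)%:E.
Proof.
have : step t p y + (s y)%:E = 1.
  rewrite -sE -stepD// -[RHS](step_cst t_ge0 t_sum1 y (@lee01 R)).
  by apply: eq_step => z; exact: pq.
move=> H; rewrite EFinB -H addeK//.
Qed.

(** First step analysis at the root: either it is in A, or some child, hence a
    last one, starts a tree that hits A. *)
Let hit_prob_eq y : p y = f y + damp t kap p y.
Proof.
have := branch_gf_gf m_ge0 (offspring_sum1 mu) (s01 y).
rewrite -sE kapE rE -EFinM -EFinD => -[kr].
rewrite /damp step_p -EFinM -EFinD /p (avoid_limit_hit NX A y).
rewrite (avoid_limit_rec NX A y) rE /outside /f.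
case: (y \in A) => /=.
  transitivity ((1 - 0 * r y)%:E : \bar R); first by rewrite EFinB.
  by congr _%:E; rewrite -[X in (X - _)%R]kr; ring.
transitivity ((1 - 1 * r y)%:E : \bar R); first by rewrite EFinB.
by congr _%:E; rewrite -[X in (X - _)%R]kr; ring.
Qed.

Let grE y : pot t delta0 y = (gr y)%:E.
Proof. exact: (pot_delta_fin dE t_ge0 Sigma_unit C_gt0 gr_asymp). Qed.

Let uE : u = fun y => ((y \in F)%:R)%:E.
Proof. by apply/funext => y; rewrite /u AF. Qed.

Let hit_prob_damped y : p y = damped_pot t kap f y.
Proof.
apply: (damped_fixpoint t_ge0 kap01 f_ge0 p_ge0 u_ge0 hit_prob_eq).
  by move=> z; exact: hit_prob_pot NX _ mu_crit z.
move=> z; rewrite uE (pot_finite_set dE t_ge0 Sigma_unit C_gt0 gr_asymp).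
exact: ltry.
Qed.

Let total k := \esum_(y in [set: lattice d]) iter k (damp t kap) f y.

Let start a (y : lattice d) : \bar R := gf m (step t q y) * delta0 (y - a)%R.

Let start_ge0 a y : 0 <= start a y.
Proof.
by rewrite /start rE -EFinM lee_fin mulr_ge0//; case/andP: (r01 y).
Qed.

Let indic_sum y : ((y \in F)%:R)%:E = \sum_(a <- F) delta0 (y - a)%R :> \bar R.
Proof.
rewrite /delta0 sumEFin; congr _%:E.
transitivity (\sum_(a <- F) ((a == y)%:R : R))%R; last first.
  by apply: eq_bigr => a _; rewrite subr_eq0 eq_sym.
have [yF|yF] := boolP (y \in F).
  rewrite (big_fsetD1 y)//= eqxx big_seq big1 ?addr0// => a.
  by rewrite !inE => /andP[/negPf ->].
rewrite big_seq big1// => a aF; case: eqP => // ay.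
by rewrite -ay aF in yF.
Qed.

Let f_start y : f y = \sum_(a <- F) start a y.
Proof.
rewrite /start -ge0_sume_distrr; last by move=> a _; exact: delta0_ge0.
by rewrite -indic_sum rE /f AF -EFinM mulrC.
Qed.

Let spineE a k y : spine_prob m t q a k y = iter k (damp t kap) (start a) y.
Proof.
rewrite /spine_prob; congr (iter _ _ _ _); apply/funext => g; apply/funext => z.
by rewrite kapE.
Qed.

Let total_start k :
  total k = \sum_(a <- F) \esum_(y in [set: lattice d]) spine_prob m t q a k y.
Proof.
rewrite /total (_ : f = fun y => \sum_(a <- F) start a y); last exact/funext.
rewrite -esum_sum; last first.
  by move=> y a _ _; rewrite spineE; exact: damps_ge0.
apply: eq_esum => y _; rewrite damps_sum//.
by apply: eq_bigr => a _; rewrite spineE.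
Qed.

Let escape a := escape_prob S' N' X' A a.

Let escape_cvg a :
  \esum_(y in [set: lattice d]) spine_prob m t q a k y @[k --> \oo] --> escape a.
Proof.
exact: (escape_prob_cvg SNX (avoid_limit_cvg NX (A := A))).
Qed.

Let spine_ge0 a k : 0 <= \esum_(y in [set: lattice d]) spine_prob m t q a k y.
Proof. by apply: esum_ge0 => y _; rewrite spineE; exact: damps_ge0. Qed.

Let escape_fin a : escape a \is a fin_num.
Proof.
have le1 : escape a <= 1.
  rewrite -(cvg_lim _ (@escape_cvg a))//; apply: lime_le.
    by apply/cvg_ex; exists (escape a); exact: escape_cvg.
  apply: nearW => k; apply: (@le_trans _ _
    (\esum_(y in [set: lattice d]) iter k (step t) (start a) y)).
    by apply: le_esum => y _; rewrite spineE; exact: damps_le_steps.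
  rewrite esum_steps// -[leRHS](esum_delta0 a).
  apply: le_esum => y _; rewrite -[leRHS]mul1e; apply: lee_wpmul2r.
    exact: delta0_ge0.
  by rewrite rE lee_fin; case/andP: (r01 y).
have ge0 : 0 <= escape a.
  rewrite -(cvg_lim _ (@escape_cvg a))//; apply: lime_ge.
    by apply/cvg_ex; exists (escape a); exact: escape_cvg.
  exact: nearW.
by rewrite ge0_fin_numE// (le_lt_trans le1)// ltry.
Qed.

Let BCapE : (BCap S' N' X' A)%:E = \sum_(a <- F) escape a.
Proof.
rewrite /BCap fsbig_finite//= -sumEFin; apply: eq_bigr => a _.
by rewrite fineK//; exact: escape_fin.
Qed.

(** Summed over the points a of A, the mass at time k is the probability that
    the branches leaving the spine at c_0, ..., c_{-k} avoid A. *)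
Let total_cvg : total k @[k --> \oo] --> (BCap S' N' X' A)%:E.
Proof.
rewrite BCapE (_ : total = fun k => \sum_(a <- F)
  \esum_(y in [set: lattice d]) spine_prob m t q a k y); last first.
  by apply/funext => k; exact: total_start.
apply: cvg_nnesum => [a _|a _]; last exact: escape_cvg.
by apply: nearW => k; exact: spine_ge0.
Qed.

Let total_dec : {homo total : k l / (k <= l)%N >-> k >= l}.
Proof.
apply/nonincreasing_seqP => k; rewrite /total.
have fk0 := damps_ge0 t_ge0 kap01 k f_ge0.
rewrite -(esum_step t_ge0 t_sum1 fk0); apply: le_esum => y _.
rewrite iterS -[leRHS]mul1e; apply: lee_wpmul2r; first exact: step_ge0.
by rewrite lee_fin; case/andP: (kap01 y).
Qed.

Let rho_gt0 : (0 < rho)%R. Proof. by rewrite invr_gt0 exprn_gt0. Qed.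

Let rho_le1 i : (0 < rho ^+ i <= 1)%R.
Proof.
rewrite exprn_gt0//= exprn_ile1//; first exact: ltW.
by rewrite invf_le1 ?exprn_gt0// exprn_ege1// ler1n.
Qed.

Let kap_psi y : (1 - kap y = psi mu (1 - s y))%R.
Proof. by rewrite /psi subKr /kap sE. Qed.

(** The damping at y is governed by the chance to hit A from there, hence by
    the level of y, up to a shift i0 that absorbs constants. *)
Let kap_level : exists i0, forall y,
  (1 - kap y <= psi mu (rho ^+ (lev y - i0)))%R.
Proof.
have [c c0 Hc] := pot_finite_set_upper dE t_ge0 Sigma_unit C_gt0 gr_asymp F.
pose i0 := (Num.truncn c).+1; exists i0 => y.
have ci0 : (c <= (2 ^+ D) ^+ i0)%R.
  apply: (@le_trans _ _ i0%:R); first exact/ltW/truncnS_gt.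
  apply: (@le_trans _ _ (2 ^+ i0)%R).
    by rewrite -natrX ler_nat ltnW// ltn_expl.
  apply: lerXn2r; rewrite ?nnegrE ?exprn_ge0//.
  by rewrite -[leLHS]expr1 ler_weXn2l// ler1n.
have hit_le : (1 - s y <= c * rho ^+ lev y)%R.
  rewrite -lee_fin -step_p; apply: le_trans (Hc y); rewrite -uE.
  apply: (@le_trans _ _ (step t (pot t u) y)).
    by apply: le_step => // z; exact: hit_prob_pot NX _ mu_crit z.
  have /= -> := steps_pot t_ge0 1 y u_ge0.
  rewrite (pot_split t_ge0 1 y u_ge0) leeDr// big_nat1.
  exact: u_ge0.
have /andP[s0 s1] := s01 y; have /andP[rj0 rj1] := rho_le1 (lev y - i0).
rewrite kap_psi; apply: le_psi => //; first by rewrite subr_ge0.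
have [li|il] := leqP (lev y) i0.
  have -> : (lev y - i0 = 0)%N by apply/eqP; rewrite subn_eq0.
  by rewrite expr0 gerBl.
apply: le_trans hit_le _.
rewrite -{1}(subnKC (ltnW il)) exprD mulrA -[leRHS]mul1r; apply: ler_wpM2r.
  exact: ltW.
rewrite -[leRHS](_ : (2 ^+ D) ^+ i0 * rho ^+ i0 = 1)%R.
  by apply: ler_wpM2r => //; case/andP: (rho_le1 i0) => /ltW.
by rewrite -exprMn mulfV ?expr1n// gt_eqF// exprn_gt0.
Qed.

Let level_sum i0 :
  \esum_(j in [set: nat]) (4 ^+ j * psi mu (rho ^+ (j - i0)))%:E < +oo.
Proof.
have pos j : 0 <= (4 ^+ j * psi mu (rho ^+ (j - i0)))%:E.
  rewrite lee_fin mulr_ge0 ?exprn_ge0// psi_ge0//.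
  by case/andP: (rho_le1 (j - i0)) => /ltW -> ->.
rewrite (@esum_nat_split _ _ i0)// sumEFin lte_add_pinfty ?ltry//.
rewrite (_ : (fun n => _) = fun j => (4 ^+ i0)%:E * (dyadic_term (psi mu) D j)%:E).
  rewrite esumZl ?lee_fin ?exprn_ge0//; last first.
    move=> j; rewrite lee_fin mulr_ge0 ?exprn_ge0// psi_ge0//.
    by case/andP: (rho_le1 j) => /ltW -> ->.
  by rewrite lte_mul_pinfty// lee_fin exprn_ge0.
apply/funext => j; rewrite -EFinM /dyadic_term addKn exprD.
by rewrite mulrA.
Qed.

Let late (e : R) : (0 < e)%R ->
  (exists m0, forall k, (m0 <= k)%N -> \forall x \near lattice_infty R d,
    pot t (late_loss t kap u k) x <= (e * gr x)%:E) /\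
  (exists k, \esum_(y in [set: lattice d]) late_loss t kap u k y < e%:E).
Proof.
move=> e0; have [i0 kap_b] := kap_level.
have [c1 c10 gr_up] := green_fun_upper t_ge0 Sigma_unit C_gt0 gr_asymp.
have [c2 c20 gr_low] := green_fun_lower Sigma_unit C_gt0 gr_asymp.
have [c3 c30] := pot_finite_set_upper dE t_ge0 Sigma_unit C_gt0 gr_asymp F.
rewrite -uE => u_up.
have b0 j : (0 <= psi mu (rho ^+ (j - i0)))%R.
  by rewrite psi_ge0//; case/andP: (rho_le1 (j - i0)) => /ltW -> ->.
have b_dec i j : (i <= j)%N ->
    (psi mu (rho ^+ (j - i0)) <= psi mu (rho ^+ (i - i0)))%R.
  move=> ij; apply: le_psi => //.
  - by case/andP: (rho_le1 (j - i0)) => /ltW.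
  - apply: ler_wiXn2l; [exact: ltW| |exact: leq_sub2r].
    by case/andP: (rho_le1 1).
  - by case/andP: (rho_le1 (i - i0)).
have gr0 := green_fun_ge0 t_ge0.
split.
  exact: (late_loss_small dE t_ge0 kap01 u_ge0 c30 u_up b0 b_dec kap_b (level_sum i0)
    gr0 grE c10 gr_up c20 gr_low near_lev e0).
have [m0 Hm0] := late_mass_small dE t_ge0 kap01 u_ge0 c30 u_up b0 kap_b
  (level_sum i0) e0.
by exists m0; exact: Hm0.
Qed.

Let u_sum : \esum_(y in [set: lattice d]) u y = (#|` F|%:R)%:E.
Proof.
transitivity (\esum_(y in [set: lattice d]) (\sum_(a <- F) delta0 (y - a)%R : \bar R)).
  by apply: eq_esum => y _; rewrite /u AF indic_sum.
rewrite esum_sum; last by move=> y a _ _; exact: delta0_ge0.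
under eq_bigr do rewrite esum_delta0.
by rewrite sumEFin big_const_seq count_predT iter_addr_0.
Qed.

Lemma hit_prob_two_sided (e : R) : (0 < e)%R ->
  \forall x \near lattice_infty R d,
    ((BCap S' N' X' A - e) * gr x <= hit_prob N X A x
      <= (BCap S' N' X' A + e) * gr x)%R.
Proof.
move=> e0.
have gr0 := green_fun_ge0 t_ge0.
have shift := green_fun_shift t_ge0 Sigma_unit C_gt0 gr_asymp.
have pot_u (e' : R) : (0 < e')%R -> \forall x \near lattice_infty R d,
    pot t u x <= ((#|` F|%:R + e') * gr x)%:E.
  rewrite uE; exact: (pot_finite_set_asymp dE t_ge0 Sigma_unit C_gt0 gr_asymp).
have late1 (e' : R) (e'0 : (0 < e')%R) := (late e'0).1.
have := damped_pot_asymp t_ge0 t_sum1 kap01 (F := lattice_infty R d) gr0 grE shift f_ge0 f'_ge0 ff'u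
  u_sum pot_u late1 total_cvg total_dec e0.
move=> /(_ (lattice_infty_filter R d)); apply: filterS => x.
by rewrite -hit_prob_damped !lee_fin.
Qed.

(** This is what turns an additive error into a relative one. *)
Lemma BCap_gt0 : A !=set0 -> (0 < BCap S' N' X' A)%R.
Proof.
move=> [a Aa].
have F0 : (0 < #|` F|%:R :> R)%R.
  rewrite ltr0n cardfs_gt0; apply/fset0Pn; exists a.
  by rewrite -AF inE.
have [k0 k00 Hk0] := branch_gf_pos m_ge0 (offspring_sum1 mu) (offspring_mean mu_crit).
have kap_low y : (k0 <= kap y)%R.
  by rewrite -lee_fin -kapE sE; apply: Hk0; case/andP: (s01 y).
have m0 := extinct_at_once_pos mu_crit.
have c00 : (0 < fine (m 0%N))%R.
  by rewrite fine_gt0// m0 ltey_eq fin_num_measure.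
have f_low y : (fine (m 0%N))%:E * u y <= f y.
  rewrite /u /f -EFinM lee_fin mulrC; apply: ler_wpM2l => //.
  rewrite -lee_fin -rE sE fineK ?fin_num_measure//.
  by apply: gf_ge => //; case/andP: (s01 y).
have late2 (e' : R) (e'0 : (0 < e')%R) := (late e'0).2.
have [b b0 [k Hk]] := damped_mass_pos t_ge0 t_sum1 kap01 u_ge0 u_sum F0 k00 kap_low
  c00 f_low late2.
apply: (lt_le_trans b0); rewrite -lee_fin -(cvg_lim _ total_cvg)//.
apply: lime_ge; first by apply/cvg_ex; exists (BCap S' N' X' A)%:E; exact: total_cvg.
by exists k => // j /= kj; rewrite -(subnKC kj); exact: Hk.
Qed.

End Assembly.

(** Comparing with the Green function at the opposite point costs nothing, both
    being equivalent to the same even function. *)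
Lemma two_sided_compare (R : realFieldType) (B e p g g' h : R) :
  0 < B -> 0 < e -> e <= 1 -> 0 <= h ->
  `|g - h| <= e / 16 * h -> `|g' - h| <= e / 16 * h ->
  (B - B * e / 8) * g <= p <= (B + B * e / 8) * g ->
  `|p - B * g'| <= e * `|B * g'|.
Proof.
move=> B0 e0 e1 h0; rewrite !ler_norml => /andP[g1 g2] /andP[h1 h2] /andP[p1 p2].
have eh : 0 <= e * h by rewrite mulr_ge0// ltW.
have eh1 : e * h <= h by rewrite ler_piMl.
have g'0 : 0 <= g' by lra.
have g0 : 0 <= g by lra.
have hg' : h <= 2 * g' by lra.
have ehg' : e * h <= 2 * (e * g').
  by rewrite [leRHS]mulrCA ler_wpM2l// ltW.
have gg' : g - g' <= e * g' / 4 by lra.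
have g'g : g' - g <= e * g' / 4 by lra.
rewrite (ger0_norm (mulr_ge0 (ltW B0) g'0)).
have eg' : 0 <= e * g' by rewrite mulr_ge0// ltW.
have eg1 : e * g <= 2 * (e * g').
  have eg'1 : e * g' <= g' by rewrite ler_piMl.
  have gle : g <= 2 * g' by lra.
  by rewrite [leRHS]mulrCA ler_wpM2l// ltW.
have q1 : B * g - B * (e * g) / 8 <= p by apply: le_trans p1; lra.
have q2 : p <= B * g + B * (e * g) / 8 by apply: le_trans p2 _; lra.
have r1 : B * g <= B * g' + B * (e * g') / 4.
  have : B * (g - g') <= B * (e * g' / 4) by rewrite ler_wpM2l// ltW.
  lra.
have r2 : B * g' <= B * g + B * (e * g') / 4.
  have : B * (g' - g) <= B * (e * g' / 4) by rewrite ler_wpM2l// ltW.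
  lra.
have r3 : B * (e * g) <= 2 * (B * (e * g')).
  by rewrite [leRHS]mulrCA ler_wpM2l// ltW.
have r4 : 0 <= B * (e * g') by rewrite mulr_ge0// ltW.
by apply/andP; split; lra.
Qed.

Theorem theorem1p11 (R : realType) (d : nat)
  (alpha : R) (L : R -> R)
  (mu : probability nat R)
  (theta : probability (lattice d) R) (Sigma : 'M[R]_d)
  (* a random walk with theta-jumps started at 0 *)
  (d0 : measure_display) (Om0 : measurableType d0) (P0 : probability Om0 R)
  (xi : nat -> {RV P0 >-> lattice d})
  (* the T-walk *)
  (d1 : measure_display) (Om1 : measurableType d1) (P1 : probability Om1 R)
  (N : seq nat -> {RV P1 >-> nat}) (X : seq nat -> {RV P1 >-> lattice d})
  (* the T_infty-walk *)
  (d2 : measure_display) (Om2 : measurableType d2) (P2 : probability Om2 R)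
  (S' : nat -> {RV P2 >-> (nat * nat)%type})
  (N' : vertex -> {RV P2 >-> nat}) (X' : vertex -> {RV P2 >-> lattice d}) :
  1 < alpha <= 2 ->
  critical mu ->
  in_dom mu alpha L ->
  centered_nondegenerate theta ->
  is_sqrtmx Sigma (cov_matrix theta) ->
  walk_steps xi theta ->
  is_tree_walk N X mu theta ->
  is_inf_tree_walk S' N' X' mu theta ->
  (fun x : lattice d => fine (green xi x)) ~_(lattice_infty R d)
    (fun x => C_green theta * sigma_norm Sigma x `^ (2 - d%:R)) ->
  (2 * alpha / (alpha - 1) < d%:R \/
   (d%:R = 2 * alpha / (alpha - 1) /\
    (\sum_(1 <= n <oo) (L (n%:R `^ (2 / (alpha - 1))) / n%:R)%:E < +oo)%E)) ->
  finite_moment theta d.-1 ->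
  forall A : set (lattice d), finite_set A ->
    (fun x : lattice d => hit_prob N X A x) ~_(lattice_infty R d)
      (fun x => BCap S' N' X' A * fine (green xi x)).
Proof.
move=> /andP[alpha1 alpha2] mu_crit mu_dom [_ _ cov_unit] sqrtS xi_steps NX SNX.
move=> green_asymp dim _ A finA.
have a0 : 0 < alpha - 1 by rewrite subr_gt0.
have aE : 2 * alpha / (alpha - 1) = 2 + 2 / (alpha - 1).
  by field; rewrite gt_eqF.
have a2 : 2 <= 2 / (alpha - 1) by rewrite ler_pdivlMr//; lra.
(* As alpha <= 2, the condition on d forces d >= 2 + 2 / (alpha - 1) >= 4. *)
have d4 : (3 < d)%N.
  by rewrite -(ler_nat R); case: dim => [|[-> _]]; rewrite aE; lra.
have [D dE] : exists D, d = D.+2 by exists d.-2; lia.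
have D0 : (0 < D)%N by lia.
have DE : D%:R = d%:R - 2 :> R by rewrite dE -[D.+2]addn2 natrD addrK.
have Sigma_unit : Sigma \in unitmx.
  move: cov_unit; case: sqrtS => _ _ <-; rewrite !unitmxE det_mulmx !unitfE.
  by rewrite mulf_eq0 orbb.
have C0 := C_green_gt0 d4 cov_unit sqrtS.
set C := C_green theta in C0 green_asymp *.
pose t z := theta [set z].
(* Potentials look for the walk that leads from x to 0, hence the sign. *)
have greenE x : fine (green xi x) = green_fun t (- x).
  by rewrite (green_pot xi_steps).
have powE x : sigma_norm Sigma x `^ (2 - d%:R) = (sigma_norm Sigma x ^+ D)^-1.
  by rewrite -opprB -DE powR_invn// eucl_ge0.
have gr_asymp' (e : R) : 0 < e -> \forall x \near lattice_infty R d,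
    `|green_fun t (- x) - C * (sigma_norm Sigma x ^+ D)^-1|
      <= e * (C * (sigma_norm Sigma x ^+ D)^-1).
  move=> e0; move/eqaddoP : green_asymp => /(_ e e0); apply: filterS => x.
  rewrite /= !fctE greenE powE => /le_trans; apply.
  by rewrite ger0_norm// mulr_ge0 ?invr_ge0 ?exprn_ge0 ?eucl_ge0// ltW.
have gr_asymp (e : R) : 0 < e -> \forall x \near lattice_infty R d,
    `|green_fun t x - C * (sigma_norm Sigma x ^+ D)^-1|
      <= e * (C * (sigma_norm Sigma x ^+ D)^-1).
  move=> /gr_asymp' /near_lattice_opp; apply: filterS => x.
  by rewrite opprK sigma_normN.
have psi_sum : (\esum_(j in [set: nat]) (dyadic_term (psi mu) D j)%:E < +oo)%E.
  have [L_slow _] := mu_dom.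
  have psiE e := psi_in_dom mu_crit (e := e) alpha1 mu_dom.
  have psi0 (e : R) : 0 < e <= 1 -> 0 <= psi mu e.
    by move=> /andP[/ltW e0 e1]; apply: psi_ge0 => //; rewrite e0.
  case: dim => [dbig|[dcrit Lsum]].
    by apply: (dyadic_sum_ratio alpha1 D0 L_slow psiE psi0); rewrite DE; lra.
  apply: (dyadic_sum_critical alpha1 psiE psi0 _ _ Lsum).
    by move=> e e' /ltW e0; exact: le_psi.
  by rewrite DE; lra.
apply/eqaddoP => e e0.
have [A0|A_neq0] := eqVneq A set0.
  apply: nearW => x; rewrite !fctE A0 /BCap fsbig_set0 mul0r subr0.
  rewrite /hit_prob (_ : [set w | _] = set0) ?measure0 ?normr0 ?mulr0//.
  by apply/seteqP; split=> // w /=; rewrite setI0 => -[].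
have B0 : 0 < BCap S' N' X' A.
  exact: (BCap_gt0 mu_crit NX SNX dE D0 Sigma_unit C0 gr_asymp psi_sum finA
    ((set0P A).1 A_neq0)).
pose e' := Num.min e 1.
have e'0 : 0 < e' by rewrite lt_min e0 ltr01.
have e'1 : e' <= 1 by rewrite ge_min lexx orbT.
have e'e : e' <= e by rewrite ge_min lexx.
have Be0 : 0 < BCap S' N' X' A * e' / 8 by rewrite divr_gt0// mulr_gt0.
have e16 : 0 < e' / 16 by rewrite divr_gt0.
near=> x.
rewrite !fctE greenE.
apply: (@le_trans _ _ (e' * `|BCap S' N' X' A * green_fun t (- x)|)); last first.
  by apply: ler_wpM2r.
apply: (two_sided_compare (g := green_fun t x)
    (h := C * (sigma_norm Sigma x ^+ D)^-1)) => //.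
- by rewrite mulr_ge0 ?invr_ge0 ?exprn_ge0 ?eucl_ge0// ltW.
- by near: x; exact: gr_asymp.
- by near: x; exact: gr_asymp'.
- by near: x; exact: (hit_prob_two_sided mu_crit NX SNX dE D0 Sigma_unit C0
    gr_asymp psi_sum finA Be0).
Unshelve. all: by end_near. Qed.
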